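(* Let $v\in\mathbb{C}$ with $\Re(v)>\frac12$. For every complex $s\neq 1$, the Hurwitz zeta function satisfies, for either choice of the sign $\pm$, $$\zeta(s,v)=\frac{\pi}{2(s-1)}\int_{-\infty}^{+\infty}\frac{\left(v-\frac12\pm ix\right)^{1-s}}{\cosh^2 \pi x}\,dx ,$$ and also $$\zeta(s,v)=\frac{\pi}{2(s-1)}\int_{0}^{\infty}\frac{\left(v-\frac12-ix\right)^{1-s}+\left(v-\frac12+ix\right)^{1-s}}{\cosh^2\pi x}\,dx$$ and $$\zeta(s,v)=\frac{\pi}{s-1}\int_0^\infty \frac{\cos\left[(s-1)\arctan\frac{2x}{2v-1}\right]}{\left(v^2-v+\frac14+x^2\right)^{\frac12(s-1)}\cosh^2\pi x}\,dx .$$ Moreover, for every integer $n\ge 0$, the generalized Stieltjes constants satisfy, for either choice of the sign $\pm$, $$\gamma_n(v)=-\frac{\pi}{2(n+1)}\int_{-\infty}^{+\infty}\frac{\log^{n+1}\left(v-\frac12\pm ix\right)}{\cosh^2\pi x}\,dx$$ and $$\gamma_n(v)=-\frac{\pi}{2(n+1)}\int_{0}^{\infty}\frac{\log^{n+1}\left(v-\frac12-ix\right)+\log^{n+1}\left(v-\frac12+ix\right)}{\cosh^2\pi x}\,dx .$$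
   Context: The Hurwitz zeta function is $\zeta(s,v)=\sum_{k=0}^\infty (k+v)^{-s}$ (for $\Re(s)>1$, $v\in\mathbb{C}\setminus\{0,-1,-2,\ldots\}$), extended by analytic continuation to all complex $s\ne1$; it has a simple pole at $s=1$. The generalized Stieltjes constants $\gamma_n(v)$ are defined by the Laurent expansion $$\zeta(s,v)=\frac{1}{s-1}+\sum_{n=0}^\infty\frac{(-1)^n}{n!}\gamma_n(v)(s-1)^n,\qquad s\in\mathbb{C}\setminus\{1\}.$$ Logarithms, complex powers and $\arctan$ take their principal values, and $\log^{k} w$ means $(\log w)^k$. *)

(* Defs.v *)
From Stdlib Require Import Reals Factorial ClassicalEpsilon.
From Coquelicot Require Import Coquelicot.
Open Scope C_scope.

Definition Cexp (z : C) : C :=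
  (exp (Re z) * cos (Im z), exp (Re z) * sin (Im z))%R.

Definition Ccos (z : C) : C := (Cexp (Ci * z) + Cexp (- (Ci * z))) / 2.

(* Principal argument, in (-PI, PI]; the value at 0 is meaningless. *)
Definition Carg (z : C) : R :=
  if Rle_dec 0 (Im z) then acos (Re z / Cmod z) else (- acos (Re z / Cmod z))%R.

Definition Clog (z : C) : C := (ln (Cmod z), Carg z).

(* Principal value of z ^ w for z <> 0 (complex analogue of Rpower;
   Coquelicot's Cpow is the natural power). *)
Definition Cpower (z w : C) : C := Cexp (w * Clog z).

(* Principal arctangent: the plane is cut along the imaginary axis from i and -i
   outwards to infinity. *)
Definition Carctan (z : C) : C :=
  Ci / 2 * (Clog (1 - Ci * z) - Clog (1 + Ci * z)).

Definition is_int_line (f : R -> C) (I : C) : Prop :=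
  is_RInt_gen (V := C_R_NormedModule) f
    (Rbar_locally m_infty) (Rbar_locally p_infty) I.

Definition is_int_halfline (f : R -> C) (I : C) : Prop :=
  is_RInt_gen (V := C_R_NormedModule) f
    (at_point 0%R) (Rbar_locally p_infty) I.

Definition is_Cseries (a : nat -> C) (l : C) : Prop :=
  is_series (K := C_AbsRing) (V := C_NormedModule) a l.

Definition analytic_at (f : C -> C) (s0 : C) : Prop :=
  exists a : nat -> C,
    locally (T := C_UniformSpace) s0
      (fun s => is_Cseries (fun n => a n * (s - s0) ^ n) (f s)).

(* f is the analytic continuation to C \ {1} of the series defining zeta(., v).
   This determines f s for all s <> 1; f 1 is unconstrained. *)
Definition is_hurwitz_zeta (v : C) (f : C -> C) : Prop :=
  (forall s : C, s <> 1 -> analytic_at f s) /\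
  (forall s : C, (1 < Re s)%R ->
     is_Cseries (fun k => Cpower (INR k + v) (- s)) (f s)).

Definition hurwitz_zeta (s v : C) : C :=
  epsilon (inhabits (fun _ : C => RtoC 0)) (is_hurwitz_zeta v) s.

(* g is the sequence of Laurent coefficients of zeta(., v) at its simple pole 1,
   normalised as (-1)^n g n / n!, with principal part 1 / (s - 1). *)
Definition is_stieltjes (v : C) (g : nat -> C) : Prop :=
  forall s : C, s <> 1 ->
    is_Cseries (fun n => (- (1)) ^ n / INR (fact n) * g n * (s - 1) ^ n)
      (hurwitz_zeta s v - 1 / (s - 1)).

Definition stieltjes (n : nat) (v : C) : C :=
  epsilon (inhabits (fun _ : nat => RtoC 0)) (is_stieltjes v) n.

(* Main.v *)
Require Import Defs.
From Stdlib Require Import Reals Arith Factorial Lra Lia.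
From Stdlib Require Import Classical ClassicalEpsilon FunctionalExtensionality.
From Coquelicot Require Import Coquelicot.
Open Scope C_scope.

(** Put F(z) = z^(1-s) and K(x) = 1 / cosh^2(pi x).  The kernel K is the restriction of
1 / sin^2(pi w) to each of the lines Re w = 1/2 and Re w = -1/2, and between these lines
1 / sin^2(pi w) has just one pole, a double pole at 0.  The residue theorem on the strip
therefore gives, for Re b > 1/2,
   int (F(b + 1/2 + ix) - F(b - 1/2 + ix)) K(x) dx = (2 / pi) F'(b)
([difference_integral], with int K = 2 / pi from [line_int_sech2]).  With b = v + k the left
side is a difference of consecutive values of J(a) = int (a + ix)^(1-s) K(x) dx, at
a = v + k + 1/2 and a = v + k - 1/2, so the sum over k of (v + k)^(-s) telescopes
([exp_moment_step]); when Re s > 1 the far end vanishes ([exp_moment_vanishes]), and the series is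
pi / (2 (s - 1)) J(v - 1/2).

As a function of s this expression is analytic off 1: J is a superposition of the entire
functions exp((1-s) L), L = log(v - 1/2 + ix), and expanding the exponential under the integral
sign ([exp_moment_expansion]) gives a power series around every point, which may be divided by
s - 1 ([analytic_quotient]).  The identity theorem ([identity_theorem]) then makes it the value of
the analytic continuation at every s <> 1 ([hurwitz_zeta_integral]).  The same expansion
around s = 1, where the zeroth moment 2 / pi produces the polar part, exhibits the Laurent
coefficients as moments of L ([stieltjes_integral_spec]).

The two signs and the half-line integrals come from the evenness of K, and the arctangent form
from log(a + ix) + log(a - ix) = log(a^2 + x^2) and
arctan(x / a) = (i / 2) (log(a - ix) - log(a + ix)), which hold without correction terms
because Re a > 0 keeps all arguments inside (-pi / 2, pi / 2) ([arctan_form]).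

The residue theorem is obtained without contours.  Subtracting from F its Taylor polynomial of
degree 2 at b leaves T with T(w) = O(w^3), and the integral of T / sin^2 over the line
Re w = t does not depend on t for t <> 0, since d/dt = -i d/dx under the integral sign
([vertical_integral_deriv]); across t = 0 it does not jump because T / sin^2 is
Lipschitz there ([gap_pointwise]).  The subtracted polynomial contributes F'(b) K and an odd
function.  All integrands are bounded by a multiple of exp(-|x|): the logarithm grows so slowly
that any exponential of it is O(exp|x|) on vertical lines ([Clog_growth]), while
K(x) = O(exp(-2|x|)). *)

(** * Calculus along complex-valued curves *)

Lemma C_ext (z w : C) : Re z = Re w -> Im z = Im w -> z = w.
Proof. destruct z, w; simpl; intros -> ->; reflexivity. Qed.

(** Differentiability along real curves, by components: it is all that is needed of complex
analyticity here, because a function of z is only ever differentiated along lines. *)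
Definition Cderiv (f : R -> C) (t : R) (l : C) : Prop :=
  is_derive (fun u => Re (f u)) t (Re l) /\
  is_derive (fun u => Im (f u)) t (Im l).

Definition Ccont {U : UniformSpace} (f : U -> C) (x : U) : Prop :=
  continuous (U := R_UniformSpace) (fun u => Re (f u)) x /\
  continuous (U := R_UniformSpace) (fun u => Im (f u)) x.

Lemma Cderiv_eq (f : R -> C) (t : R) (l : C) l' : Cderiv f t l -> l = l' -> Cderiv f t l'.
Proof. intros H <-; exact H. Qed.

Lemma Cderiv_ext (f g : R -> C) (t : R) (l : C) :
  (forall u, f u = g u) -> Cderiv f t l -> Cderiv g t l.
Proof.
  intros E [H1 H2]; split; (eapply is_derive_ext; [|eassumption]);
  intros u; simpl; now rewrite E.
Qed.

Lemma Cderiv_const c t : Cderiv (fun _ => c) t 0.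
Proof. split; apply (@is_derive_const R_AbsRing R_NormedModule). Qed.

Lemma Cderiv_plus (f g : R -> C) (t : R) (lf lg : C) :
  Cderiv f t lf -> Cderiv g t lg -> Cderiv (fun u => f u + g u) t (lf + lg).
Proof.
  intros [H1 H2] [H3 H4]; split;
  apply (@is_derive_plus R_AbsRing R_NormedModule); assumption.
Qed.

Ltac real_derive :=
  auto_derive;
  [ repeat split; try (eexists; eassumption)
  | repeat match goal with
    | H : is_derive ?f ?t ?l |- context [Derive ?g ?t] =>
        change g with f; rewrite (is_derive_unique _ _ _ H)
    end ].

(** Exposes a curve as a pair of real functions, the form that [auto_derive] understands. *)
Lemma Ccurve_ind (P : (R -> C) -> Prop) :
  (forall X Y : R -> R, P (fun u => (X u, Y u))) -> forall f, P f.
Proof.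
  intros H f.
  replace f with (fun u => (fst (f u), snd (f u))) by
    (apply functional_extensionality; intros u; now rewrite <- surjective_pairing).
  apply H.
Qed.

Lemma Cderiv_mult (f g : R -> C) (t : R) (lf lg : C) :
  Cderiv f t lf -> Cderiv g t lg ->
  Cderiv (fun u => f u * g u) t (lf * g t + f t * lg).
Proof.
  unfold Cderiv, Cmult, Re, Im; simpl.
  induction f as [X Y] using Ccurve_ind; induction g as [Z W] using Ccurve_ind; simpl.
  intros [H1 H2] [H3 H4]; split; real_derive; ring.
Qed.

Lemma Cderiv_scal (c : C) (f : R -> C) (t : R) (l : C) :
  Cderiv f t l -> Cderiv (fun u => c * f u) t (c * l).
Proof.
  intros H. eapply Cderiv_eq.
  - apply Cderiv_mult; [apply Cderiv_const | exact H].
  - cbv beta; ring.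
Qed.

Lemma Cderiv_opp (f : R -> C) (t : R) (l : C) : Cderiv f t l -> Cderiv (fun u => - f u) t (- l).
Proof.
  intros [H1 H2]; split; apply (@is_derive_opp R_AbsRing R_NormedModule); assumption.
Qed.

Lemma Cderiv_minus (f g : R -> C) (t : R) (lf lg : C) :
  Cderiv f t lf -> Cderiv g t lg -> Cderiv (fun u => f u - g u) t (lf - lg).
Proof. intros; apply Cderiv_plus, Cderiv_opp; assumption. Qed.

Lemma Cderiv_RtoC (g : R -> R) (t l : R) :
  @is_derive R_AbsRing R_NormedModule g t l -> Cderiv (fun u => RtoC (g u)) t (RtoC l).
Proof.
  intros H; split; [exact H|].
  exact (@is_derive_const R_AbsRing R_NormedModule 0%R t).
Qed.

Lemma Cderiv_line (p q : C) (t : R) : Cderiv (fun u => p + RtoC u * q) t q.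
Proof.
  eapply Cderiv_eq.
  - apply Cderiv_plus; [apply Cderiv_const|].
    apply Cderiv_mult; [|apply Cderiv_const].
    apply Cderiv_RtoC, (@is_derive_id R_AbsRing).
  - unfold one; simpl. ring.
Qed.

Lemma Cmod_Ci : Cmod Ci = 1%R.
Proof.
  unfold Cmod, Ci; simpl. replace (0 * (0 * 1) + 1 * (1 * 1))%R with 1%R by ring.
  apply sqrt_1.
Qed.

Lemma Csum_sq_pos (z : C) : z <> 0 -> (0 < fst z ^ 2 + snd z ^ 2)%R.
Proof.
  intros H. destruct z as [x y]; simpl.
  destruct (Req_dec x 0) as [->|]; destruct (Req_dec y 0) as [->|]; try nra.
  elim H; reflexivity.
Qed.

Lemma Cderiv_inv (f : R -> C) (t : R) (l : C) :
  f t <> 0 -> Cderiv f t l -> Cderiv (fun u => / f u) t (- l / (f t * f t)).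
Proof.
  induction f as [X Y] using Ccurve_ind.
  intros Hn [H1 H2]. pose proof (Csum_sq_pos _ Hn) as Hp.
  unfold Cderiv, Cdiv, Cinv, Cmult, Copp, Re, Im in *; simpl in *.
  split; real_derive; try nra; field; nra.
Qed.

Lemma Cderiv_exp (f : R -> C) (t : R) (l : C) :
  Cderiv f t l -> Cderiv (fun u => Cexp (f u)) t (l * Cexp (f t)).
Proof.
  induction f as [X Y] using Ccurve_ind.
  intros [H1 H2]. unfold Cderiv, Cexp, Cmult, Re, Im in *; simpl in *.
  split; real_derive; ring.
Qed.

Lemma Cmod_sq (z : C) : (Cmod z ^ 2 = fst z ^ 2 + snd z ^ 2)%R.
Proof. unfold Cmod. apply pow2_sqrt. nra. Qed.

(** Replaces the arc cosine of the definition, which is not differentiable on the positive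
real axis, by a function that is smooth on the whole right half-plane. *)
Lemma Carg_atan (z : C) : (0 < Re z)%R -> Carg z = atan (Im z / Re z).
Proof.
  destruct z as [x y]; simpl. intros Hx.
  set (r := Cmod (x, y)).
  assert (Hr2 : (r ^ 2 = x ^ 2 + y ^ 2)%R) by apply (Cmod_sq (x, y)).
  assert (Hr : (0 < r)%R).
  { apply Cmod_gt_0. intros E. injection E. lra. }
  assert (Hc : (0 < x / r)%R) by (apply Rdiv_lt_0_compat; lra).
  assert (E : (sqrt (1 - (x / r)²) = Rabs y / r)%R).
  { replace (1 - (x / r)²)%R with ((Rabs y / r)²)%R.
    - apply sqrt_Rsqr. apply Rmult_le_pos; [apply Rabs_pos|].
      left; now apply Rinv_0_lt_compat.
    - unfold Rsqr. replace (Rabs y / r * (Rabs y / r))%R with (Rabs y * Rabs y / r ^ 2)%R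
        by (field; lra).
      rewrite <- Rabs_mult, Rabs_pos_eq by nra.
      replace (x / r * (x / r))%R with (x ^ 2 / r ^ 2)%R by (field; lra).
      rewrite Hr2. field. nra. }
  unfold Carg. simpl. fold r. rewrite acos_atan by exact Hc. rewrite E.
  replace (Rabs y / r / (x / r))%R with (Rabs y / x)%R by (field; lra).
  destruct (Rle_dec 0 y) as [Hy|Hy].
  - now rewrite Rabs_pos_eq.
  - rewrite Rabs_left by lra. rewrite <- atan_opp. f_equal. field; lra.
Qed.

Lemma ln_Cmod (z : C) : z <> 0 -> ln (Cmod z) = (ln (fst z ^ 2 + snd z ^ 2) / 2)%R.
Proof.
  intros H. rewrite <- Cmod_sq. rewrite ln_pow by now apply Cmod_gt_0.
  simpl. field.
Qed.

Lemma Re_pos_nz (z : C) : (0 < Re z)%R -> z <> 0.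
Proof. intros H E. rewrite E in H. simpl in H. lra. Qed.

Lemma Clog_right (z : C) : (0 < Re z)%R ->
  Clog z = (ln (fst z ^ 2 + snd z ^ 2) / 2, atan (snd z / fst z))%R.
Proof.
  intros H. unfold Clog. rewrite ln_Cmod by now apply Re_pos_nz.
  now rewrite Carg_atan.
Qed.

Lemma locally_pos {U : UniformSpace} (f : U -> R) (x : U) :
  continuous f x -> (0 < f x)%R -> locally x (fun y => (0 < f y)%R).
Proof.
  intros Hf Hp.
  apply (Hf (fun y => (0 < y)%R)).
  exists (mkposreal _ Hp). intros y Hy.
  unfold ball in Hy; simpl in Hy; unfold AbsRing_ball, abs, minus, plus, opp in Hy;
  simpl in Hy. apply Rabs_def2 in Hy. lra.
Qed.

Lemma Cderiv_ext_loc (f g : R -> C) (t : R) (l : C) :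
  locally t (fun u => f u = g u) -> Cderiv f t l -> Cderiv g t l.
Proof.
  intros E [H1 H2]; split; (eapply is_derive_ext_loc; [|eassumption]);
  (eapply filter_imp; [|exact E]); intros u Hu; simpl in *; now rewrite Hu.
Qed.

(** On the right half-plane the principal logarithm is given near each point by the smooth
formula of [Clog_right]. *)
Lemma Cderiv_log (f : R -> C) (t : R) (l : C) :
  (0 < Re (f t))%R -> Cderiv f t l -> Cderiv (fun u => Clog (f u)) t (l / f t).
Proof.
  induction f as [X Y] using Ccurve_ind.
  intros Hp [H1 H2].
  apply Cderiv_ext_loc with
    (f := fun u => (ln (X u ^ 2 + Y u ^ 2) / 2, atan (Y u / X u))%R).
  { assert (L : locally t (fun u => (0 < X u)%R)).
    { apply (locally_pos (U := R_UniformSpace) X); [|exact Hp].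
      apply (@ex_derive_continuous R_AbsRing R_NormedModule). eexists; exact H1. }
    eapply filter_imp; [|exact L]. intros u Hu. symmetry. now apply (Clog_right (X u, Y u)). }
  unfold Cderiv, Cdiv, Cinv, Cmult, Re, Im in *; simpl in *.
  split; real_derive; try nra; try field; try nra.
Qed.

(** * Continuity of complex-valued functions *)

Section Cont.
Context {U : UniformSpace}.
Implicit Types f g : U -> C.

Lemma Ccont_const (c : C) (x : U) : Ccont (fun _ => c) x.
Proof. split; apply continuous_const. Qed.

Lemma Ccont_plus f g x : Ccont f x -> Ccont g x -> Ccont (fun u => f u + g u) x.
Proof.
  intros [H1 H2] [H3 H4]; split;
  apply (@continuous_plus U R_AbsRing R_NormedModule); assumption.
Qed.

Lemma Ccont_opp f x : Ccont f x -> Ccont (fun u => - f u) x.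
Proof.
  intros [H1 H2]; split; apply (@continuous_opp U R_AbsRing R_NormedModule); assumption.
Qed.

Lemma Ccont_minus f g x : Ccont f x -> Ccont g x -> Ccont (fun u => f u - g u) x.
Proof. intros; apply Ccont_plus, Ccont_opp; assumption. Qed.

Lemma Ccont_mult f g x : Ccont f x -> Ccont g x -> Ccont (fun u => f u * g u) x.
Proof.
  intros [H1 H2] [H3 H4]; split.
  - apply (@continuous_minus U R_AbsRing R_NormedModule);
    apply (@continuous_mult U R_AbsRing); assumption.
  - apply (@continuous_plus U R_AbsRing R_NormedModule);
    apply (@continuous_mult U R_AbsRing); assumption.
Qed.

Lemma Ccont_pow f n x : Ccont f x -> Ccont (fun u => f u ^ n) x.
Proof.
  intros H; induction n; simpl; [apply Ccont_const | now apply Ccont_mult].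
Qed.

Lemma Ccont_RtoC (g : U -> R) x : continuous g x -> Ccont (fun u => RtoC (g u)) x.
Proof. intros H; split; [exact H | apply continuous_const]. Qed.

Lemma continuous_real_comp (g : U -> R) (h : R -> R) x :
  continuous g x -> continuous h (g x) -> continuous (fun u => h (g u)) x.
Proof. intros; now apply (continuous_comp (V := R_UniformSpace)). Qed.

Lemma Ccont_inv f x : f x <> 0 -> Ccont f x -> Ccont (fun u => / f u) x.
Proof.
  intros Hn [H1 H2]. pose proof (Csum_sq_pos _ Hn) as Hp.
  assert (Hi : continuous (U := R_UniformSpace)
            (fun u => / (fst (f u) ^ 2 + snd (f u) ^ 2))%R x).
  { apply continuous_real_comp.
    - simpl. apply (@continuous_plus U R_AbsRing R_NormedModule);
      apply (@continuous_mult U R_AbsRing); try assumption;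
      apply (@continuous_mult U R_AbsRing); try assumption; apply continuous_const.
    - apply continuous_Rinv. lra. }
  split; unfold Re, Im, Cinv, Rdiv; simpl fst; simpl snd;
  apply (@continuous_mult U R_AbsRing); try assumption.
  now apply (@continuous_opp U R_AbsRing R_NormedModule).
Qed.

Lemma Ccont_exp f x : Ccont f x -> Ccont (fun u => Cexp (f u)) x.
Proof.
  intros [H1 H2].
  split; unfold Cexp; simpl; apply (@continuous_mult U R_AbsRing);
  apply continuous_real_comp; try assumption;
  apply (@ex_derive_continuous R_AbsRing R_NormedModule); auto_derive; auto.
Qed.

Lemma Ccont_log f x : (0 < Re (f x))%R -> Ccont f x -> Ccont (fun u => Clog (f u)) x.
Proof.
  intros Hp [H1 H2].
  assert (L : locally x (fun u => (0 < Re (f u))%R)) by now apply locally_pos.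
  assert (Q : continuous (U := R_UniformSpace) (fun u => fst (f u) ^ 2 + snd (f u) ^ 2)%R x).
  { simpl. apply (@continuous_plus U R_AbsRing R_NormedModule);
      apply (@continuous_mult U R_AbsRing); try assumption;
      apply (@continuous_mult U R_AbsRing); try assumption; apply continuous_const. }
  unfold Re in Hp.
  split.
  - apply continuous_ext_loc with (fun u => ln (fst (f u) ^ 2 + snd (f u) ^ 2) * / 2)%R.
    { eapply filter_imp; [|exact L]. intros u Hu. now rewrite Clog_right. }
    apply (@continuous_mult U R_AbsRing); [|apply continuous_const].
    apply continuous_real_comp; [exact Q|].
    apply (@ex_derive_continuous R_AbsRing R_NormedModule). auto_derive. nra.
  - apply continuous_ext_loc with (fun u => atan (snd (f u) * / fst (f u)))%R.
    { eapply filter_imp; [|exact L]. intros u Hu. now rewrite Clog_right. }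
    apply continuous_real_comp.
    + apply (@continuous_mult U R_AbsRing); [exact H2|].
      apply continuous_real_comp; [exact H1|]. apply continuous_Rinv. lra.
    + apply (@ex_derive_continuous R_AbsRing R_NormedModule). auto_derive. auto.
Qed.

Lemma Ccont_ext f g x : (forall u, f u = g u) -> Ccont f x -> Ccont g x.
Proof.
  intros E [H1 H2]; split; [refine (continuous_ext _ _ _ _ H1)|refine (continuous_ext _ _ _ _ H2)];
  intros u; simpl; now rewrite E.
Qed.
End Cont.

Lemma Cderiv_cont (f : R -> C) (t : R) (l : C) : Cderiv f t l -> Ccont (U := R_UniformSpace) f t.
Proof.
  intros [H1 H2]; split; apply (@ex_derive_continuous R_AbsRing R_NormedModule);
  eexists; eassumption.
Qed.

(** * The mean value inequality *)

(** The real mean value theorem applies to the component of u in the direction of its own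
increment, so no constant is lost. *)
Lemma Cderiv_increment_le (u : R -> C) (u' : R -> C) (phi phi' : R -> R) (a b : R) :
  (a <= b)%R ->
  (forall t, (a <= t <= b)%R -> Cderiv u t (u' t)) ->
  (forall t, (a <= t <= b)%R -> is_derive phi t (phi' t)) ->
  (forall t, (a <= t <= b)%R -> (Cmod (u' t) <= phi' t)%R) ->
  (Cmod (u b - u a) <= phi b - phi a)%R.
Proof.
  intros Hab Hu Hphi Hle.
  set (D := u b - u a).
  destruct (Req_dec (Cmod D) 0) as [E|E].
  { rewrite E.
    destruct (MVT_gen phi a b phi') as [c [Hc1 Hc2]].
    - intros x Hx; rewrite Rmin_left, Rmax_right in Hx by lra; apply Hphi; lra.
    - intros x Hx; rewrite Rmin_left, Rmax_right in Hx by lra.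
      apply continuity_pt_filterlim, (@ex_derive_continuous R_AbsRing R_NormedModule).
      eexists; apply Hphi; lra.
    - rewrite Rmin_left, Rmax_right in Hc1 by lra. rewrite Hc2.
      apply Rmult_le_pos; [|lra].
      eapply Rle_trans; [apply Cmod_ge_0|apply Hle; lra]. }
  assert (HD : (0 < Cmod D)%R) by (pose proof (Cmod_ge_0 D); lra).
  set (psi := fun t => (Cmod D * phi t - Re (Cconj D * u t))%R).
  destruct (MVT_gen psi a b (fun t => Cmod D * phi' t - Re (Cconj D * u' t))%R)
    as [c [Hc1 Hc2]].
  - intros x Hx; rewrite Rmin_left, Rmax_right in Hx by lra.
    apply (@is_derive_minus R_AbsRing R_NormedModule).
    + apply is_derive_scal. apply Hphi; lra.
    + exact (proj1 (Cderiv_scal (Cconj D) u x _ (Hu x ltac:(lra)))).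
  - intros x Hx; rewrite Rmin_left, Rmax_right in Hx by lra.
    apply continuity_pt_filterlim, (@ex_derive_continuous R_AbsRing R_NormedModule).
    eexists.
    apply (@is_derive_minus R_AbsRing R_NormedModule).
    + apply is_derive_scal. apply Hphi; lra.
    + exact (proj1 (Cderiv_scal (Cconj D) u x _ (Hu x ltac:(lra)))).
  - rewrite Rmin_left, Rmax_right in Hc1 by lra.
    assert (Hpos : (0 <= psi b - psi a)%R).
    { rewrite Hc2. apply Rmult_le_pos; [|lra].
      pose proof (re_le_Cmod (Cconj D * u' c)) as Hre.
      rewrite Cmod_mult, Cmod_conj in Hre.
      pose proof (Hle c Hc1).
      pose proof (Rle_abs (Re (Cconj D * u' c))). nra. }
    assert (E2 : (Re (Cconj D * u b) - Re (Cconj D * u a) = Cmod D ^ 2)%R).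
    { rewrite Cmod_sq. unfold D, Cminus, Cplus, Copp, Cmult, Cconj, Re; simpl. ring. }
    unfold psi in Hpos. nra.
Qed.

Lemma Cderiv_bound_le (u : R -> C) (u' : R -> C) (M a b : R) :
  (a <= b)%R ->
  (forall t, (a <= t <= b)%R -> Cderiv u t (u' t)) ->
  (forall t, (a <= t <= b)%R -> (Cmod (u' t) <= M)%R) ->
  (Cmod (u b - u a) <= M * (b - a))%R.
Proof.
  intros Hab Hu Hle.
  replace (M * (b - a))%R with (M * b - M * a)%R by ring.
  apply Cderiv_increment_le with (u' := u') (phi := fun t => (M * t)%R) (phi' := fun _ => M);
    try assumption.
  intros t _. auto_derive; auto; ring.
Qed.

(** * The exponential series *)

Lemma Cderiv_change (f g : R -> C) (t : R) (l l' : C) :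
  Cderiv f t l -> (forall u, f u = g u) -> l = l' -> Cderiv g t l'.
Proof. intros H E <-. now apply (Cderiv_ext f). Qed.

Lemma Cexp_plus z w : Cexp (z + w) = Cexp z * Cexp w.
Proof.
  apply C_ext; unfold Cexp, Cplus, Cmult, Re, Im; simpl;
  rewrite exp_plus, ?cos_plus, ?sin_plus; ring.
Qed.

Lemma Cexp_0 : Cexp 0 = 1.
Proof.
  apply C_ext; unfold Cexp, Re, Im; simpl; rewrite exp_0, ?cos_0, ?sin_0; ring.
Qed.

Lemma Cexp_nz z : Cexp z <> 0.
Proof.
  intros H. assert (E : Cexp z * Cexp (- z) = 1).
  { rewrite <- Cexp_plus, Cplus_opp_r. apply Cexp_0. }
  rewrite H, Cmult_0_l in E. injection E; lra.
Qed.

Lemma Cexp_opp z : Cexp (- z) = / Cexp z.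
Proof.
  assert (E : Cexp z * Cexp (- z) = 1).
  { rewrite <- Cexp_plus, Cplus_opp_r. apply Cexp_0. }
  pose proof (Cexp_nz z).
  replace (Cexp (- z)) with (/ Cexp z * (Cexp z * Cexp (- z))) by (field; assumption).
  rewrite E. ring.
Qed.

Lemma Cmod_Cexp z : Cmod (Cexp z) = exp (Re z).
Proof.
  unfold Cmod, Cexp; simpl.
  replace (exp (Re z) * cos (Im z) * (exp (Re z) * cos (Im z) * 1) +
    exp (Re z) * sin (Im z) * (exp (Re z) * sin (Im z) * 1))%R with
    (exp (Re z) ^ 2 * (Rsqr (sin (Im z)) + Rsqr (cos (Im z))))%R by (unfold Rsqr; ring).
  rewrite sin2_cos2, Rmult_1_r. apply sqrt_pow2. left; apply exp_pos.
Qed.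

Lemma Cmod_Cexp_le z : (Cmod (Cexp z) <= exp (Cmod z))%R.
Proof.
  rewrite Cmod_Cexp.
  assert (H : (Re z <= Cmod z)%R).
  { eapply Rle_trans; [apply Rle_abs | apply re_le_Cmod]. }
  destruct H as [H| ->]; [left; now apply exp_increasing | lra].
Qed.

Lemma Cmod_RtoC_pos r : (0 <= r)%R -> Cmod (RtoC r) = r.
Proof. intros H. rewrite Cmod_R. now apply Rabs_pos_eq. Qed.

(** Integrating the bound K exp(2|w|) along the segment from 0 to z gains a factor 1/2,
since |z| exp(2 t |z|) is half the t-derivative of exp(2 t |z|). *)
Lemma exp_remainder_step (f g : C -> C) (K : R) (z : C) :
  (forall t : R, Cderiv (fun t => f (RtoC t * z)) t (z * g (RtoC t * z))) ->
  f 0 = 0 ->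
  (forall w, (Cmod (g w) <= K * exp (2 * Cmod w))%R) ->
  (Cmod (f z) <= K / 2 * exp (2 * Cmod z))%R.
Proof.
  intros Hd H0 Hg.
  assert (HK : (0 <= K)%R).
  { pose proof (Hg 0) as H. rewrite Cmod_0, Rmult_0_r, exp_0 in H.
    pose proof (Cmod_ge_0 (g 0)). lra. }
  assert (M : (Cmod (f (RtoC 1 * z)%C - f (RtoC 0 * z)%C) <=
     K / 2 * exp (2 * Cmod z * 1) - K / 2 * exp (2 * Cmod z * 0))%R).
  { apply (Cderiv_increment_le (fun t => f (RtoC t * z)) (fun t => z * g (RtoC t * z))
      (fun t => K / 2 * exp (2 * Cmod z * t))%R
      (fun t => Cmod z * (K * exp (2 * Cmod z * t)))%R).
    - lra.
    - intros t _. apply Hd.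
    - intros t _. auto_derive; auto. field.
    - intros t Ht. rewrite Cmod_mult. apply Rmult_le_compat_l; [apply Cmod_ge_0|].
      eapply Rle_trans; [apply Hg|]. rewrite Cmod_mult, Cmod_RtoC_pos by lra.
      right. do 2 f_equal. ring. }
  rewrite Cmult_1_l, Cmult_0_l, H0 in M.
  replace (f z - 0) with (f z) in M by ring.
  rewrite Rmult_1_r, Rmult_0_r, exp_0 in M. lra.
Qed.

Definition exp_partial (n : nat) (z : C) : C :=
  sum_n (fun k => z ^ k / INR (fact k)) n.

Lemma exp_partial_S n z :
  exp_partial (S n) z = exp_partial n z + z ^ S n / INR (fact (S n)).
Proof. unfold exp_partial. now rewrite sum_Sn. Qed.

Lemma exp_partial_0 z : exp_partial 0 z = 1.
Proof. unfold exp_partial. rewrite sum_O. simpl. field. Qed.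

Lemma RtoC_neq0 (r : R) : r <> 0%R -> RtoC r <> 0.
Proof. intros H E. apply H. injection E. auto. Qed.

Lemma exp_partial_at_0 n : exp_partial n 0 = 1.
Proof.
  induction n; [apply exp_partial_0|].
  rewrite exp_partial_S, IHn, Cpow_S. unfold Cdiv. ring.
Qed.

Lemma Cderiv_id_scal z t : Cderiv (fun t => RtoC t * z) t z.
Proof.
  eapply Cderiv_change; [apply (Cderiv_line 0 z)| |reflexivity].
  intros u; cbv beta. ring.
Qed.

Lemma Cderiv_pow (f : R -> C) (t : R) (l : C) n :
  Cderiv f t l -> Cderiv (fun u => f u ^ S n) t (INR (S n) * l * f t ^ n).
Proof.
  intros H. induction n.
  - eapply Cderiv_change; [exact H| |].
    + intros u. simpl. ring.
    + simpl. ring.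
  - eapply Cderiv_eq.
    + apply (Cderiv_mult f (fun u => f u ^ S n)); [exact H | exact IHn].
    + rewrite (S_INR (S n)), RtoC_plus, !Cpow_S. ring.
Qed.

Lemma Cderiv_exp_partial n z t :
  Cderiv (fun t => exp_partial (S n) (RtoC t * z)) t (z * exp_partial n (RtoC t * z)).
Proof.
  induction n.
  - eapply Cderiv_change.
    1: apply (Cderiv_plus (fun _ => 1) (fun t => RtoC t * z));
       [apply Cderiv_const | apply Cderiv_id_scal].
    + intros u. rewrite exp_partial_S, exp_partial_0. simpl. field. 
    + rewrite exp_partial_0. ring.
  - eapply Cderiv_change.
    1: apply (Cderiv_plus (fun t => exp_partial (S n) (RtoC t * z))
        (fun t => / INR (fact (S (S n))) * (RtoC t * z) ^ S (S n)));
       [apply IHn | apply Cderiv_scal, Cderiv_pow, Cderiv_id_scal].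
    + intros u. rewrite (exp_partial_S (S n)). unfold Cdiv. ring.
    + rewrite (exp_partial_S n). 
      change (fact (S (S n))) with (S (S n) * fact (S n))%nat.
      rewrite mult_INR, RtoC_mult. field. split; apply RtoC_neq0.
      * apply INR_fact_neq_0.
      * now apply not_0_INR.
Qed.

(** Geometric decay, uniform in z up to the weight exp(2|z|): this is what later replaces
dominated convergence when the exponential series is integrated term by term. *)
Lemma exp_remainder n : forall z,
  (Cmod (Cexp z - exp_partial n z) <= (/ 2) ^ S n * exp (2 * Cmod z))%R.
Proof.
  induction n; intros z.
  - replace ((/ 2) ^ 1)%R with (1 / 2)%R by field.
    apply (exp_remainder_step (fun w => Cexp w - exp_partial 0 w) Cexp).
    + intros t. eapply Cderiv_eq.
      * apply Cderiv_minus.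
        -- apply (Cderiv_exp (fun t => RtoC t * z)), Cderiv_id_scal.
        -- eapply Cderiv_ext; [|apply (Cderiv_const 1)].
           intros u; now rewrite exp_partial_0.
      * ring.
    + rewrite Cexp_0, exp_partial_0. ring.
    + intros w. eapply Rle_trans; [apply Cmod_Cexp_le|].
      rewrite Rmult_1_l. pose proof (Cmod_ge_0 w).
      destruct (Req_dec (Cmod w) 0) as [-> | Hw].
      * rewrite Rmult_0_r; lra.
      * left. apply exp_increasing. lra.
  - replace ((/ 2) ^ S (S n))%R with ((/ 2) ^ S n / 2)%R by (simpl; field).
    apply (exp_remainder_step (fun w => Cexp w - exp_partial (S n) w)
      (fun w => Cexp w - exp_partial n w)).
    + intros t. eapply Cderiv_eq.
      * apply Cderiv_minus.
        -- apply (Cderiv_exp (fun t => RtoC t * z)), Cderiv_id_scal.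
        -- apply Cderiv_exp_partial.
      * ring.
    + rewrite Cexp_0, exp_partial_at_0. ring.
    + exact IHn.
Qed.

(** * The principal logarithm *)

(** Through this lemma every identity between logarithms becomes a check that an imaginary part
lies in (-pi, pi). *)
Lemma Clog_Cexp u : (- PI < Im u < PI)%R -> Clog (Cexp u) = u.
Proof.
  intros [H1 H2]. unfold Clog. rewrite Cmod_Cexp, ln_exp.
  apply C_ext; [reflexivity|]. simpl. unfold Carg. rewrite Cmod_Cexp.
  pose proof (exp_pos (Re u)) as He.
  assert (E : (Re (Cexp u) / exp (Re u) = cos (Im u))%R).
  { unfold Cexp; simpl. field. lra. }
  rewrite E. unfold Cexp at 1; simpl.
  destruct (Rle_dec 0 (exp (Re u) * sin (Im u))) as [Hs|Hs].
  - apply acos_cos. split; [|lra].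
    destruct (Rle_dec 0 (Im u)) as [|Hn]; [assumption|].
    assert (sin (Im u) < 0)%R by (apply sin_lt_0_var; lra). nra.
  - destruct (Rlt_dec (Im u) 0) as [Hn|Hn].
    + rewrite <- cos_neg, acos_cos by lra. ring.
    + elim Hs. apply Rmult_le_pos; [lra|]. apply sin_ge_0; lra.
Qed.

Lemma Cexp_Clog z : (0 < Re z)%R -> Cexp (Clog z) = z.
Proof.
  intros H. destruct z as [x y]; simpl in H.
  unfold Cexp. unfold Clog at 1 2 3 4. rewrite Carg_atan by exact H. simpl.
  set (r := Cmod (x, y)).
  assert (Hr2 : (r ^ 2 = x ^ 2 + y ^ 2)%R) by apply (Cmod_sq (x, y)).
  assert (Hr : (0 < r)%R).
  { apply Cmod_gt_0. intros E. injection E. lra. }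
  rewrite exp_ln by exact Hr. rewrite cos_atan, sin_atan.
  assert (E : sqrt (1 + (y / x)²) = (r / x)%R).
  { replace (1 + (y / x)²)%R with ((r / x)²)%R.
    - apply sqrt_Rsqr. left. now apply Rdiv_lt_0_compat.
    - unfold Rsqr. replace (r / x * (r / x))%R with (r ^ 2 / x ^ 2)%R by (field; lra).
      rewrite Hr2. field. lra. }
  rewrite E. f_equal; field; lra.
Qed.

Lemma Clog_Im_bound z : (0 < Re z)%R -> (- (PI / 2) < Im (Clog z) < PI / 2)%R.
Proof.
  intros H. unfold Clog; simpl. rewrite Carg_atan by exact H.
  pose proof (atan_bound (Im z / Re z)). lra.
Qed.

Lemma Cpower_plus z a b : Cpower z (a + b) = Cpower z a * Cpower z b.
Proof.
  unfold Cpower. rewrite <- Cexp_plus. f_equal. ring.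
Qed.

Lemma Cmod_le_parts z : (Cmod z <= Rabs (Re z) + Rabs (Im z))%R.
Proof.
  destruct z as [x y]. replace (x, y) with (RtoC x + Ci * RtoC y).
  - eapply Rle_trans; [apply Cmod_triangle|]. rewrite Cmod_mult, !Cmod_R, Cmod_Ci.
    simpl. right.
    replace (x + (0 * y - 1 * 0))%R with x by ring.
    replace (0 + (0 * 0 + 1 * y))%R with y by ring. ring.
  - apply C_ext; simpl; ring.
Qed.

(** From log u <= u with u = (1 + r) / (A + 1): a multiple of log r exceeds r by at most a
constant, and in a vertical strip r = |z| exceeds |Im z| by at most a constant. *)
Lemma Clog_growth (A c M : R) : (0 <= A)%R -> (0 < c)%R ->
  exists K, forall z, (c <= Re z <= M)%R -> (A * Cmod (Clog z) <= K + Rabs (Im z))%R.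
Proof.
  intros HA Hc.
  exists (A * (Rabs (ln c) + PI) + 1 + M + (A + 1) * ln (A + 1))%R.
  intros z [Hz1 Hz2].
  assert (Hzp : (0 < Re z)%R) by lra.
  set (r := Cmod z).
  assert (Hr1 : (Re z <= r)%R).
  { eapply Rle_trans; [apply Rle_abs | apply re_le_Cmod]. }
  assert (Hr2 : (r <= Re z + Rabs (Im z))%R).
  { pose proof (Cmod_le_parts z) as H. rewrite (Rabs_pos_eq (Re z)) in H by lra. exact H. }
  assert (Hl : (Rabs (ln r) <= ln (1 + r) + Rabs (ln c))%R).
  { assert (0 <= ln (1 + r))%R by (rewrite <- ln_1; left; apply ln_increasing; lra).
    assert (ln r < ln (1 + r))%R by (apply ln_increasing; lra).
    assert (ln c <= ln r)%R by (destruct (Req_dec c r) as [->|]; [lra|left; apply ln_increasing; lra]).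
    pose proof (Rabs_pos (ln c)). pose proof (Rabs_maj2 (ln c)).
    apply Rabs_le; split; lra. }
  assert (Hm : (Cmod (Clog z) <= ln (1 + r) + (Rabs (ln c) + PI))%R).
  { eapply Rle_trans; [apply Cmod_le_parts|].
    pose proof (Clog_Im_bound z Hzp) as Hi. pose proof PI_RGT_0.
    assert (Rabs (Im (Clog z)) <= PI)%R by (apply Rabs_le; lra).
    change (Re (Clog z)) with (ln r). lra. }
  assert (Hln : ((A + 1) * ln (1 + r) <= 1 + r + (A + 1) * ln (A + 1))%R).
  { assert (H : (ln ((1 + r) / (A + 1)) <= (1 + r) / (A + 1))%R).
    { assert (Hq : (0 < (1 + r) / (A + 1))%R) by (apply Rdiv_lt_0_compat; lra).
      rewrite <- (ln_exp ((1 + r) / (A + 1))) at 2.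
      left; apply ln_increasing; [exact Hq|].
      pose proof (exp_ineq1 _ (not_eq_sym (Rlt_not_eq _ _ Hq))). lra. }
    rewrite ln_div in H by lra.
    apply Rmult_le_compat_l with (r := (A + 1)%R) in H; [|lra].
    replace ((A + 1) * ((1 + r) / (A + 1)))%R with (1 + r)%R in H by (field; lra). lra. }
  assert (0 <= ln (1 + r))%R by (rewrite <- ln_1; left; apply ln_increasing; lra).
  pose proof (Rmult_le_compat_l A _ _ HA Hm). lra.
Qed.

(** * Integrals of complex-valued functions over segments *)

Definition CInt (f : R -> C) (a b : R) : C :=
  (RInt (fun x => Re (f x)) a b, RInt (fun x => Im (f x)) a b).

Definition Ccontinuous (f : R -> C) : Prop := forall x, Ccont (U := R_UniformSpace) f x.

Lemma ex_RInt_cont (g : R -> R) a b : (forall x, continuous g x) -> ex_RInt g a b.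
Proof. intros H. apply (@ex_RInt_continuous R_CompleteNormedModule). intros; apply H. Qed.

Lemma CInt_correct f a b : Ccontinuous f ->
  is_RInt (V := C_R_NormedModule) f a b (CInt f a b).
Proof.
  intros H. apply (@is_RInt_fct_extend_pair R_NormedModule R_NormedModule);
  apply (@RInt_correct R_CompleteNormedModule), ex_RInt_cont; intros x;
  [exact (proj1 (H x)) | exact (proj2 (H x))].
Qed.

Lemma CInt_unique f a b l :
  is_RInt (V := C_R_NormedModule) f a b l -> CInt f a b = l.
Proof.
  intros H. apply C_ext; simpl; apply (@is_RInt_unique R_CompleteNormedModule).
  - now apply (@is_RInt_fct_extend_fst R_NormedModule R_NormedModule).
  - now apply (@is_RInt_fct_extend_snd R_NormedModule R_NormedModule).
Qed.

Lemma CInt_Chasles f a b c : Ccontinuous f -> CInt f a b + CInt f b c = CInt f a c.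
Proof.
  intros H. symmetry. apply CInt_unique.
  apply (@is_RInt_Chasles C_R_NormedModule) with b; now apply CInt_correct.
Qed.

Lemma CInt_point f a : CInt f a a = 0.
Proof. apply CInt_unique. apply (@is_RInt_point C_R_NormedModule). Qed.

Lemma CInt_plus f g a b : Ccontinuous f -> Ccontinuous g ->
  CInt (fun x => f x + g x) a b = CInt f a b + CInt g a b.
Proof.
  intros Hf Hg. apply CInt_unique.
  apply (@is_RInt_plus C_R_NormedModule); now apply CInt_correct.
Qed.

Lemma CInt_scal c f a b : Ccontinuous f ->
  CInt (fun x => c * f x) a b = c * CInt f a b.
Proof.
  intros Hf.
  assert (H1 := ex_RInt_cont (fun x => Re (f x)) a b (fun x => proj1 (Hf x))).
  assert (H2 := ex_RInt_cont (fun x => Im (f x)) a b (fun x => proj2 (Hf x))).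
  apply CInt_unique.
  apply (@is_RInt_fct_extend_pair R_NormedModule R_NormedModule).
  - apply (@is_RInt_minus R_NormedModule); apply (@is_RInt_scal R_NormedModule);
    now apply (@RInt_correct R_CompleteNormedModule).
  - apply (@is_RInt_plus R_NormedModule); apply (@is_RInt_scal R_NormedModule);
    now apply (@RInt_correct R_CompleteNormedModule).
Qed.

Lemma Ccontinuous_flip f : Ccontinuous f -> Ccontinuous (fun x => f (- x)%R).
Proof.
  intros H x. destruct (H (- x)%R) as [H1 H2].
  assert (Hn : continuous (U := R_UniformSpace) (fun x : R => (- x)%R) x).
  { apply (@ex_derive_continuous R_AbsRing R_NormedModule). auto_derive; auto. }
  split.
  - now apply (continuous_comp (fun x : R => (- x)%R) (fun y => Re (f y))).
  - now apply (continuous_comp (fun x : R => (- x)%R) (fun y => Im (f y))).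
Qed.

Lemma CInt_flip f a b : Ccontinuous f ->
  CInt (fun x => f (- x)%R) a b = CInt f (- b) (- a).
Proof.
  intros H. apply CInt_unique.
  pose proof (@is_RInt_comp_opp C_R_NormedModule (fun x => - f x) a b (CInt f (- b) (- a))) as K.
  eapply is_RInt_ext; [|apply K].
  - intros x _. simpl. change (- - f (- x)%R = f (- x)%R). ring.
  - assert (E : CInt f (- b) (- a) = - CInt f (- a) (- b)).
    { rewrite <- (Cplus_0_r (CInt f (- b) (- a))).
      rewrite <- (Cplus_opp_r (CInt f (- a) (- b))), Cplus_assoc, CInt_Chasles, CInt_point
        by exact H. ring. }
    rewrite E. apply (@is_RInt_opp C_R_NormedModule). now apply CInt_correct.
Qed.

Lemma CInt_deriv f a x : Ccontinuous f -> Cderiv (fun y => CInt f a y) x (f x).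
Proof.
  intros H. split.
  - refine (@is_derive_RInt R_NormedModule (fun y => Re (f y)) _ a x _ (proj1 (H x))).
    apply filter_forall. intros b.
    exact (@RInt_correct R_CompleteNormedModule _ a b (ex_RInt_cont _ a b (fun y => proj1 (H y)))).
  - refine (@is_derive_RInt R_NormedModule (fun y => Im (f y)) _ a x _ (proj2 (H x))).
    apply filter_forall. intros b.
    exact (@RInt_correct R_CompleteNormedModule _ a b (ex_RInt_cont _ a b (fun y => proj2 (H y)))).
Qed.

Lemma Rle_add_eps (x y : R) : (forall e, 0 < e -> x <= y + e)%R -> (x <= y)%R.
Proof.
  intros H. destruct (Rle_dec x y) as [|N]; [assumption|].
  specialize (H ((x - y) / 2)%R). lra.
Qed.

(** * Improper integrals of dominated functions *)

Lemma Cfilterlim {T} (F : (T -> Prop) -> Prop) {FF : Filter F} (f : T -> C) (l : C) :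
  filterlim f F (locally (T := C_R_NormedModule) l) <->
  forall eps, (0 < eps)%R -> F (fun x => (Cmod (f x - l) < eps)%R).
Proof.
  split.
  - intros H eps He.
    pose proof (proj1 (@filterlim_locally_ball_norm R_AbsRing T C_R_NormedModule F _ f l) H
      (mkposreal eps He)) as K.
    eapply filter_imp; [|exact K]. intros x Hx. rewrite Cmod_norm. exact Hx.
  - intros H. apply (@filterlim_locally_ball_norm R_AbsRing T C_R_NormedModule F _ f l).
    intros [eps He]. eapply filter_imp; [|exact (H eps He)].
    intros x Hx. cbv beta in Hx. rewrite Cmod_norm in Hx. exact Hx.
Qed.

Lemma exp_neg_small K eps : (0 < eps)%R ->
  exists M, (0 <= M)%R /\ forall x, (M <= x)%R -> (K * exp (- x) < eps)%R.
Proof.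
  intros He. exists (Rabs K / eps)%R.
  assert (H0 : (0 <= Rabs K / eps)%R).
  { apply Rmult_le_pos; [apply Rabs_pos | left; now apply Rinv_0_lt_compat]. }
  split; [exact H0|]. intros x Hx.
  assert (H1 : (1 + x <= exp x)%R).
  { destruct (Req_dec x 0) as [->|Hn]; [rewrite exp_0; lra|].
    left; now apply exp_ineq1. }
  rewrite exp_Ropp. pose proof (exp_pos x) as Hp.
  apply Rmult_lt_reg_r with (exp x); [exact Hp|].
  rewrite Rmult_assoc, Rinv_l, Rmult_1_r by lra.
  pose proof (Rle_abs K).
  assert (Rabs K <= eps * x)%R.
  { apply Rmult_le_compat_l with (r := eps) in Hx; [|lra].
    replace (eps * (Rabs K / eps))%R with (Rabs K) in Hx by (field; lra). exact Hx. }
  nra.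
Qed.

(** The primitive of f grows no faster than that of the majorant. *)
Lemma tail_bound f C0 (Hf : Ccontinuous f)
  (Hb : forall x, (Cmod (f x) <= C0 * exp (- Rabs x))%R) a b :
  (0 <= a <= b)%R -> (Cmod (CInt f a b) <= C0 * exp (- a) - C0 * exp (- b))%R.
Proof.
  intros [Ha Hab].
  replace (CInt f a b) with (CInt f a b - CInt f a a) by (rewrite CInt_point; ring).
  replace (C0 * exp (- a) - C0 * exp (- b))%R
    with (- C0 * exp (- b) - - C0 * exp (- a))%R by ring.
  apply (Cderiv_increment_le (fun x => CInt f a x) f
    (fun x => - C0 * exp (- x))%R (fun x => C0 * exp (- x))%R); try assumption.
  - intros t _. now apply CInt_deriv.
  - intros t _. auto_derive; auto. ring.
  - intros t Ht. eapply Rle_trans; [apply Hb|]. rewrite Rabs_pos_eq by lra. lra.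
Qed.

(** By [tail_bound] the primitive satisfies the Cauchy criterion at infinity. *)
Lemma half_line_limit f C0 (Hf : Ccontinuous f)
  (Hb : forall x, (Cmod (f x) <= C0 * exp (- Rabs x))%R) :
  exists l, forall x, (0 <= x)%R -> (Cmod (CInt f 0 x - l) <= C0 * exp (- x))%R.
Proof.
  assert (HC : (0 <= C0)%R).
  { pose proof (Hb 0%R) as H. rewrite Rabs_R0, Ropp_0, exp_0 in H.
    pose proof (Cmod_ge_0 (f 0%R)). lra. }
  assert (T : forall a b, (0 <= a <= b)%R ->
    (Cmod (CInt f 0 b - CInt f 0 a) <= C0 * exp (- a))%R).
  { intros a b H. rewrite <- (CInt_Chasles f 0 a b) by exact Hf.
    replace (CInt f 0 a + CInt f a b - CInt f 0 a) with (CInt f a b) by ring.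
    pose proof (tail_bound f C0 Hf Hb a b H). pose proof (exp_pos (- b)). nra. }
  destruct (proj1 (@filterlim_locally_cauchy R C_R_CompleteNormedModule
    (Rbar_locally p_infty) _ (fun x => CInt f 0 x))) as [l Hl].
  { intros eps. destruct (exp_neg_small C0 eps (cond_pos eps)) as [M [HM0 HM]].
    assert (K : forall u v, (M < u)%R -> (M < v)%R -> (u <= v)%R ->
       (Cmod (CInt f 0 v - CInt f 0 u) < eps)%R).
    { intros u v Hu Hv Huv. eapply Rle_lt_trans; [apply T; lra|]. apply HM; lra. }
    exists (fun x => (M < x)%R). split; [exists M; auto|].
    intros u v Hu Hv.
    assert (E : (Cmod (CInt f 0 v - CInt f 0 u) < eps)%R).
    { destruct (Rle_dec u v) as [H|H]; [now apply K|].
      rewrite <- Cmod_opp. replace (- (CInt f 0 v - CInt f 0 u)) with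
        (CInt f 0 u - CInt f 0 v) by ring. apply K; lra. }
    apply (@norm_compat1 R_AbsRing C_R_NormedModule). rewrite Cmod_norm in E. exact E. }
  exists l. intros x Hx. apply Rle_add_eps. intros e He.
  destruct (proj1 (Cfilterlim _ _ _) Hl e He) as [M HM].
  set (y := (Rmax x M + 1)%R).
  pose proof (Rmax_l x M). pose proof (Rmax_r x M).
  assert (Hy : (Cmod (CInt f 0 y - l) < e)%R) by (apply HM; unfold y; lra).
  replace (CInt f 0 x - l) with (- (CInt f 0 y - CInt f 0 x) + (CInt f 0 y - l)) by ring.
  eapply Rle_trans; [apply Cmod_triangle|]. rewrite Cmod_opp.
  assert (Cmod (CInt f 0 y - CInt f 0 x) <= C0 * exp (- x))%R by (apply T; unfold y; lra).
  lra.
Qed.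

Lemma is_RInt_gen_primitive (Fa Fb : (R -> Prop) -> Prop) {FFa : Filter Fa} {FFb : Filter Fb}
  (f P : R -> C) (la lb : C) :
  (forall a b, is_RInt (V := C_R_NormedModule) f a b (P b - P a)) ->
  (forall e, (0 < e)%R -> Fa (fun x => (Cmod (P x - la) < e)%R)) ->
  (forall e, (0 < e)%R -> Fb (fun x => (Cmod (P x - lb) < e)%R)) ->
  is_RInt_gen (V := C_R_NormedModule) f Fa Fb (lb - la).
Proof.
  intros HP Ha Hb.
  assert (L : filterlim (fun ab => P (snd ab) - P (fst ab)) (filter_prod Fa Fb)
     (locally (T := C_R_NormedModule) (lb - la))).
  { assert (FF : Filter (filter_prod Fa Fb)) by (apply filter_prod_filter; assumption).
    apply (Cfilterlim _ _ _). intros e He.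
    apply (Filter_prod _ _ _ _ _ (Ha (e / 2)%R ltac:(lra)) (Hb (e / 2)%R ltac:(lra))).
    intros x y Hx Hy. simpl.
    replace (P y - P x - (lb - la)) with ((P y - lb) + - (P x - la)) by ring.
    eapply Rle_lt_trans; [apply Cmod_triangle|]. rewrite Cmod_opp. lra. }
  intros Q HQ. unfold filtermapi.
  pose proof (L Q HQ) as K. unfold filtermap in K.
  assert (FF : Filter (filter_prod Fa Fb)) by (apply filter_prod_filter; assumption).
  eapply filter_imp; [|exact K].
  intros [a b] Hab. eexists. split; [apply HP|exact Hab].
Qed.

Definition Dominated (f : R -> C) : Prop :=
  Ccontinuous f /\ exists C0, forall x, (Cmod (f x) <= C0 * exp (- Rabs x))%R.

Definition line_int (f : R -> C) : C :=
  RInt_gen (V := C_R_CompleteNormedModule) f (Rbar_locally m_infty) (Rbar_locally p_infty).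

Lemma line_int_unique f I : is_int_line f I -> line_int f = I.
Proof.
  intros H.
  exact (@is_RInt_gen_unique C_R_CompleteNormedModule _ _
    (Proper_StrongProper _ (Rbar_locally_filter m_infty))
    (Proper_StrongProper _ (Rbar_locally_filter p_infty)) f I H).
Qed.

Lemma CInt_eq_prim f a b : Ccontinuous f -> CInt f a b = CInt f 0 b - CInt f 0 a.
Proof. intros H. rewrite <- (CInt_Chasles f 0 a b) by exact H. ring. Qed.

(** Both half-lines are handled by [half_line_limit], the left one after reflection; the sum of
the two limits serves the line, the truncations and the folded half-line at once. *)
Lemma line_int_main f C0 : Ccontinuous f ->
  (forall x, (Cmod (f x) <= C0 * exp (- Rabs x))%R) ->
  is_int_line f (line_int f) /\
  (forall X, (0 <= X)%R -> (Cmod (CInt f (- X) X - line_int f) <= 2 * C0 * exp (- X))%R) /\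
  is_int_halfline (fun x => f x + f (- x)%R) (line_int f).
Proof.
  intros Hf Hb.
  assert (HC : (0 <= C0)%R).
  { pose proof (Hb 0%R) as H. rewrite Rabs_R0, Ropp_0, exp_0 in H.
    pose proof (Cmod_ge_0 (f 0%R)). lra. }
  set (g := fun x => f (- x)%R).
  assert (Hg : Ccontinuous g) by now apply Ccontinuous_flip.
  assert (Hgb : forall x, (Cmod (g x) <= C0 * exp (- Rabs x))%R).
  { intros x. rewrite <- (Rabs_Ropp x). apply Hb. }
  destruct (half_line_limit f C0 Hf Hb) as [lp Hp].
  destruct (half_line_limit g C0 Hg Hgb) as [lm Hm].
  assert (Eg : forall x, CInt g 0 x = - CInt f 0 (- x)).
  { intros x. unfold g. rewrite CInt_flip, Ropp_0 by exact Hf.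
    rewrite (CInt_eq_prim f (- x) 0) by exact Hf. rewrite CInt_point. ring. }
  assert (L : is_int_line f (lp - - lm)).
  { apply (is_RInt_gen_primitive (Rbar_locally m_infty) (Rbar_locally p_infty) f
      (fun x => CInt f 0 x)).
    - intros a b. rewrite <- CInt_eq_prim by exact Hf. now apply CInt_correct.
    - intros e He. destruct (exp_neg_small C0 e He) as [M [HM0 HM]].
      exists (- M)%R. intros x Hx.
      replace (CInt f 0 x - - lm) with (- (CInt g 0 (- x) - lm))
        by (rewrite Eg, Ropp_involutive; ring).
      rewrite Cmod_opp. eapply Rle_lt_trans; [apply Hm; lra|]. apply HM; lra.
    - intros e He. destruct (exp_neg_small C0 e He) as [M [HM0 HM]].
      exists M. intros x Hx. eapply Rle_lt_trans; [apply Hp; lra|]. apply HM; lra. }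
  rewrite (line_int_unique f _ L). split; [exact L|].
  assert (B : forall X, (0 <= X)%R ->
    (Cmod (CInt f (- X) X - (lp - - lm)) <= 2 * C0 * exp (- X))%R).
  { intros X HX. rewrite CInt_eq_prim by exact Hf.
    replace (CInt f 0 X - CInt f 0 (- X) - (lp - - lm)) with
      ((CInt f 0 X - lp) + (CInt g 0 X - lm)) by (rewrite Eg; ring).
    eapply Rle_trans; [apply Cmod_triangle|].
    specialize (Hp X HX); specialize (Hm X HX). lra. }
  split; [exact B|].
  set (P := fun x => CInt f 0 x + CInt g 0 x).
  assert (P0 : P 0%R = 0) by (unfold P; rewrite !CInt_point; ring).
  replace (lp - - lm) with ((lp - - lm) - P 0%R) by (rewrite P0; ring).
  apply (is_RInt_gen_primitive (at_point 0%R) (Rbar_locally p_infty) (fun x => f x + g x) P).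
  - intros a b. unfold P.
    replace (CInt f 0 b + CInt g 0 b - (CInt f 0 a + CInt g 0 a)) with
      (CInt f a b + CInt g a b)
      by (rewrite (CInt_eq_prim f a b), (CInt_eq_prim g a b) by assumption; ring).
    apply (@is_RInt_plus C_R_NormedModule); now apply CInt_correct.
  - intros e He. unfold at_point. replace (P 0%R - P 0%R) with (RtoC 0) by ring.
    now rewrite Cmod_0.
  - intros e He. destruct (exp_neg_small (2 * C0) e He) as [M [HM0 HM]].
    exists M. intros x Hx.
    replace (P x - (lp - - lm)) with (CInt f (- x) x - (lp - - lm)).
    + eapply Rle_lt_trans; [apply B; lra|]. apply HM; lra.
    + rewrite CInt_eq_prim by exact Hf. unfold P. rewrite Eg. ring.
Qed.

Lemma line_int_correct f : Dominated f -> is_int_line f (line_int f).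
Proof. intros [Hf [C0 Hb]]. apply (line_int_main f C0 Hf Hb). Qed.

Lemma line_int_halfline f : Dominated f -> is_int_halfline (fun x => f x + f (- x)%R) (line_int f).
Proof. intros [Hf [C0 Hb]]. apply (line_int_main f C0 Hf Hb). Qed.

Lemma line_int_truncation f C0 X : Ccontinuous f ->
  (forall x, (Cmod (f x) <= C0 * exp (- Rabs x))%R) -> (0 <= X)%R ->
  (Cmod (CInt f (- X) X - line_int f) <= 2 * C0 * exp (- X))%R.
Proof. intros Hf Hb. now apply (line_int_main f C0 Hf Hb). Qed.

Lemma line_int_bound f C0 : Ccontinuous f ->
  (forall x, (Cmod (f x) <= C0 * exp (- Rabs x))%R) -> (Cmod (line_int f) <= 2 * C0)%R.
Proof.
  intros Hf Hb. pose proof (line_int_truncation f C0 0 Hf Hb (Rle_refl 0)) as H.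
  rewrite Ropp_0, CInt_point, exp_0 in H.
  replace (0 - line_int f) with (- line_int f) in H by ring. rewrite Cmod_opp in H. lra.
Qed.

(** Since the improper integral is known to exist, symmetric truncations determine it. *)
Lemma line_int_eq_lim f l : Dominated f ->
  (forall e, (0 < e)%R -> exists M, forall X, (M <= X)%R -> (Cmod (CInt f (- X) X - l) <= e)%R) ->
  line_int f = l.
Proof.
  intros [Hf [C0 Hb]] Hl.
  apply Ceq_minus, Cmod_eq_0.
  apply Rle_antisym; [|apply Cmod_ge_0]. apply Rle_add_eps. intros e He.
  destruct (Hl (e / 2)%R ltac:(lra)) as [M HM].
  destruct (exp_neg_small (2 * C0) (e / 2)%R ltac:(lra)) as [N [HN0 HN]].
  set (X := Rmax M N). pose proof (Rmax_l M N). pose proof (Rmax_r M N).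
  specialize (HM X ltac:(unfold X; lra)). specialize (HN X ltac:(unfold X; lra)).
  pose proof (line_int_truncation f C0 X Hf Hb ltac:(unfold X; lra)) as HT.
  replace (line_int f - l) with (- (CInt f (- X) X - line_int f) + (CInt f (- X) X - l)) by ring.
  eapply Rle_trans; [apply Cmod_triangle|]. rewrite Cmod_opp. lra.
Qed.

Lemma Ccontinuous_plus f g :
  Ccontinuous f -> Ccontinuous g -> Ccontinuous (fun x => f x + g x).
Proof. intros Hf Hg x. now apply Ccont_plus. Qed.

Lemma Ccontinuous_scal c f : Ccontinuous f -> Ccontinuous (fun x => c * f x).
Proof. intros Hf x. apply Ccont_mult; [apply Ccont_const | apply Hf]. Qed.

Lemma Dominated_plus f g : Dominated f -> Dominated g -> Dominated (fun x => f x + g x).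
Proof.
  intros [Hf [A HA]] [Hg [B HB]]. split; [now apply Ccontinuous_plus|].
  exists (A + B)%R. intros x. eapply Rle_trans; [apply Cmod_triangle|].
  specialize (HA x); specialize (HB x). lra.
Qed.

Lemma Dominated_scal c f : Dominated f -> Dominated (fun x => c * f x).
Proof.
  intros [Hf [A HA]]. split; [now apply Ccontinuous_scal|].
  exists (Cmod c * A)%R. intros x. rewrite Cmod_mult, Rmult_assoc.
  apply Rmult_le_compat_l; [apply Cmod_ge_0 | apply HA].
Qed.

Lemma Dominated_flip f : Dominated f -> Dominated (fun x => f (- x)%R).
Proof.
  intros [Hf [A HA]]. split; [now apply Ccontinuous_flip|].
  exists A. intros x. rewrite <- (Rabs_Ropp x). apply HA.
Qed.

Lemma CInt_LI_lim f : Dominated f -> forall e, (0 < e)%R ->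
  exists M, forall X, (M <= X)%R -> (Cmod (CInt f (- X) X - line_int f) <= e)%R.
Proof.
  intros [Hf [C0 Hb]] e He.
  destruct (exp_neg_small (2 * C0) e He) as [M [HM0 HM]].
  exists M. intros X HX. specialize (HM X HX).
  pose proof (line_int_truncation f C0 X Hf Hb ltac:(lra)). lra.
Qed.

Lemma line_int_plus f g : Dominated f -> Dominated g ->
  line_int (fun x => f x + g x) = line_int f + line_int g.
Proof.
  intros Hf Hg. apply line_int_eq_lim; [now apply Dominated_plus|].
  intros e He.
  destruct (CInt_LI_lim f Hf (e / 2)%R ltac:(lra)) as [M HM].
  destruct (CInt_LI_lim g Hg (e / 2)%R ltac:(lra)) as [N HN].
  exists (Rmax M N). intros X HX. pose proof (Rmax_l M N). pose proof (Rmax_r M N).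
  rewrite CInt_plus by (apply Hf || apply Hg).
  replace (CInt f (- X) X + CInt g (- X) X - (line_int f + line_int g)) with
    ((CInt f (- X) X - line_int f) + (CInt g (- X) X - line_int g)) by ring.
  eapply Rle_trans; [apply Cmod_triangle|].
  specialize (HM X ltac:(lra)); specialize (HN X ltac:(lra)). lra.
Qed.

Lemma line_int_scal c f : Dominated f -> line_int (fun x => c * f x) = c * line_int f.
Proof.
  intros Hf. apply line_int_eq_lim; [now apply Dominated_scal|].
  intros e He. pose proof (Cmod_ge_0 c) as Hc.
  destruct (CInt_LI_lim f Hf (e / (Cmod c + 1))%R) as [M HM].
  { apply Rdiv_lt_0_compat; lra. }
  exists M. intros X HX. rewrite CInt_scal by apply Hf.
  replace (c * CInt f (- X) X - c * line_int f) with (c * (CInt f (- X) X - line_int f)) by ring.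
  rewrite Cmod_mult. specialize (HM X HX).
  apply Rmult_le_compat_l with (r := Cmod c) in HM; [|exact Hc].
  eapply Rle_trans; [exact HM|].
  replace (Cmod c * (e / (Cmod c + 1)))%R with (e - e / (Cmod c + 1))%R by (field; lra).
  assert (0 < e / (Cmod c + 1))%R by (apply Rdiv_lt_0_compat; lra). lra.
Qed.

Lemma line_int_flip f : Dominated f -> line_int (fun x => f (- x)%R) = line_int f.
Proof.
  intros Hf. apply line_int_eq_lim; [now apply Dominated_flip|].
  intros e He. destruct (CInt_LI_lim f Hf e He) as [M HM].
  exists M. intros X HX. rewrite CInt_flip, Ropp_involutive by apply Hf. auto.
Qed.

Lemma line_int_ext f g : (forall x, f x = g x) -> line_int f = line_int g.
Proof.
  intros H. f_equal. now apply functional_extensionality.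
Qed.

(** * Series of complex numbers *)

Lemma is_Cseries_eps a l :
  is_Cseries a l <->
  forall eps, (0 < eps)%R ->
    exists N, forall n, (N <= n)%nat -> (Cmod (sum_n a n - l) < eps)%R.
Proof.
  unfold is_Cseries, is_series.
  rewrite (@filterlim_locally_ball_norm C_AbsRing nat C_NormedModule eventually _ (sum_n a) l).
  split.
  - intros H eps He. exact (H (mkposreal eps He)).
  - intros H [eps He]. exact (H eps He).
Qed.

Lemma is_Cseries_ext a b l : (forall n, a n = b n) -> is_Cseries a l -> is_Cseries b l.
Proof. intros E. apply is_series_ext. exact E. Qed.

Lemma is_Cseries_unique a l l' : is_Cseries a l -> is_Cseries a l' -> l = l'.
Proof.
  rewrite !is_Cseries_eps. intros H H'.
  apply Ceq_minus, Cmod_eq_0.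
  apply Rle_antisym; [|apply Cmod_ge_0]. apply Rle_add_eps. intros e He.
  destruct (H (e / 2)%R ltac:(lra)) as [N HN].
  destruct (H' (e / 2)%R ltac:(lra)) as [M HM].
  specialize (HN (N + M)%nat ltac:(lia)). specialize (HM (N + M)%nat ltac:(lia)).
  replace (l - l') with (- (sum_n a (N + M) - l) + (sum_n a (N + M) - l')) by ring.
  eapply Rle_trans; [apply Cmod_triangle|]. rewrite Cmod_opp. lra.
Qed.

Lemma Csum_Sn (a : nat -> C) n : sum_n a (S n) = sum_n a n + a (S n).
Proof. apply (sum_Sn (G := C_AbelianMonoid)). Qed.

Lemma is_Cseries_minus a b la lb : is_Cseries a la -> is_Cseries b lb ->
  is_Cseries (fun n => a n - b n) (la - lb).
Proof. intros. apply (@is_series_minus C_AbsRing C_NormedModule); assumption. Qed.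

Lemma is_Cseries_scal c a l : is_Cseries a l -> is_Cseries (fun n => c * a n) (c * l).
Proof. intros. apply (@is_series_scal C_AbsRing C_NormedModule); assumption. Qed.

Lemma bounded_prefix (a : nat -> C) N :
  exists K, forall n, (n <= N)%nat -> (Cmod (a n) <= K)%R.
Proof.
  induction N as [|N [K HK]].
  - exists (Cmod (a 0%nat)). intros n Hn. replace n with 0%nat by lia. lra.
  - exists (Rmax K (Cmod (a (S N)))). intros n Hn.
    destruct (Nat.eq_dec n (S N)) as [->|]; [apply Rmax_r|].
    eapply Rle_trans; [apply HK; lia | apply Rmax_l].
Qed.

(** The terms are differences of partial sums, which are eventually close to l. *)
Lemma is_Cseries_bounded a l : is_Cseries a l ->
  exists K, (0 <= K)%R /\ forall n, (Cmod (a n) <= K)%R.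
Proof.
  rewrite is_Cseries_eps. intros H.
  destruct (H 1%R ltac:(lra)) as [N HN].
  destruct (bounded_prefix a N) as [K HK].
  exists (Rmax K 2). pose proof (Rmax_l K 2). pose proof (Rmax_r K 2).
  split; [lra|]. intros n.
  destruct (le_lt_dec n N) as [Hn|Hn]; [specialize (HK n Hn); lra|].
  destruct n as [|n]; [lia|].
  pose proof (HN n ltac:(lia)) as Hs1. pose proof (HN (S n) ltac:(lia)) as Hs2.
  rewrite Csum_Sn in Hs2.
  replace (a (S n)) with ((sum_n a n + a (S n) - l) + - (sum_n a n - l)) by ring.
  eapply Rle_trans; [apply Cmod_triangle|]. rewrite Cmod_opp. lra.
Qed.

Lemma sum_n_zero (a : nat -> C) N :
  (forall n, (n <= N)%nat -> a n = 0) -> sum_n a N = RtoC 0.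
Proof.
  induction N as [|N IH]; intros H.
  - rewrite sum_O. apply H; lia.
  - rewrite Csum_Sn, IH by (intros; apply H; lia). rewrite H by lia. exact (Cplus_0_l 0).
Qed.

Lemma half_pow_lt eps : (0 < eps)%R -> exists N, forall n, (N <= n)%nat -> ((/ 2) ^ n < eps)%R.
Proof.
  intros He. destruct (pow_lt_1_zero (/ 2)%R) with (y := eps) as [N HN].
  - rewrite Rabs_pos_eq; lra.
  - exact He.
  - exists N. intros n Hn. specialize (HN n Hn).
    rewrite Rabs_pos_eq in HN; [exact HN|]. apply pow_le; lra.
Qed.

(** * The identity theorem *)

(** Comparison with a geometric series of ratio |z| / r <= 1/2; the factor 1 - 2^-(N - m)
makes the induction on N go through. *)
Lemma power_tail_bound (a : nat -> C) (r K : R) (m : nat) (z : C) :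
  (0 < r)%R -> (forall n, (Cmod (a n) * r ^ n <= K)%R) ->
  (2 * Cmod z <= r)%R ->
  (forall n, (n < m)%nat -> a n = 0) ->
  forall N, (m <= N)%nat ->
  (Cmod (sum_n (fun n => (a n * z ^ n)%C) N - a m * z ^ m) <=
     2 * K * (Cmod z / r) ^ S m * (1 - (/ 2) ^ (N - m)))%R.
Proof.
  intros Hr HK Hz Hm N HN.
  set (q := (Cmod z / r)%R).
  assert (Hq0 : (0 <= q)%R).
  { apply Rmult_le_pos; [apply Cmod_ge_0|]. left; now apply Rinv_0_lt_compat. }
  assert (Hq : (q <= / 2)%R).
  { apply Rmult_le_reg_r with r; [exact Hr|].
    replace (q * r)%R with (Cmod z) by (unfold q; field; lra). lra. }
  assert (HK0 : (0 <= K)%R).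
  { eapply Rle_trans; [|apply (HK 0%nat)]. simpl. rewrite Rmult_1_r. apply Cmod_ge_0. }
  assert (T : forall n, (Cmod (a n * z ^ n) <= K * q ^ n)%R).
  { intros n. rewrite Cmod_mult, Cmod_pow.
    replace (Cmod z) with (r * q)%R by (unfold q; field; lra).
    rewrite Rpow_mult_distr, <- Rmult_assoc.
    apply Rmult_le_compat_r; [now apply pow_le | apply HK]. }
  induction HN as [|N HN IH].
  - replace (sum_n (fun n => a n * z ^ n) m - a m * z ^ m) with (RtoC 0).
    + rewrite Cmod_0, Nat.sub_diag. simpl. right. ring.
    + destruct m as [|m].
      * rewrite sum_O. ring.
      * rewrite Csum_Sn, sum_n_zero; [ring|].
        intros n Hn. rewrite Hm by lia. ring.
  - rewrite Csum_Sn.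
    replace (sum_n (fun n => a n * z ^ n) N + a (S N) * z ^ S N - a m * z ^ m) with
      ((sum_n (fun n => a n * z ^ n) N - a m * z ^ m) + a (S N) * z ^ S N) by ring.
    eapply Rle_trans; [apply Cmod_triangle|].
    pose proof (T (S N)) as T1.
    assert (E : (q ^ S N <= q ^ S m * (/ 2) ^ (N - m))%R).
    { replace (S N) with (S m + (N - m))%nat by lia. rewrite pow_add.
      apply Rmult_le_compat_l; [now apply pow_le|]. apply pow_incr; lra. }
    replace (S N - m)%nat with (S (N - m)) by lia. simpl ((/ 2) ^ S (N - m))%R.
    assert (K * q ^ S N <= K * (q ^ S m * (/ 2) ^ (N - m)))%R
      by (apply Rmult_le_compat_l; assumption).
    lra.
Qed.

(** The first possibly nonzero coefficient a m satisfies |a m| |z|^m = O(|z|^(m+1)) at every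
zero z of the sum. *)
Lemma power_series_zero_coef (a : nat -> C) (h : C -> C) (r : R) :
  (0 < r)%R ->
  (forall z : C, z <> 0 -> (Cmod z < r)%R -> is_Cseries (fun n => a n * z ^ n) (h z)) ->
  (forall d, (0 < d)%R -> exists z : C, z <> 0 /\ (Cmod z < d)%R /\ h z = 0) ->
  forall n, a n = 0.
Proof.
  intros Hr Hs Hz.
  assert (Hr2 : (Cmod (RtoC (r / 2)) < r)%R) by (rewrite Cmod_RtoC_pos by lra; lra).
  assert (Hr0 : RtoC (r / 2) <> 0) by (apply RtoC_neq0; lra).
  destruct (is_Cseries_bounded _ _ (Hs _ Hr0 Hr2)) as [K [HK0 HK]].
  assert (HK' : forall n, (Cmod (a n) * (r / 2) ^ n <= K)%R).
  { intros n. specialize (HK n). rewrite Cmod_mult, Cmod_pow, Cmod_RtoC_pos in HK by lra.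
    exact HK. }
  intros n. induction n as [m IH] using lt_wf_ind.
  apply Cmod_eq_0. apply Rle_antisym; [|apply Cmod_ge_0].
  set (B := (2 * K / (r / 2) ^ S m)%R).
  assert (HB : (0 <= B)%R).
  { apply Rmult_le_pos; [lra|]. left. apply Rinv_0_lt_compat, pow_lt. lra. }
  apply Rle_add_eps. intros e He.
  destruct (Hz (Rmin (r / 4) (e / (B + 1)))) as [z [Hz0 [Hzd Hhz]]].
  { apply Rmin_glb_lt; [lra|]. apply Rdiv_lt_0_compat; lra. }
  pose proof (Rmin_l (r / 4) (e / (B + 1))). pose proof (Rmin_r (r / 4) (e / (B + 1))).
  assert (Hzp : (0 < Cmod z)%R) by now apply Cmod_gt_0.
  assert (HT := power_tail_bound a (r / 2) K m z ltac:(lra) HK' ltac:(lra) IH).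
  assert (Hzm : (0 < Cmod z ^ m)%R) by now apply pow_lt.
  assert (L : (Cmod (a m * z ^ m) <= B * Cmod z ^ S m)%R).
  { apply Rle_add_eps. intros e' He'.
    assert (Hzr : (Cmod z < r)%R) by lra.
    destruct (proj1 (is_Cseries_eps _ _) (Hs z Hz0 Hzr) e' He') as [N HN].
    specialize (HN (N + m)%nat ltac:(lia)). specialize (HT (N + m)%nat ltac:(lia)).
    rewrite Hhz in HN.
    set (s := sum_n (fun n => a n * z ^ n) (N + m)) in *.
    replace (a m * z ^ m) with ((s - 0) + - (s - a m * z ^ m)) by ring.
    eapply Rle_trans; [apply Cmod_triangle|]. rewrite Cmod_opp.
    assert (E : (2 * K * (Cmod z / (r / 2)) ^ S m = B * Cmod z ^ S m)%R).
    { unfold B, Rdiv. rewrite Rpow_mult_distr, pow_inv. ring. }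
    rewrite E in HT.
    assert (0 <= B * Cmod z ^ S m)%R by (apply Rmult_le_pos; [lra|]; apply pow_le; lra).
    assert (0 <= (/ 2) ^ (N + m - m))%R by (apply pow_le; lra).
    nra. }
  rewrite Cmod_mult, Cmod_pow in L. simpl (Cmod z ^ S m)%R in L.
  assert (L2 : (Cmod (a m) <= B * Cmod z)%R).
  { apply Rmult_le_reg_r with (Cmod z ^ m)%R; [exact Hzm|]. lra. }
  assert (B * Cmod z <= B * (e / (B + 1)))%R by (apply Rmult_le_compat_l; lra).
  replace (B * (e / (B + 1)))%R with (e - e / (B + 1))%R in * by (field; lra).
  assert (0 < e / (B + 1))%R by (apply Rdiv_lt_0_compat; lra). lra.
Qed.

Lemma is_Cseries_zero : is_Cseries (fun _ => 0) 0.
Proof.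
  apply is_Cseries_eps. intros e He. exists 0%nat. intros n _.
  rewrite sum_n_zero by auto. replace (0 - 0) with (RtoC 0) by ring. now rewrite Cmod_0.
Qed.

Lemma locally_C_Cmod (s0 : C) (P : C -> Prop) :
  locally (T := C_UniformSpace) s0 P <->
  exists r, (0 < r)%R /\ forall s, (Cmod (s - s0) < r)%R -> P s.
Proof.
  rewrite locally_C. split.
  - intros [[r Hr] H]. exists r. split; [exact Hr|]. intros s Hs. apply H. exact Hs.
  - intros [r [Hr H]]. exists (mkposreal r Hr). intros s Hs. apply H. exact Hs.
Qed.

Lemma analytic_at_minus f g s0 :
  analytic_at f s0 -> analytic_at g s0 -> analytic_at (fun s => f s - g s) s0.
Proof.
  intros [a Ha] [b Hb]. exists (fun n => a n - b n).
  eapply filter_imp; [|exact (filter_and _ _ Ha Hb)].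
  intros s [H1 H2]. eapply is_Cseries_ext; [|exact (is_Cseries_minus _ _ _ _ H1 H2)].
  intros n. cbv beta. ring.
Qed.

Lemma analytic_zero_locally f s0 :
  analytic_at f s0 ->
  (forall d, (0 < d)%R -> exists s : C, s <> s0 /\ (Cmod (s - s0) < d)%R /\ f s = 0) ->
  exists r, (0 < r)%R /\ forall s, (Cmod (s - s0) < r)%R -> f s = 0.
Proof.
  intros [a Ha] Hz. apply locally_C_Cmod in Ha. destruct Ha as [r [Hr Ha]].
  assert (Z : forall n, a n = 0).
  { apply (power_series_zero_coef a (fun z => f (s0 + z)) r Hr).
    - intros z _ Hzr. specialize (Ha (s0 + z)).
      replace (s0 + z - s0) with z in Ha by ring. now apply Ha.
    - intros d Hd. destruct (Hz d Hd) as [s [H1 [H2 H3]]].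
      exists (s - s0). split; [now apply Cminus_eq_contra|]. split; [exact H2|].
      replace (s0 + (s - s0)) with s by ring. exact H3. }
  exists r. split; [exact Hr|]. intros s Hs.
  eapply is_Cseries_unique; [exact (Ha s Hs)|].
  eapply is_Cseries_ext; [|exact is_Cseries_zero]. intros n. cbv beta. rewrite Z. ring.
Qed.

Lemma Cmod_real_shift (p q : R) (y : R) : Cmod ((p, y) - (q, y)) = Rabs (p - q).
Proof.
  replace ((p, y) - (q, y)) with (RtoC (p - q)) by (apply C_ext; simpl; ring).
  apply Cmod_R.
Qed.

(** Continuation to the left: at the end of the largest half-line of zeros the zeros are not
isolated, so f vanishes in a disc around it. *)
Lemma zero_on_horizontal f y X :
  (forall x, analytic_at f (x, y)) ->
  (forall x, (X < x)%R -> f (x, y) = 0) -> forall x, f (x, y) = 0.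
Proof.
  intros Ha H0 x1. apply NNPP. intros Hn.
  (* the abscissa is reversed so that the leftward motion becomes a supremum *)
  set (A := fun u => forall t, (t <= u)%R -> f (- t, y)%R = 0).
  destruct (completeness A) as [m [Hub Hlub]].
  - exists (- x1)%R. intros u Hu. apply Rnot_lt_le. intros H. apply Hn.
    replace x1 with (- - x1)%R by ring. apply Hu. lra.
  - exists (- X - 1)%R. intros t Ht. apply H0. lra.
  - assert (Hlt : forall t, (t < m)%R -> f (- t, y)%R = 0).
    { intros t Ht. apply NNPP. intros Hf.
      assert (m <= t)%R; [|lra]. apply Hlub. intros u Hu. apply Rnot_lt_le.
      intros H. apply Hf, Hu. lra. }
    destruct (analytic_zero_locally f (- m, y)%R (Ha _)) as [r [Hr Hz]].
    { intros d Hd. exists (- (m - d / 2), y)%R. split; [|split].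
      - intros Eq. injection Eq. lra.
      - rewrite Cmod_real_shift. replace (- (m - d / 2) - - m)%R with (d / 2)%R by ring.
        rewrite Rabs_pos_eq; lra.
      - apply Hlt; lra. }
    assert (A (m + r / 2)%R).
    { intros t Ht. destruct (Rlt_dec t m) as [|H]; [now apply Hlt|].
      apply Hz. rewrite Cmod_real_shift. apply Rabs_def1; lra. }
    pose proof (Hub _ H). lra.
Qed.

(** A horizontal line off the real axis avoids 1 and meets the half-plane Re s > 1; real points
are limits of points on such lines. *)
Lemma identity_theorem f :
  (forall s : C, s <> 1 -> analytic_at f s) ->
  (forall s, (1 < Re s)%R -> f s = 0) -> forall s : C, s <> 1 -> f s = 0.
Proof.
  intros Ha H0.
  assert (N : forall x y, y <> 0%R -> f (x, y) = 0).
  { intros x y Hy. apply (zero_on_horizontal f y 1).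
    - intros t. apply Ha. intros E. injection E. auto.
    - intros t Ht. now apply H0. }
  intros s Hs. destruct (analytic_zero_locally f s (Ha s Hs)) as [r [Hr Hz]].
  - intros d Hd. destruct s as [x y].
    exists (x, if Req_EM_T y 0 then d / 2 else y + Rmin (d / 2) (Rabs y / 2))%R.
    destruct (Req_EM_T y 0) as [->|Hy].
    + split; [|split].
      * intros E; injection E; lra.
      * replace ((x, d / 2)%R - (x, 0%R)) with (RtoC (d / 2) * Ci)
          by (apply C_ext; simpl; ring).
        rewrite Cmod_mult, Cmod_Ci, Cmod_RtoC_pos; lra.
      * apply N. lra.
    + pose proof (Rabs_pos_lt y Hy).
      assert (Hm : (0 < Rmin (d / 2) (Rabs y / 2))%R) by (apply Rmin_glb_lt; lra).
      pose proof (Rmin_l (d / 2) (Rabs y / 2)). pose proof (Rmin_r (d / 2) (Rabs y / 2)).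
      set (e := Rmin (d / 2) (Rabs y / 2)) in *.
      split; [|split].
      * intros E; injection E; lra.
      * replace ((x, (y + e)%R) - (x, y)) with (RtoC e * Ci)
          by (apply C_ext; simpl; ring).
        rewrite Cmod_mult, Cmod_Ci, Cmod_RtoC_pos; lra.
      * apply N. intros E. assert (y = - e)%R by lra.
        unfold Rabs in *. destruct (Rcase_abs y); lra.
  - apply Hz. replace (s - s) with (RtoC 0) by ring. now rewrite Cmod_0.
Qed.

(** * The kernel 1 / cosh^2(pi x) *)

Definition sech2 (x : R) : R := (/ cosh (PI * x) ^ 2)%R.

Lemma cosh_pos x : (0 < cosh x)%R.
Proof. unfold cosh. pose proof (exp_pos x). pose proof (exp_pos (- x)). lra. Qed.

Lemma cosh_opp x : cosh (- x) = cosh x.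
Proof. unfold cosh. rewrite Ropp_involutive. lra. Qed.

Lemma sech2_even x : sech2 (- x) = sech2 x.
Proof. unfold sech2. now rewrite Ropp_mult_distr_r_reverse, cosh_opp. Qed.

Lemma sech2_pos x : (0 < sech2 x)%R.
Proof. apply Rinv_0_lt_compat, pow_lt, cosh_pos. Qed.

Lemma PI_ge_1 : (1 <= PI)%R.
Proof. pose proof PI2_1. lra. Qed.

Lemma exp_le_compat x y : (x <= y)%R -> (exp x <= exp y)%R.
Proof. intros [H| ->]; [left; now apply exp_increasing | lra]. Qed.

(** Since pi >= 1; the weak exponent 2 leaves room for a factor exp|x| in front of the kernel. *)
Lemma sech2_le x : (sech2 x <= 4 * exp (- (2 * Rabs x)))%R.
Proof.
  assert (H : (exp (Rabs x) / 2 <= cosh (PI * x))%R).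
  { pose proof PI_ge_1. pose proof (exp_pos (PI * x)). pose proof (exp_pos (- (PI * x))).
    unfold cosh. unfold Rabs. destruct (Rcase_abs x) as [Hx|Hx].
    - assert (exp (- x) <= exp (- (PI * x)))%R by (apply exp_le_compat; nra). lra.
    - assert (exp x <= exp (PI * x))%R by (apply exp_le_compat; nra). lra. }
  pose proof (exp_pos (Rabs x)) as Hp.
  replace (4 * exp (- (2 * Rabs x)))%R with (/ (exp (Rabs x) / 2) ^ 2)%R.
  - apply Rinv_le_contravar; [apply pow_lt; lra|]. apply pow_incr; lra.
  - replace (- (2 * Rabs x))%R with (- (Rabs x + Rabs x))%R by ring.
    rewrite exp_Ropp, exp_plus. field. lra.
Qed.

Lemma sech2_continuous x : continuous sech2 x.
Proof.
  unfold sech2. apply (continuous_real_comp (U := R_UniformSpace) (fun x => cosh (PI * x) ^ 2)%R Rinv).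
  - apply (@ex_derive_continuous R_AbsRing R_NormedModule).
    unfold cosh. auto_derive. auto.
  - apply continuous_Rinv. apply Rgt_not_eq, pow_lt, cosh_pos.
Qed.

Lemma kernel_bound f C0 :
  (forall x, (Cmod (f x) <= C0 * exp (Rabs x))%R) ->
  forall x, (Cmod (f x * RtoC (sech2 x)) <= 4 * C0 * exp (- Rabs x))%R.
Proof.
  intros H x. pose proof (sech2_pos x).
  rewrite Cmod_mult, Cmod_RtoC_pos by lra.
  pose proof (sech2_le x) as Hs. specialize (H x). pose proof (Cmod_ge_0 (f x)).
  replace (4 * C0 * exp (- Rabs x))%R with
    ((C0 * exp (Rabs x)) * (4 * exp (- (2 * Rabs x))))%R.
  - apply Rmult_le_compat; lra.
  - replace (exp (- Rabs x)) with (exp (Rabs x) * exp (- (2 * Rabs x)))%R; [ring|].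
    rewrite <- exp_plus. f_equal. ring.
Qed.

Lemma kernel_continuous f : Ccontinuous f -> Ccontinuous (fun x => f x * RtoC (sech2 x)).
Proof.
  intros H x. apply Ccont_mult; [apply H|]. apply Ccont_RtoC, sech2_continuous.
Qed.

Lemma kernel_dominated f C0 : Ccontinuous f ->
  (forall x, (Cmod (f x) <= C0 * exp (Rabs x))%R) ->
  Dominated (fun x => f x * RtoC (sech2 x)).
Proof.
  intros Hf Hb. split; [now apply kernel_continuous|].
  exists (4 * C0)%R. now apply kernel_bound.
Qed.

(** The growth of x |-> log(a + ix): its exponentials, of whatever rate A, are absorbed by the
kernel. *)
Definition Log_growth (L : R -> C) : Prop :=
  Ccontinuous L /\
  forall A, (0 <= A)%R -> exists C0, forall x, (exp (A * Cmod (L x)) <= C0 * exp (Rabs x))%R.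

Lemma Ccontinuous_line (p q : C) : Ccontinuous (fun x => p + RtoC x * q).
Proof. intros x. eapply Cderiv_cont, Cderiv_line. Qed.

Lemma Clog_line_growth (a : C) : (0 < Re a)%R ->
  Log_growth (fun x => Clog (a + RtoC x * Ci)).
Proof.
  intros Ha.
  assert (Er : forall x, Re (a + RtoC x * Ci) = Re a) by (intros x; destruct a; simpl; ring).
  split.
  - intros x. apply Ccont_log; [now rewrite Er|]. apply Ccontinuous_line.
  - intros A HA. destruct (Clog_growth A (Re a) (Re a) HA Ha) as [K HK].
    exists (exp (K + Rabs (Im a))). intros x.
    rewrite <- exp_plus. apply exp_le_compat.
    eapply Rle_trans; [apply HK; rewrite Er; lra|].
    replace (Im (a + RtoC x * Ci)) with (Im a + x)%R by (destruct a; simpl; ring).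
    pose proof (Rabs_triang (Im a) x). lra.
Qed.

(** * Moments of a slowly growing function against the kernel *)

Section Moments.
Variables (L : R -> C) (HL : Log_growth L).

Definition moment (w : C) (k : nat) : C :=
  line_int (fun x => (Cexp (w * L x) * L x ^ k) * RtoC (sech2 x)).

Lemma pow_le_fact_exp (y : R) k : (0 <= y)%R -> (y ^ k <= INR (fact k) * exp y)%R.
Proof.
  intros Hy. induction k as [|k IH] in y, Hy |- *.
  - simpl. rewrite Rmult_1_l. rewrite <- exp_0. now apply exp_le_compat.
  (* phi is nondecreasing by the induction hypothesis and phi 0 >= 0 *)
  - set (phi := fun t => (INR (fact (S k)) * exp t - t ^ S k)%R).
    destruct (MVT_gen phi 0 y (fun t => INR (fact (S k)) * exp t - INR (S k) * t ^ k)%R)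
      as [c [Hc1 Hc2]].
    + intros x _. unfold phi. auto_derive; auto.
      change (fact k + k * fact k)%nat with (fact (S k)). rewrite (S_INR k).
      destruct k; simpl INR; ring.
    + intros x _. apply continuity_pt_filterlim,
        (@ex_derive_continuous R_AbsRing R_NormedModule). unfold phi. auto_derive; auto.
    + rewrite Rmin_left, Rmax_right in Hc1 by lra.
      specialize (IH c ltac:(lra)).
      assert (E : INR (fact (S k)) = (INR (S k) * INR (fact k))%R)
        by (change (fact (S k)) with (S k * fact k)%nat; apply mult_INR).
      assert (0 <= phi y - phi 0%R)%R.
      { rewrite Hc2. apply Rmult_le_pos; [|lra]. rewrite E.
        pose proof (pos_INR (S k)). nra. }
      assert (0 <= phi 0%R)%R.
      { unfold phi. rewrite pow_i by lia. rewrite exp_0.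
        pose proof (pos_INR (fact (S k))). lra. }
      unfold phi at 1 in H. lra.
Qed.

Lemma moment_continuous w k : Ccontinuous (fun x => Cexp (w * L x) * L x ^ k).
Proof.
  intros x. apply Ccont_mult.
  - apply Ccont_exp, Ccont_mult; [apply Ccont_const | apply HL].
  - apply Ccont_pow, HL.
Qed.

Lemma moment_dominated w k :
  Dominated (fun x => (Cexp (w * L x) * L x ^ k) * RtoC (sech2 x)).
Proof.
  destruct (proj2 HL (Cmod w + 1)%R) as [C0 HC]; [pose proof (Cmod_ge_0 w); lra|].
  apply kernel_dominated with (C0 := (INR (fact k) * C0)%R); [apply moment_continuous|].
  intros x. rewrite Cmod_mult, Cmod_pow.
  eapply Rle_trans.
  - apply Rmult_le_compat; [apply Cmod_ge_0 | apply pow_le, Cmod_ge_0 | apply Cmod_Cexp_le |].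
    apply pow_le_fact_exp, Cmod_ge_0.
  - rewrite Cmod_mult. specialize (HC x).
    replace ((Cmod w + 1) * Cmod (L x))%R with (Cmod w * Cmod (L x) + Cmod (L x))%R in HC by ring.
    rewrite exp_plus in HC. pose proof (pos_INR (fact k)). nra.
Qed.

Definition exp_moment (w : C) : C := line_int (fun x => Cexp (w * L x) * RtoC (sech2 x)).

Lemma moment_partial_sum w h n :
  sum_n (fun k => h ^ k / INR (fact k) * moment w k) n =
    line_int (fun x => (Cexp (w * L x) * exp_partial n (h * L x)) * RtoC (sech2 x)) /\
  Dominated (fun x => (Cexp (w * L x) * exp_partial n (h * L x)) * RtoC (sech2 x)).
Proof.
  induction n as [|n [IH1 IH2]].
  - assert (E : (fun x => (Cexp (w * L x) * exp_partial 0 (h * L x)) * RtoC (sech2 x)) =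
      (fun x => (Cexp (w * L x) * L x ^ 0) * RtoC (sech2 x))).
    { apply functional_extensionality. intros x.
      now rewrite exp_partial_0. }
    rewrite E. split; [|apply moment_dominated].
    rewrite sum_O. fold (moment w 0). simpl. field.
  - assert (E : (fun x => (Cexp (w * L x) * exp_partial (S n) (h * L x)) * RtoC (sech2 x)) =
      (fun x => (Cexp (w * L x) * exp_partial n (h * L x)) * RtoC (sech2 x) +
        h ^ S n / INR (fact (S n)) * ((Cexp (w * L x) * L x ^ S n) * RtoC (sech2 x)))).
    { apply functional_extensionality. intros x.
      rewrite exp_partial_S, Cpow_mult_l. unfold Cdiv. ring. }
    rewrite E. split.
    + rewrite line_int_plus, line_int_scal, Csum_Sn, IH1;
      [reflexivity | apply moment_dominated | exact IH2 | apply Dominated_scal, moment_dominated].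
    + apply Dominated_plus; [exact IH2 | apply Dominated_scal, moment_dominated].
Qed.

(** Termwise integration of exp((w + h) L) = exp(w L) * sum of (h L)^k / k!.  The remainder
after the term of degree n is at most 2^-(n+1) exp((|w| + 2|h|) |L|) by [exp_remainder], and the
exponential is absorbed by the kernel. *)
Lemma exp_moment_expansion w h :
  is_Cseries (fun k => h ^ k / INR (fact k) * moment w k) (exp_moment (w + h)).
Proof.
  destruct (proj2 HL (Cmod w + 2 * Cmod h)%R) as [C0 HC].
  { pose proof (Cmod_ge_0 w). pose proof (Cmod_ge_0 h). lra. }
  assert (HC0 : (0 <= C0)%R).
  { specialize (HC 0%R). rewrite Rabs_R0, exp_0 in HC.
    pose proof (exp_pos ((Cmod w + 2 * Cmod h) * Cmod (L 0%R))). lra. }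
  apply is_Cseries_eps. intros e He.
  destruct (half_pow_lt (e / (8 * C0 + 1))) as [N HN]; [apply Rdiv_lt_0_compat; lra|].
  exists N. intros n Hn. destruct (moment_partial_sum w h n) as [E D].
  rewrite E.
  set (rem := fun x => Cexp (w * L x) * (exp_partial n (h * L x) - Cexp (h * L x))).
  assert (Hb : forall x, (Cmod (rem x) <= (/ 2) ^ S n * C0 * exp (Rabs x))%R).
  { intros x. unfold rem. rewrite Cmod_mult.
    replace (exp_partial n (h * L x) - Cexp (h * L x)) with
      (- (Cexp (h * L x) - exp_partial n (h * L x))) by ring.
    rewrite Cmod_opp.
    eapply Rle_trans.
    - apply Rmult_le_compat; try apply Cmod_ge_0; [apply Cmod_Cexp_le | apply exp_remainder].
    - rewrite !Cmod_mult. specialize (HC x).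
      replace ((Cmod w + 2 * Cmod h) * Cmod (L x))%R with
        (Cmod w * Cmod (L x) + 2 * (Cmod h * Cmod (L x)))%R in HC by ring.
      rewrite exp_plus in HC.
      assert (0 <= (/ 2) ^ S n)%R by (apply pow_le; lra). nra. }
  assert (Dw : Dominated (fun x => Cexp ((w + h) * L x) * RtoC (sech2 x))).
  { replace (fun x => Cexp ((w + h) * L x) * RtoC (sech2 x)) with
      (fun x => (Cexp ((w + h) * L x) * L x ^ 0) * RtoC (sech2 x)).
    - apply moment_dominated.
    - apply functional_extensionality. intros x. simpl. ring. }
  assert (Er : line_int (fun x => (Cexp (w * L x) * exp_partial n (h * L x)) * RtoC (sech2 x))
     - exp_moment (w + h) = line_int (fun x => rem x * RtoC (sech2 x))).
  { unfold exp_moment. 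
    replace (line_int (fun x => rem x * RtoC (sech2 x))) with
      (line_int (fun x => (Cexp (w * L x) * exp_partial n (h * L x)) * RtoC (sech2 x) +
        (- (1)) * (Cexp ((w + h) * L x) * RtoC (sech2 x)))).
    - rewrite line_int_plus, line_int_scal; [ring | exact Dw | exact D | now apply Dominated_scal].
    - apply line_int_ext. intros x. unfold rem. rewrite Cmult_plus_distr_r, Cexp_plus. ring. }
  rewrite Er.
  assert (Hcont : Ccontinuous rem).
  { intros x. unfold rem. apply Ccont_mult.
    - apply Ccont_exp, Ccont_mult; [apply Ccont_const | apply HL].
    - apply Ccont_minus.
      + clear -HL. induction n.
        * eapply Ccont_ext; [|apply (Ccont_const 1)]. intros u; cbv beta; now rewrite exp_partial_0.
        * eapply Ccont_ext.
          2: apply Ccont_plus; [exact IHn|].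
          2: apply Ccont_mult; [|apply (Ccont_const (/ INR (fact (S n))))].
          2: apply Ccont_pow, Ccont_mult; [apply Ccont_const | apply HL].
          intros u; cbv beta. now rewrite exp_partial_S.
      + apply Ccont_exp, Ccont_mult; [apply Ccont_const | apply HL]. }
  eapply Rle_lt_trans.
  - apply line_int_bound with (C0 := (4 * ((/ 2) ^ S n * C0))%R).
    + now apply kernel_continuous.
    + now apply kernel_bound.
  - specialize (HN (S n) ltac:(lia)).
    apply Rmult_lt_compat_l with (r := (8 * C0 + 1)%R) in HN; [|lra].
    replace ((8 * C0 + 1) * (e / (8 * C0 + 1)))%R with e in HN by (field; lra).
    assert (0 <= (/ 2) ^ S n)%R by (apply pow_le; lra). lra.
Qed.
End Moments.

(** * Dividing a power series by a linear factor *)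

(** The coefficients of (sum of a k h^k) / (d + h) in powers of h. *)
Fixpoint quotient_coef (a : nat -> C) (d : C) (n : nat) : C :=
  match n with
  | O => a O / d
  | S m => (a (S m) - quotient_coef a d m) / d
  end.

(** Exact at every finite stage: multiplied by d + h, the partial sums of the quotient differ
from those of the dividend by a single term, so no product of series is needed. *)
Lemma quotient_partial_sum (a : nat -> C) (d h : C) n : d <> 0 ->
  (d + h) * sum_n (fun k => quotient_coef a d k * h ^ k) n =
  sum_n (fun k => a k * h ^ k) n + quotient_coef a d n * h ^ S n.
Proof.
  intros Hd. induction n.
  - rewrite !sum_O. simpl. field. exact Hd.
  - rewrite !Csum_Sn, Cmult_plus_distr_l, IHn. simpl. field. exact Hd.
Qed.

Lemma quotient_coef_bound (a : nat -> C) (d : C) K : d <> 0 -> (0 <= K)%R ->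
  (forall n, (Cmod (a n) <= K)%R) ->
  forall n, (Cmod (quotient_coef a d n) <= K * (1 + 2 / Cmod d) ^ S n)%R.
Proof.
  intros Hd HK Ha n.
  assert (Hp : (0 < Cmod d)%R) by now apply Cmod_gt_0.
  set (rho := (1 + 2 / Cmod d)%R).
  assert (Hi : (0 < / Cmod d)%R) by now apply Rinv_0_lt_compat.
  assert (Hr : (1 <= rho)%R) by (unfold rho, Rdiv; lra).
  assert (Hr2 : (2 * / Cmod d <= rho)%R) by (unfold rho, Rdiv; lra).
  induction n.
  - simpl. rewrite Cmod_div by exact Hd. specialize (Ha O). pose proof (Cmod_ge_0 (a O)).
    unfold Rdiv. apply Rmult_le_compat; lra.
  - simpl quotient_coef. rewrite Cmod_div by exact Hd.
    assert (H : (Cmod (a (S n) - quotient_coef a d n) <= 2 * (K * rho ^ S n))%R).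
    { eapply Rle_trans; [apply Cmod_triangle|]. rewrite Cmod_opp. specialize (Ha (S n)).
      assert (1 <= rho ^ S n)%R by now apply pow_R1_Rle. nra. }
    replace (rho ^ S (S n))%R with (rho * rho ^ S n)%R by reflexivity.
    assert (0 <= K * rho ^ S n)%R by (apply Rmult_le_pos; [exact HK|apply pow_le; lra]).
    unfold Rdiv. pose proof (Cmod_ge_0 (a (S n) - quotient_coef a d n)).
    eapply Rle_trans; [apply Rmult_le_compat_r; [lra | exact H]|]. nra.
Qed.

(** The series is assumed to converge everywhere, so its coefficients are bounded and those of
the quotient grow at most geometrically ([quotient_coef_bound]); near s0 the single leftover
term of [quotient_partial_sum] tends to 0. *)
Lemma analytic_quotient (F : C -> C) (a : nat -> C) (s0 p : C) :
  s0 <> p ->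
  (forall s, is_Cseries (fun n => a n * (s - s0) ^ n) (F s)) ->
  analytic_at (fun s => F s / (s - p)) s0.
Proof.
  intros Hs Ha. set (d := s0 - p).
  assert (Hd : d <> 0) by now apply Cminus_eq_contra.
  assert (HK : exists K, (0 <= K)%R /\ forall n, (Cmod (a n) <= K)%R).
  { apply is_Cseries_bounded with (F (s0 + 1)).
    eapply is_Cseries_ext; [|apply Ha]. intros n. cbv beta.
    replace (s0 + 1 - s0) with (RtoC 1) by ring. rewrite Cpow_1_l. ring. }
  destruct HK as [K [HK0 HK]].
  pose proof (quotient_coef_bound a d K Hd HK0 HK) as HB.
  assert (Hp : (0 < Cmod d)%R) by now apply Cmod_gt_0.
  set (rho := (1 + 2 / Cmod d)%R) in *.
  assert (Hi : (0 < / Cmod d)%R) by now apply Rinv_0_lt_compat.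
  assert (Hr : (1 <= rho)%R) by (unfold rho, Rdiv; lra).
  assert (Hrd : (1 < rho * Cmod d)%R).
  { replace (rho * Cmod d)%R with (Cmod d + 2)%R by (unfold rho; field; lra). lra. }
  exists (quotient_coef a d). apply locally_C_Cmod.
  (* on this disc rho |h| <= 1/2 beats the growth rho^n of the coefficients, and |h| < |d| *)
  exists (/ (2 * rho))%R. split; [apply Rinv_0_lt_compat; lra|].
  intros s Hss. set (h := s - s0) in *.
  assert (Hrh : (rho * Cmod h <= / 2)%R).
  { apply Rmult_lt_compat_l with (r := rho) in Hss; [|lra].
    replace (rho * / (2 * rho))%R with (/ 2)%R in Hss by (field; lra). lra. }
  assert (Hdh : (Cmod h < Cmod d)%R) by (pose proof (Cmod_ge_0 h); nra).
  assert (Hn : d + h <> 0).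
  { intros E. replace h with (- d) in Hdh.
    - rewrite Cmod_opp in Hdh. lra.
    - rewrite <- (Cplus_0_r (- d)), <- E. ring. }
  replace (s - p) with (d + h) by (unfold d, h; ring).
  assert (Hdp : (0 < Cmod (d + h))%R) by now apply Cmod_gt_0.
  apply is_Cseries_eps. intros e He.
  destruct (proj1 (is_Cseries_eps _ _) (Ha s) (e * Cmod (d + h) / 2)%R) as [N HN].
  { apply Rmult_lt_0_compat; [nra|lra]. }
  destruct (half_pow_lt (e * Cmod (d + h) / 2 / (K + 1))%R) as [M HM].
  { apply Rdiv_lt_0_compat; [apply Rmult_lt_0_compat; [nra|lra]|lra]. }
  exists (N + M)%nat. intros n Hnn.
  specialize (HN n ltac:(lia)). specialize (HM (S n) ltac:(lia)).
  pose proof (quotient_partial_sum a d h n Hd) as HQ.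
  fold h in HN.
  set (S1 := sum_n (fun k => quotient_coef a d k * h ^ k) n) in *.
  set (S2 := sum_n (fun k => a k * h ^ k) n) in *.
  replace (S1 - F s / (d + h)) with (((S2 - F s) + quotient_coef a d n * h ^ S n) / (d + h)).
  - rewrite Cmod_div by exact Hn.
    apply Rmult_lt_reg_r with (Cmod (d + h)); [exact Hdp|].
    unfold Rdiv. rewrite Rmult_assoc, Rinv_l, Rmult_1_r by lra.
    eapply Rle_lt_trans; [apply Cmod_triangle|].
    assert (HT : (Cmod (quotient_coef a d n * h ^ S n) <= K * (/ 2) ^ S n)%R).
    { rewrite Cmod_mult, Cmod_pow.
      eapply Rle_trans.
      - apply Rmult_le_compat_r; [apply pow_le, Cmod_ge_0 | apply HB].
      - rewrite Rmult_assoc, <- Rpow_mult_distr. apply Rmult_le_compat_l; [exact HK0|].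
        apply pow_incr. split; [|exact Hrh]. apply Rmult_le_pos; [lra | apply Cmod_ge_0]. }
    apply Rmult_lt_compat_l with (r := (K + 1)%R) in HM; [|lra].
    replace ((K + 1) * (e * Cmod (d + h) / 2 / (K + 1)))%R with (e * Cmod (d + h) / 2)%R in HM
      by (field; lra).
    assert (0 <= (/ 2) ^ S n)%R by (apply pow_le; lra). lra.
  - replace S1 with ((d + h) * S1 / (d + h)) by (field; exact Hn).
    rewrite HQ. field. exact Hn.
Qed.

(** * Moving a vertical line of integration *)

Definition Plane : UniformSpace := prod_UniformSpace R_UniformSpace R_UniformSpace.

Lemma Cderiv_horizontal (x t : R) : Cderiv (fun u => (u, x)) t 1.
Proof.
  eapply Cderiv_change; [apply (Cderiv_line (0, x)%R 1)| |reflexivity].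
  intros u. apply C_ext; simpl; ring.
Qed.

Lemma Cderiv_vertical (t x : R) : Cderiv (fun y => (t, y)) x Ci.
Proof.
  eapply Cderiv_change; [apply (Cderiv_line (t, 0)%R Ci)| |reflexivity].
  intros u. apply C_ext; simpl; ring.
Qed.

Lemma Ccont_2d (h : C -> C) (t x : R) :
  Ccont (U := Plane) h (t, x) ->
  continuity_2d_pt (fun u v => Re (h (u, v))) t x /\
  continuity_2d_pt (fun u v => Im (h (u, v))) t x.
Proof.
  intros [H1 H2]. split; apply continuity_2d_pt_filterlim.
  - eapply filterlim_ext; [|exact H1]. intros [u v]; reflexivity.
  - eapply filterlim_ext; [|exact H2]. intros [u v]; reflexivity.
Qed.

Lemma locally_open_interval lo hi t : (lo < t < hi)%R ->
  locally t (fun y : R => (lo < y < hi)%R).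
Proof.
  intros H.
  assert (He : (0 < Rmin (t - lo) (hi - t))%R) by (apply Rmin_glb_lt; lra).
  exists (mkposreal _ He). intros y Hy.
  unfold ball in Hy; simpl in Hy; unfold AbsRing_ball, abs, minus, plus, opp in Hy;
  simpl in Hy. apply Rabs_def2 in Hy.
  pose proof (Rmin_l (t - lo) (hi - t)). pose proof (Rmin_r (t - lo) (hi - t)). lra.
Qed.

(** The integral of an analytic g along the truncated line Re w = t, as a function of t.
Analyticity enters as the chain rule along curves, the same derivative dg serving horizontal
and vertical directions. *)
Section Shift.
Variables (g dg : C -> C) (lo hi X : R).
Hypothesis Hd : forall (gam : R -> C) t l, (lo < Re (gam t) < hi)%R -> Cderiv gam t l ->
  Cderiv (fun u => g (gam u)) t (l * dg (gam t)).
Hypothesis Hc : forall t x, (lo < t < hi)%R -> Ccont (U := Plane) dg (t, x).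

Lemma vertical_continuous t : (lo < t < hi)%R -> Ccontinuous (fun x => g (t, x)).
Proof.
  intros Ht x. eapply Cderiv_cont. apply (Hd (fun x => (t, x))); [exact Ht|].
  apply Cderiv_vertical.
Qed.

Lemma vertical_dg_continuous t : (lo < t < hi)%R -> Ccontinuous (fun x => dg (t, x)).
Proof.
  intros Ht x. destruct (Hc t x Ht) as [H1 H2].
  assert (Hp : filterlim (fun y : R => (t, y)) (locally x) (locally (T := Plane) (t, x))).
  { apply filterlim_locally. intros eps. exists eps. intros y Hy.
    split; [apply ball_center | exact Hy]. }
  split.
  - exact (filterlim_comp _ _ _ (fun y : R => (t, y)) (fun w => Re (dg w)) _ _ _ Hp H1).
  - exact (filterlim_comp _ _ _ (fun y : R => (t, y)) (fun w => Im (dg w)) _ _ _ Hp H2).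
Qed.

(** The derivative of g in the direction of t is -i times its derivative in the direction
of x, so the integral of the former is given by the values of g at the two ends. *)
Lemma vertical_integral_deriv t : (lo < t < hi)%R ->
  Cderiv (fun t => CInt (fun x => g (t, x)) (- X) X) t (- Ci * (g (t, X) - g (t, - X)%R)).
Proof.
  intros Ht.
  assert (Hh : forall y x, (lo < y < hi)%R -> Cderiv (fun u => g (u, x)) y (dg (y, x))).
  { intros y x Hy. eapply Cderiv_eq.
    - apply (Hd (fun u => (u, x))); [exact Hy | apply Cderiv_horizontal].
    - ring. }
  assert (Hv : forall x, Cderiv (fun x => g (t, x)) x (Ci * dg (t, x))).
  { intros x. apply (Hd (fun x => (t, x))); [exact Ht | apply Cderiv_vertical]. }
  assert (Hl : locally t (fun y : R => (lo < y < hi)%R)) by now apply locally_open_interval.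
  assert (Hdc := vertical_dg_continuous t Ht).
  split.
  - replace (Re (- Ci * (g (t, X) - g (t, - X)%R))) with
      (RInt (fun x => Derive (fun u => Re (g (u, x))) t) (- X) X).
    + apply (is_derive_RInt_param (fun u x => Re (g (u, x)))).
      * eapply filter_imp; [|exact Hl]. intros y Hy x _. eexists. exact (proj1 (Hh y x Hy)).
      * intros x _. eapply continuity_2d_pt_ext_loc.
        2: apply (proj1 (Ccont_2d dg t x (Hc t x Ht))).
        destruct Hl as [d Hl]. exists d. intros u v Hu Hv'. symmetry.
        apply is_derive_unique, Hh, Hl. exact Hu.
      * eapply filter_imp; [|exact Hl]. intros y Hy.
        apply ex_RInt_cont. intros x. exact (proj1 (vertical_continuous y Hy x)).
    + rewrite (RInt_ext _ (fun x => Re (dg (t, x))))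
        by (intros x _; apply is_derive_unique, Hh, Ht).
      apply is_RInt_unique.
      replace (Re (- Ci * (g (t, X) - g (t, - X)%R))) with
        (minus (Im (g (t, X))) (Im (g (t, - X)%R)))
        by (unfold minus, plus, opp, Re, Im; simpl; ring).
      apply (is_RInt_derive (fun x => Im (g (t, x)))).
      * intros x _. destruct (Hv x) as [_ H].
        replace (Re (dg (t, x))) with (Im (Ci * dg (t, x))) by (unfold Re, Im; simpl; ring). exact H.
      * intros x _. exact (proj1 (Hdc x)).
  - replace (Im (- Ci * (g (t, X) - g (t, - X)%R))) with
      (RInt (fun x => Derive (fun u => Im (g (u, x))) t) (- X) X).
    + apply (is_derive_RInt_param (fun u x => Im (g (u, x)))).
      * eapply filter_imp; [|exact Hl]. intros y Hy x _. eexists. exact (proj2 (Hh y x Hy)).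
      * intros x _. eapply continuity_2d_pt_ext_loc.
        2: apply (proj2 (Ccont_2d dg t x (Hc t x Ht))).
        destruct Hl as [d Hl]. exists d. intros u v Hu Hv'. symmetry.
        apply is_derive_unique, Hh, Hl. exact Hu.
      * eapply filter_imp; [|exact Hl]. intros y Hy.
        apply ex_RInt_cont. intros x. exact (proj2 (vertical_continuous y Hy x)).
    + rewrite (RInt_ext _ (fun x => Im (dg (t, x))))
        by (intros x _; apply is_derive_unique, Hh, Ht).
      apply is_RInt_unique.
      replace (Im (- Ci * (g (t, X) - g (t, - X)%R))) with
        (minus (opp (Re (g (t, X)))) (opp (Re (g (t, - X)%R))))
        by (unfold minus, plus, opp, Re, Im; simpl; ring).
      apply (is_RInt_derive (fun x => opp (Re (g (t, x))))).
      * intros x _. destruct (Hv x) as [H _].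
        replace (Im (dg (t, x))) with (opp (Re (Ci * dg (t, x))))
          by (unfold opp, Re, Im; simpl; ring).
        apply (@is_derive_opp R_AbsRing R_NormedModule). exact H.
      * intros x _. exact (proj2 (Hdc x)).
Qed.

Lemma shift_bound t0 t1 B :
  (lo < t0)%R -> (t0 <= t1)%R -> (t1 < hi)%R ->
  (forall t, (t0 <= t <= t1)%R -> (Cmod (g (t, X)) <= B)%R /\ (Cmod (g (t, - X)%R) <= B)%R) ->
  (Cmod (CInt (fun x => g (t1, x)) (- X) X - CInt (fun x => g (t0, x)) (- X) X)
     <= 2 * B * (t1 - t0))%R.
Proof.
  intros H0 H01 H1 HB.
  apply (Cderiv_bound_le (fun t => CInt (fun x => g (t, x)) (- X) X)
    (fun t => - Ci * (g (t, X) - g (t, - X)%R))); [exact H01| |].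
  - intros t Ht. apply vertical_integral_deriv. lra.
  - intros t Ht. destruct (HB t Ht) as [HB1 HB2].
    rewrite Cmod_mult, Cmod_opp, Cmod_Ci.
    eapply Rle_trans; [apply Rmult_le_compat_l; [lra|apply Cmod_triangle]|].
    rewrite Cmod_opp. lra.
Qed.
End Shift.

(** * The function sin(pi w) *)

Definition sinpi (w : C) : C := (Cexp (Ci * PI * w) - Cexp (- (Ci * PI * w))) / (2 * Ci).
Definition cospi (w : C) : C := (Cexp (Ci * PI * w) + Cexp (- (Ci * PI * w))) / 2.

Lemma C2_nz : RtoC 2 <> 0.
Proof. apply RtoC_neq0. lra. Qed.

Lemma sinpi_deriv (gam : R -> C) t l : Cderiv gam t l ->
  Cderiv (fun u => sinpi (gam u)) t (l * (PI * cospi (gam t))).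
Proof.
  intros H. eapply Cderiv_change.
  - apply (Cderiv_scal (/ (2 * Ci)) (fun u => Cexp (Ci * PI * gam u) - Cexp (- (Ci * PI * gam u)))).
    apply Cderiv_minus; apply Cderiv_exp; [|apply Cderiv_opp];
    apply (Cderiv_scal (Ci * PI)), H.
  - intros u. unfold sinpi, Cdiv. ring.
  - unfold cospi. field; repeat split; (exact Ci_nz || exact C2_nz).
Qed.

Lemma sinpi_parts t x :
  sinpi (t, x) = (sin (PI * t) * cosh (PI * x), cos (PI * t) * sinh (PI * x))%R.
Proof.
  assert (E : / (2 * Ci) = - Ci * / 2).
  { assert (H0 : Ci * Ci = - (1)) by (apply C_ext; simpl; ring).
    rewrite <- (Cmult_1_l (/ (2 * Ci))). replace (RtoC 1) with (- (Ci * Ci)) at 1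
      by (rewrite H0; ring). field; repeat split; (exact Ci_nz || exact C2_nz). }
  unfold sinpi, Cdiv. rewrite E.
  rewrite <- (RtoC_inv 2) by lra.
  replace (Ci * PI * (t, x)) with ((- (PI * x))%R, (PI * t)%R) by (apply C_ext; simpl; ring).
  unfold Cexp, cosh, sinh. simpl. rewrite Ropp_involutive, cos_neg, sin_neg.
  apply C_ext; simpl; field.
Qed.

Lemma cosh_sinh_sq y : (cosh y ^ 2 - sinh y ^ 2 = 1)%R.
Proof.
  unfold cosh, sinh. assert (exp y * exp (- y) = 1)%R
    by (rewrite <- exp_plus, Rplus_opp_r; apply exp_0). nra.
Qed.

Lemma Cmod_sinpi t x : (Cmod (sinpi (t, x)) ^ 2 = sin (PI * t) ^ 2 + sinh (PI * x) ^ 2)%R.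
Proof.
  rewrite sinpi_parts, Cmod_sq. simpl fst; simpl snd.
  pose proof (cosh_sinh_sq (PI * x)). pose proof (sin2_cos2 (PI * t)) as Hs.
  unfold Rsqr in Hs. nra.
Qed.

Lemma ex_derive_continuity_pt (f : R -> R) (x : R) : ex_derive f x -> continuity_pt f x.
Proof.
  intros H. apply continuity_pt_filterlim.
  now apply (@ex_derive_continuous R_AbsRing R_NormedModule).
Qed.

(** Half-angle formula: sin u = 2 sin v cos v >= 2 v cos^2 v = v (1 + cos u) >= v for v = u / 2. *)
Lemma sin_ge_half u : (0 <= u <= PI / 2)%R -> (u / 2 <= sin u)%R.
Proof.
  intros Hu. set (v := (u / 2)%R).
  assert (H1 : (v * cos v <= sin v)%R).
  { destruct (MVT_gen (fun v => sin v - v * cos v)%R 0 v (fun v => v * sin v)%R)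
      as [c [Hc1 Hc2]].
    - intros y _. auto_derive; auto. ring.
    - intros y _. apply ex_derive_continuity_pt. auto_derive; auto.
    - unfold v in *. rewrite Rmin_left, Rmax_right in Hc1 by lra.
      rewrite sin_0 in Hc2.
      assert (0 <= sin c)%R by (apply sin_ge_0; lra).
      assert (0 <= c * sin c * (u / 2 - 0))%R
        by (apply Rmult_le_pos; [apply Rmult_le_pos; lra|lra]). lra. }
  assert (Eu : sin u = (2 * sin v * cos v)%R)
    by (rewrite <- sin_2a; f_equal; unfold v; field).
  assert (H2 : (1 / 2 <= cos v * cos v)%R).
  { assert (0 <= cos (2 * v))%R by (apply cos_ge_0; unfold v; lra).
    rewrite cos_2a_cos in H. lra. }
  assert (H3 : (0 <= cos v)%R) by (apply cos_ge_0; unfold v; lra).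
  assert (0 <= v)%R by (unfold v; lra). rewrite Eu. change (u / 2)%R with v. nra.
Qed.

Lemma sin_pi_sq t : (- (1 / 2) <= t <= 1 / 2)%R -> (t ^ 2 <= sin (PI * t) ^ 2)%R.
Proof.
  intros Ht.
  assert (HPI : (3 <= PI)%R) by (pose proof PI2_3_2; lra).
  assert (P : forall t, (0 <= t <= 1 / 2)%R -> (t ^ 2 <= sin (PI * t) ^ 2)%R).
  { intros s Hs. apply pow_incr. split; [lra|].
    pose proof (sin_ge_half (PI * s)%R ltac:(split; nra)). nra. }
  destruct (Rle_dec 0 t) as [H|H]; [apply P; lra|].
  specialize (P (- t)%R ltac:(lra)).
  rewrite Ropp_mult_distr_r_reverse, sin_neg in P. nra.
Qed.

Lemma sinh_sq_ge y : (y ^ 2 <= sinh y ^ 2)%R.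
Proof.
  assert (P : forall z, (0 <= z)%R -> (z ^ 2 <= sinh z ^ 2)%R).
  { intros z Hz. apply pow_incr. split; [exact Hz|].
    destruct (MVT_gen (fun z => sinh z - z)%R 0 z (fun z => cosh z - 1)%R) as [c [Hc1 Hc2]].
    - intros x _. unfold sinh, cosh. auto_derive; auto. field.
    - intros x _. apply ex_derive_continuity_pt. unfold sinh; auto_derive; auto.
    - rewrite sinh_0 in Hc2.
      assert (1 <= cosh c)%R.
      { pose proof (cosh_sinh_sq c). pose proof (cosh_pos c). nra. }
      assert (0 <= (cosh c - 1) * (z - 0))%R by (apply Rmult_le_pos; lra). lra. }
  destruct (Rle_dec 0 y) as [H|H]; [now apply P|].
  specialize (P (- y)%R ltac:(lra)).
  replace (sinh (- y)) with (- sinh y)%R in P; [nra|].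
  unfold sinh. rewrite Ropp_involutive. lra.
Qed.

(** Keeps 1 / sin^2(pi w) of order |w|^-2, up to the edges of the strip. *)
Lemma sinpi_ge (w : C) : (- (1 / 2) <= Re w <= 1 / 2)%R -> (Cmod w <= Cmod (sinpi w))%R.
Proof.
  destruct w as [t x]. simpl. intros Ht.
  apply Rsqr_incr_0; try apply Cmod_ge_0. rewrite !Rsqr_pow2, Cmod_sinpi, Cmod_sq.
  simpl fst; simpl snd.
  pose proof (sin_pi_sq t Ht). pose proof (sinh_sq_ge (PI * x)).
  pose proof PI_ge_1. pose proof (pow2_ge_0 x). assert (1 <= PI ^ 2)%R by nra.
  assert (x ^ 2 <= (PI * x) ^ 2)%R by (rewrite Rpow_mult_distr; nra).
  lra.
Qed.

Lemma sinpi_nz t x : (0 < Rabs t < 1)%R -> sinpi (t, x) <> 0.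
Proof.
  intros Ht E. pose proof (Cmod_sinpi t x) as H. rewrite E, Cmod_0 in H.
  assert (Hs : sin (PI * t) <> 0%R).
  { pose proof PI_RGT_0. unfold Rabs in Ht. destruct (Rcase_abs t).
    - assert (0 < sin (PI * - t))%R by (apply sin_gt_0; nra).
      rewrite Ropp_mult_distr_r_reverse, sin_neg in H1. lra.
    - assert (0 < sin (PI * t))%R by (apply sin_gt_0; nra). lra. }
  assert (0 < sin (PI * t) ^ 2)%R by (apply pow2_gt_0; exact Hs).
  pose proof (pow2_ge_0 (sinh (PI * x))). lra.
Qed.

Lemma Cmod_cospi_le w : (Cmod (cospi w) <= exp (PI * Rabs (Im w)))%R.
Proof.
  unfold cospi. rewrite Cmod_div by exact C2_nz. rewrite (Cmod_RtoC_pos 2) by lra.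
  assert (Hm := Cmod_triangle (Cexp (Ci * PI * w)) (Cexp (- (Ci * PI * w)))).
  rewrite !Cmod_Cexp in Hm. destruct w as [t x].
  replace (Re (Ci * PI * (t, x))) with (- (PI * x))%R in Hm by (simpl; ring).
  replace (Re (- (Ci * PI * (t, x)))) with (PI * x)%R in Hm by (simpl; ring).
  pose proof PI_RGT_0. simpl Im.
  pose proof (Rle_abs x). pose proof (Rabs_maj2 x).
  assert (exp (- (PI * x)) <= exp (PI * Rabs x))%R by (apply exp_le_compat; nra).
  assert (exp (PI * x) <= exp (PI * Rabs x))%R by (apply exp_le_compat; nra).
  lra.
Qed.

Lemma sinpi_half x : sinpi ((1 / 2)%R, x) * sinpi ((1 / 2)%R, x) = RtoC (cosh (PI * x) ^ 2).
Proof.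
  rewrite sinpi_parts. replace (PI * (1 / 2))%R with (PI / 2)%R by field.
  rewrite sin_PI2, cos_PI2. apply C_ext; simpl; ring.
Qed.

Lemma sinpi_mhalf x : sinpi ((- (1 / 2))%R, x) * sinpi ((- (1 / 2))%R, x) = RtoC (cosh (PI * x) ^ 2).
Proof.
  rewrite sinpi_parts. replace (PI * - (1 / 2))%R with (- (PI / 2))%R by field.
  rewrite sin_neg, cos_neg, sin_PI2, cos_PI2. apply C_ext; simpl; ring.
Qed.

(** * Integrals of the kernel *)

Lemma line_int_linear3 (f g h : R -> C) (c d : C) :
  Dominated f -> Dominated g -> Dominated h ->
  line_int (fun x => f x + c * g x + d * h x) = line_int f + c * line_int g + d * line_int h.
Proof.
  intros Hf Hg Hh.
  assert (Hcg := Dominated_scal c g Hg). assert (Hdh := Dominated_scal d h Hh).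
  rewrite (line_int_plus (fun x => f x + c * g x) (fun x => d * h x)
    (Dominated_plus _ _ Hf Hcg) Hdh).
  rewrite (line_int_plus f (fun x => c * g x) Hf Hcg).
  now rewrite (line_int_scal c g Hg), (line_int_scal d h Hh).
Qed.

Lemma line_int_odd f : Dominated f -> (forall x, f (- x)%R = - f x) -> line_int f = 0.
Proof.
  intros Hf Ho.
  assert (E : line_int f = - line_int f).
  { rewrite <- (line_int_flip f Hf) at 1.
    rewrite (line_int_ext _ (fun x => - (1) * f x)) by (intros x; rewrite Ho; ring).
    rewrite line_int_scal by exact Hf. ring. }
  assert (E2 : 2 * line_int f = 0).
  { replace (2 * line_int f) with (line_int f + line_int f) by ring. rewrite E at 1. ring. }
  replace (line_int f) with (/ 2 * (2 * line_int f)) by (field; exact C2_nz). rewrite E2. ring.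
Qed.

Lemma sech2_dominated : Dominated (fun x => 1 * RtoC (sech2 x)).
Proof.
  apply kernel_dominated with (C0 := 1%R).
  - intros x. apply Ccont_const.
  - intros x. rewrite Cmod_1, Rmult_1_l, <- exp_0. apply exp_le_compat, Rabs_pos.
Qed.

Lemma id_sech2_dominated : Dominated (fun x => RtoC x * RtoC (sech2 x)).
Proof.
  apply kernel_dominated with (C0 := 1%R).
  - intros x. apply (Ccont_RtoC (U := R_UniformSpace) (fun x => x)), continuous_id.
  - intros x. rewrite Cmod_R, Rmult_1_l. 
    destruct (Req_dec (Rabs x) 0) as [->|H]; [rewrite exp_0; lra|].
    pose proof (exp_ineq1 _ H). lra.
Qed.

Lemma line_int_id_sech2 : line_int (fun x => RtoC x * RtoC (sech2 x)) = 0.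
Proof.
  apply line_int_odd; [apply id_sech2_dominated|].
  intros x. rewrite sech2_even, RtoC_opp. ring.
Qed.

(** The primitive of the kernel is tanh(pi x) / pi. *)
Lemma CInt_sech2 X :
  CInt (fun x => 1 * RtoC (sech2 x)) (- X) X = RtoC (2 / PI * (sinh (PI * X) / cosh (PI * X))).
Proof.
  pose proof PI_RGT_0 as HP.
  set (T := fun x => (/ PI * (sinh (PI * x) / cosh (PI * x)))%R).
  assert (HT : forall x, is_derive T x (sech2 x)).
  { intros x. unfold T, sech2.
    pose proof (cosh_pos (PI * x)) as Hc. pose proof (cosh_sinh_sq (PI * x)) as Hs.
    unfold sinh, cosh in *.
    auto_derive; [lra|]. 
    set (p := exp (PI * x)) in *. set (q := exp (- (PI * x))) in *.
    assert (Hpq : (p * q = 1)%R) by lra.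
    replace (/ ((p + q) / 2) ^ 2)%R with (p * q / ((p + q) / 2) ^ 2)%R
      by (rewrite Hpq; field; lra).
    field. repeat split; lra. }
  apply CInt_unique.
  apply (@is_RInt_fct_extend_pair R_NormedModule R_NormedModule).
  - simpl. replace (2 / PI * (sinh (PI * X) / cosh (PI * X)))%R with (minus (T X) (T (- X)%R)).
    + eapply is_RInt_ext; [|apply (is_RInt_derive T sech2)].
      * intros x _. simpl. ring.
      * intros x _. apply HT.
      * intros x _. apply sech2_continuous.
    + unfold T, minus, plus, opp; simpl. rewrite Ropp_mult_distr_r_reverse, cosh_opp.
      replace (sinh (- (PI * X))) with (- sinh (PI * X))%R
        by (unfold sinh; rewrite Ropp_involutive; field).
      field. split; [apply Rgt_not_eq, cosh_pos | lra].
  - assert (H0 := @is_RInt_const R_NormedModule (- X) X 0%R).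
    rewrite (@scal_zero_r R_Ring R_ModuleSpace) in H0.
    eapply is_RInt_ext; [|exact H0]. intros x _. simpl. ring.
Qed.

Lemma line_int_sech2 : line_int (fun x => 1 * RtoC (sech2 x)) = RtoC (2 / PI).
Proof.
  pose proof PI_ge_1 as HP.
  apply line_int_eq_lim; [apply sech2_dominated|]. intros e He.
  destruct (exp_neg_small 4 e He) as [M [HM0 HM]].
  exists M. intros X HX. specialize (HM X HX).
  rewrite CInt_sech2, <- RtoC_minus, Cmod_R.
  pose proof (cosh_pos (PI * X)) as Hc.
  replace (2 / PI * (sinh (PI * X) / cosh (PI * X)) - 2 / PI)%R with
    (- (2 / PI * (exp (- (PI * X)) / cosh (PI * X))))%R
    by (unfold sinh, cosh in *; field; lra).
  assert (H1 : (exp (- (PI * X)) <= exp (- X))%R) by (apply exp_le_compat; nra).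
  assert (H2 : (1 <= cosh (PI * X))%R) by (pose proof (cosh_sinh_sq (PI * X)); nra).
  pose proof (exp_pos (- (PI * X))) as H3.
  assert (H4 : (0 <= exp (- (PI * X)) / cosh (PI * X) <= exp (- X))%R).
  { split; [apply Rmult_le_pos; [lra|left; now apply Rinv_0_lt_compat]|].
    apply Rmult_le_reg_r with (cosh (PI * X)); [lra|].
    unfold Rdiv. rewrite Rmult_assoc, Rinv_l, Rmult_1_r by lra.
    pose proof (exp_pos (- X)). nra. }
  assert (H5 : (0 < / PI <= 1)%R).
  { split; [apply Rinv_0_lt_compat; lra|]. rewrite <- Rinv_1. apply Rinv_le_contravar; lra. }
  rewrite Rabs_Ropp, Rabs_pos_eq.
  - unfold Rdiv at 1. nra.
  - unfold Rdiv at 1. apply Rmult_le_pos; lra.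
Qed.

(** * The residue at the double pole *)

(** F k is the k-th derivative of one analytic function on the right half-plane, with growth
controlled in every closed vertical strip. *)
Section Difference.
Variable F : nat -> C -> C.
Hypothesis Fd : forall k (gam : R -> C) t l, (0 < Re (gam t))%R -> Cderiv gam t l ->
  Cderiv (fun u => F k (gam u)) t (l * F (S k) (gam t)).
Hypothesis Fc : forall k (U : UniformSpace) (f : U -> C) x, (0 < Re (f x))%R -> Ccont f x ->
  Ccont (fun u => F k (f u)) x.
Hypothesis Fg : forall k c M, (0 < c)%R -> exists C0, forall z, (c <= Re z <= M)%R ->
  (Cmod (F k z) <= C0 * exp (Rabs (Im z)))%R.
Variable b : C.
Hypothesis Hb : (1 / 2 < Re b)%R.

(** Each of the three remainders at b is the derivative of the next. *)
Definition taylor_rem1 (w : C) : C := F 2 (b + w) - F 2 b.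
Definition taylor_rem2 (w : C) : C := F 1 (b + w) - F 1 b - w * F 2 b.
Definition taylor_rem3 (w : C) : C := F 0 (b + w) - F 0 b - w * F 1 b - w * w / 2 * F 2 b.

Lemma Cderiv_shift (gam : R -> C) t l : Cderiv gam t l -> Cderiv (fun u => b + gam u) t l.
Proof.
  intros H. eapply Cderiv_change.
  - apply (Cderiv_plus (fun _ => b) gam); [apply Cderiv_const | exact H].
  - reflexivity.
  - ring.
Qed.

Lemma taylor_rem1_deriv (gam : R -> C) t l : (0 < Re (b + gam t))%R -> Cderiv gam t l ->
  Cderiv (fun u => taylor_rem1 (gam u)) t (l * F 3 (b + gam t)).
Proof.
  intros Hp H. unfold taylor_rem1. eapply Cderiv_eq.
  - apply Cderiv_minus; [|apply Cderiv_const].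
    apply (Fd 2 (fun u => b + gam u)); [exact Hp | apply Cderiv_shift, H].
  - ring.
Qed.

Lemma taylor_rem2_deriv (gam : R -> C) t l : (0 < Re (b + gam t))%R -> Cderiv gam t l ->
  Cderiv (fun u => taylor_rem2 (gam u)) t (l * taylor_rem1 (gam t)).
Proof.
  intros Hp H. unfold taylor_rem2. eapply Cderiv_eq.
  - apply Cderiv_minus; [apply Cderiv_minus; [|apply Cderiv_const]|].
    + apply (Fd 1 (fun u => b + gam u)); [exact Hp | apply Cderiv_shift, H].
    + apply Cderiv_mult; [exact H | apply Cderiv_const].
  - unfold taylor_rem1. ring.
Qed.

Lemma taylor_rem3_deriv (gam : R -> C) t l : (0 < Re (b + gam t))%R -> Cderiv gam t l ->
  Cderiv (fun u => taylor_rem3 (gam u)) t (l * taylor_rem2 (gam t)).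
Proof.
  intros Hp H. unfold taylor_rem3, Cdiv. eapply Cderiv_eq.
  - apply Cderiv_minus; [apply Cderiv_minus; [apply Cderiv_minus; [|apply Cderiv_const]|]|].
    + apply (Fd 0 (fun u => b + gam u)); [exact Hp | apply Cderiv_shift, H].
    + apply Cderiv_mult; [exact H | apply Cderiv_const].
    + apply Cderiv_mult; [|apply Cderiv_const].
      apply Cderiv_mult; [|apply Cderiv_const]. apply Cderiv_mult; exact H.
  - unfold taylor_rem2. cbv beta. field.
Qed.

Definition Box (X : R) (w : C) : Prop :=
  (- (1 / 2) <= Re w <= 1 / 2)%R /\ (Rabs (Im w) <= X)%R.

Lemma Box_pos X w : Box X w -> (0 < Re (b + w))%R.
Proof. intros [H _]. destruct b, w; simpl in *. lra. Qed.

Lemma Box_scal X w t : Box X w -> (0 <= t <= 1)%R -> Box X (RtoC t * w).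
Proof.
  intros [H1 H2] Ht. destruct w as [x y]; split; simpl in *.
  - replace (t * x - 0 * y)%R with (t * x)%R by ring. nra.
  - replace (t * y + 0 * x)%R with (t * y)%R by ring.
    rewrite Rabs_mult, (Rabs_pos_eq t) by lra. pose proof (Rabs_pos y). nra.
Qed.

(** One integration along the segment from 0 to w raises the order of vanishing by one. *)
Lemma remainder_step (H G : C -> C) X M n :
  (forall (gam : R -> C) t l, (0 < Re (b + gam t))%R -> Cderiv gam t l ->
    Cderiv (fun u => H (gam u)) t (l * G (gam t))) ->
  H 0 = 0 -> (0 <= M)%R ->
  (forall w, Box X w -> (Cmod (G w) <= M * Cmod w ^ n)%R) ->
  forall w, Box X w -> (Cmod (H w) <= M * Cmod w ^ S n)%R.
Proof.
  intros Hd H0 HM HG w Hw.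
  replace (H w) with (H (RtoC 1 * w)%C - H (RtoC 0 * w)%C)
    by (rewrite Cmult_1_l, Cmult_0_l, H0; ring).
  replace (M * Cmod w ^ S n)%R with (M * Cmod w ^ S n * (1 - 0))%R by ring.
  apply (Cderiv_bound_le (fun t => H (RtoC t * w)%C) (fun t => w * G (RtoC t * w)%C)).
  - lra.
  - intros t Ht. apply (Hd (fun t => RtoC t * w)); [|apply Cderiv_id_scal].
    apply Box_pos with X. now apply Box_scal.
  - intros t Ht. rewrite Cmod_mult.
    assert (Cmod (G (RtoC t * w)%C) <= M * Cmod w ^ n)%R.
    { eapply Rle_trans; [apply HG; now apply Box_scal|].
      apply Rmult_le_compat_l; [exact HM|]. apply pow_incr. split; [apply Cmod_ge_0|].
      rewrite Cmod_mult, Cmod_RtoC_pos by lra. pose proof (Cmod_ge_0 w). nra. }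
    simpl. pose proof (Cmod_ge_0 w). nra.
Qed.

(** Three integrations of the bounded function F 3, starting from the box where it is bounded. *)
Lemma remainder_bounds X : (0 <= X)%R -> exists M, (0 <= M)%R /\ forall w, Box X w ->
  (Cmod (taylor_rem2 w) <= M * Cmod w ^ 2)%R /\ (Cmod (taylor_rem3 w) <= M * Cmod w ^ 3)%R.
Proof.
  intros HX.
  destruct (Fg 3 (Re b - 1 / 2)%R (Re b + 1 / 2)%R ltac:(lra)) as [C0 HC].
  assert (HC0 : (0 <= C0)%R).
  { specialize (HC b ltac:(lra)). pose proof (Cmod_ge_0 (F 3 b)).
    pose proof (exp_pos (Rabs (Im b))). nra. }
  set (M := (C0 * exp (Rabs (Im b) + X))%R).
  assert (HM : (0 <= M)%R).
  { apply Rmult_le_pos; [exact HC0|]. left; apply exp_pos. }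
  exists M. split; [exact HM|].
  assert (B0 : forall w, Box X w -> (Cmod (F 3 (b + w)) <= M * Cmod w ^ 0)%R).
  { intros w [H1 H2]. rewrite Rmult_1_r.
    eapply Rle_trans; [apply HC|].
    - destruct b, w; simpl in *; lra.
    - apply Rmult_le_compat_l; [exact HC0|]. apply exp_le_compat.
      replace (Im (b + w)) with (Im b + Im w)%R by (destruct b, w; reflexivity).
      pose proof (Rabs_triang (Im b) (Im w)). lra. }
  assert (B1 : forall w, Box X w -> (Cmod (taylor_rem1 w) <= M * Cmod w ^ 1)%R).
  { apply (remainder_step taylor_rem1 (fun w => F 3 (b + w))); auto.
    - apply taylor_rem1_deriv.
    - unfold taylor_rem1. rewrite Cplus_0_r. ring. }
  assert (B2 : forall w, Box X w -> (Cmod (taylor_rem2 w) <= M * Cmod w ^ 2)%R).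
  { apply (remainder_step taylor_rem2 taylor_rem1); auto.
    - apply taylor_rem2_deriv.
    - unfold taylor_rem2. rewrite Cplus_0_r. ring. }
  assert (B3 : forall w, Box X w -> (Cmod (taylor_rem3 w) <= M * Cmod w ^ 3)%R).
  { apply (remainder_step taylor_rem3 taylor_rem2); auto.
    - apply taylor_rem3_deriv.
    - unfold taylor_rem3, Cdiv. rewrite Cplus_0_r. ring. }
  auto.
Qed.

(** The third-order zero of the numerator beats the double pole with one order to spare, which
makes the quotient Lipschitz at 0 and not merely bounded. *)
Definition rem_over_sin2 (w : C) : C := taylor_rem3 w * / (sinpi w * sinpi w).
Definition rem_over_sin2_deriv (w : C) : C :=
  taylor_rem2 w * / (sinpi w * sinpi w) - 2 * PI * taylor_rem3 w * cospi w * / (sinpi w * sinpi w * sinpi w).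

Lemma rem_over_sin2_Cderiv (gam : R -> C) t l : (0 < Re (b + gam t))%R -> sinpi (gam t) <> 0 ->
  Cderiv gam t l -> Cderiv (fun u => rem_over_sin2 (gam u)) t (l * rem_over_sin2_deriv (gam t)).
Proof.
  intros Hp Hs H. unfold rem_over_sin2. eapply Cderiv_eq.
  - apply Cderiv_mult; [apply taylor_rem3_deriv; [exact Hp | exact H]|].
    apply (Cderiv_inv (fun u => sinpi (gam u) * sinpi (gam u))).
    + now apply Cmult_neq_0.
    + apply Cderiv_mult; apply sinpi_deriv, H.
  - unfold rem_over_sin2_deriv. cbv beta. field. exact Hs.
Qed.

Lemma Ccont_id (p : Plane) : Ccont (U := Plane) (fun w => w) p.
Proof.
  destruct p as [t x]. split.
  - apply (continuous_fst (U := R_UniformSpace) (V := R_UniformSpace) t x).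
  - apply (continuous_snd (U := R_UniformSpace) (V := R_UniformSpace) t x).
Qed.

Lemma sinpi_cont (w : Plane) : Ccont (U := Plane) sinpi w.
Proof.
  unfold sinpi, Cdiv. apply Ccont_mult; [|apply Ccont_const].
  apply Ccont_minus; apply Ccont_exp; [|apply Ccont_opp];
  apply Ccont_mult; try apply Ccont_const; apply Ccont_id.
Qed.

Lemma cospi_cont (w : Plane) : Ccont (U := Plane) cospi w.
Proof.
  unfold cospi, Cdiv. apply Ccont_mult; [|apply Ccont_const].
  apply Ccont_plus; apply Ccont_exp; [|apply Ccont_opp];
  apply Ccont_mult; try apply Ccont_const; apply Ccont_id.
Qed.

Lemma F_shift_cont k (w : Plane) : (0 < Re (b + w))%R ->
  Ccont (U := Plane) (fun w => F k (b + w)) w.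
Proof.
  intros H. apply (Fc k Plane (fun w => b + w)); [exact H|].
  apply Ccont_plus; [apply Ccont_const | apply Ccont_id].
Qed.

Lemma taylor_rem2_cont (w : Plane) : (0 < Re (b + w))%R -> Ccont (U := Plane) taylor_rem2 w.
Proof.
  intros Hp. unfold taylor_rem2.
  apply (Ccont_minus (U := Plane) (fun w => F 1 (b + w) - F 1 b) (fun w => w * F 2 b)).
  - apply (Ccont_minus (U := Plane) (fun w => F 1 (b + w)) (fun _ => F 1 b));
      [now apply F_shift_cont | apply Ccont_const].
  - apply (Ccont_mult (U := Plane) (fun w => w) (fun _ => F 2 b));
      [apply Ccont_id | apply Ccont_const].
Qed.

Lemma taylor_rem3_cont (w : Plane) : (0 < Re (b + w))%R -> Ccont (U := Plane) taylor_rem3 w.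
Proof.
  intros Hp. unfold taylor_rem3, Cdiv.
  apply (Ccont_minus (U := Plane) (fun w => F 0 (b + w) - F 0 b - w * F 1 b)
    (fun w => w * w * / 2 * F 2 b)).
  - apply (Ccont_minus (U := Plane) (fun w => F 0 (b + w) - F 0 b) (fun w => w * F 1 b)).
    + apply (Ccont_minus (U := Plane) (fun w => F 0 (b + w)) (fun _ => F 0 b));
        [now apply F_shift_cont | apply Ccont_const].
    + apply (Ccont_mult (U := Plane) (fun w => w) (fun _ => F 1 b));
        [apply Ccont_id | apply Ccont_const].
  - apply (Ccont_mult (U := Plane) (fun w => w * w * / 2) (fun _ => F 2 b));
      [|apply Ccont_const].
    apply (Ccont_mult (U := Plane) (fun w => w * w) (fun _ => / 2));
      [|apply Ccont_const].
    apply (Ccont_mult (U := Plane) (fun w => w) (fun w => w)); apply Ccont_id.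
Qed.

Lemma rem_over_sin2_deriv_cont (w : Plane) : (0 < Re (b + w))%R -> sinpi w <> 0 ->
  Ccont (U := Plane) rem_over_sin2_deriv w.
Proof.
  intros Hp Hs. unfold rem_over_sin2_deriv.
  assert (S2 : Ccont (U := Plane) (fun w => sinpi w * sinpi w) w)
    by (apply (Ccont_mult (U := Plane) sinpi sinpi); apply sinpi_cont).
  apply (Ccont_minus (U := Plane) (fun w => taylor_rem2 w * / (sinpi w * sinpi w))
    (fun w => 2 * PI * taylor_rem3 w * cospi w * / (sinpi w * sinpi w * sinpi w))).
  - apply (Ccont_mult (U := Plane) taylor_rem2 (fun w => / (sinpi w * sinpi w))); [now apply taylor_rem2_cont|].
    apply (Ccont_inv (U := Plane) (fun w => sinpi w * sinpi w)); [now apply Cmult_neq_0|].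
    exact S2.
  - apply (Ccont_mult (U := Plane) (fun w => 2 * PI * taylor_rem3 w * cospi w)
      (fun w => / (sinpi w * sinpi w * sinpi w))).
    + apply (Ccont_mult (U := Plane) (fun w => 2 * PI * taylor_rem3 w) cospi); [|apply cospi_cont].
      apply (Ccont_mult (U := Plane) (fun _ => 2 * PI) taylor_rem3); [apply Ccont_const|].
      now apply taylor_rem3_cont.
    + apply (Ccont_inv (U := Plane) (fun w => sinpi w * sinpi w * sinpi w)).
      * apply Cmult_neq_0; [now apply Cmult_neq_0 | exact Hs].
      * apply (Ccont_mult (U := Plane) (fun w => sinpi w * sinpi w) sinpi);
        [exact S2 | apply sinpi_cont].
Qed.

Lemma Re_shift_pos t x : (- Re b < t)%R -> (0 < Re (b + (t, x)))%R.
Proof. intros H. destruct b; simpl in *. lra. Qed.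

Lemma shift_right X t0 B : (0 < t0 <= 1 / 2)%R ->
  (forall t, (- (1 / 2) <= t <= 1 / 2)%R ->
     (Cmod (rem_over_sin2 (t, X)) <= B)%R /\ (Cmod (rem_over_sin2 (t, - X)%R) <= B)%R) ->
  (Cmod (CInt (fun x => rem_over_sin2 ((1 / 2)%R, x)) (- X) X - CInt (fun x => rem_over_sin2 (t0, x)) (- X) X)
    <= 2 * B * (1 / 2 - t0))%R.
Proof.
  intros Ht HB. apply (shift_bound rem_over_sin2 rem_over_sin2_deriv 0 1 X) with (B := B); try lra.
  - intros gam t l Hg Hd. apply rem_over_sin2_Cderiv; [| |exact Hd].
    + destruct (gam t) as [p q]. apply Re_shift_pos. simpl in Hg. lra.
    + destruct (gam t) as [p q]. apply sinpi_nz. simpl in Hg. rewrite Rabs_pos_eq; lra.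
  - intros t x Hg. apply rem_over_sin2_deriv_cont; [apply Re_shift_pos; lra|].
    apply sinpi_nz. rewrite Rabs_pos_eq; lra.
  - intros t Hg. apply HB. lra.
Qed.

Lemma shift_left X t0 B : (0 < t0 <= 1 / 2)%R ->
  (forall t, (- (1 / 2) <= t <= 1 / 2)%R ->
     (Cmod (rem_over_sin2 (t, X)) <= B)%R /\ (Cmod (rem_over_sin2 (t, - X)%R) <= B)%R) ->
  (Cmod (CInt (fun x => rem_over_sin2 ((- t0)%R, x)) (- X) X
      - CInt (fun x => rem_over_sin2 ((- (1 / 2))%R, x)) (- X) X)
    <= 2 * B * (1 / 2 - t0))%R.
Proof.
  intros Ht HB.
  replace (1 / 2 - t0)%R with (- t0 - - (1 / 2))%R by ring.
  assert (Hm : (- Rmin 1 (Re b) < - (1 / 2))%R).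
  { apply Ropp_lt_contravar. apply Rmin_glb_lt; lra. }
  assert (Hm1 := Rmin_l 1 (Re b)). assert (Hm2 := Rmin_r 1 (Re b)).
  apply (shift_bound rem_over_sin2 rem_over_sin2_deriv (- Rmin 1 (Re b)) 0 X) with (B := B); try lra.
  - intros gam t l Hg Hd. apply rem_over_sin2_Cderiv; [| |exact Hd].
    + destruct (gam t) as [p q]. apply Re_shift_pos. simpl in Hg. lra.
    + destruct (gam t) as [p q]. apply sinpi_nz. simpl in Hg. rewrite Rabs_left; lra.
  - intros t x Hg. apply rem_over_sin2_deriv_cont; [apply Re_shift_pos; lra|].
    apply sinpi_nz. rewrite Rabs_left; lra.
  - intros t Hg. apply HB. lra.
Qed.

Lemma rem_over_sin2_line_continuous t : (0 < Rabs t <= 1 / 2)%R -> Ccontinuous (fun x => rem_over_sin2 (t, x)).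
Proof.
  intros Ht x. eapply Cderiv_cont. apply (rem_over_sin2_Cderiv (fun x => (t, x))).
  - apply Re_shift_pos. unfold Rabs in Ht. destruct (Rcase_abs t); lra.
  - apply sinpi_nz. lra.
  - apply Cderiv_vertical.
Qed.

(** For x <> 0 the segment from (-e, x) to (e, x) avoids the singularity and the derivative is
bounded on it uniformly in x; for x = 0 both values are themselves O(e). *)
Lemma gap_pointwise X : (0 <= X)%R -> exists M, (0 <= M)%R /\
  forall e x, (0 < e <= 1 / 2)%R -> (- X <= x <= X)%R ->
  (Cmod (rem_over_sin2 (e, x) - rem_over_sin2 ((- e)%R, x)) <= M * e)%R.
Proof.
  intros HX. destruct (remainder_bounds X HX) as [M [HM HB]].
  set (M' := (M * (1 + 2 * PI * exp (PI * X)))%R).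
  assert (HP : (0 < exp (PI * X))%R) by apply exp_pos.
  pose proof PI_ge_1 as HPI.
  assert (HM' : (0 <= M')%R).
  { apply Rmult_le_pos; [exact HM|]. nra. }
  assert (HMM : (M <= M')%R) by (unfold M'; assert (0 <= M * (2 * PI * exp (PI * X)))%R
    by (apply Rmult_le_pos; [exact HM | nra]); lra).
  exists (2 * M')%R. split; [lra|].
  intros e x He Hx.
  destruct (Req_dec x 0) as [->|Hx0].
  - assert (G : forall t, t <> 0%R -> (- (1 / 2) <= t <= 1 / 2)%R ->
      (Cmod (rem_over_sin2 (t, 0%R)) <= M * Rabs t)%R).
    { intros t Ht0 Ht. unfold rem_over_sin2.
      replace (t, 0%R) with (RtoC t) by reflexivity.
      assert (Hbox : Box X (RtoC t)).
      { split; simpl; [lra|]. rewrite Rabs_R0. exact HX. }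
      destruct (HB _ Hbox) as [_ H3].
      pose proof (sinpi_ge (RtoC t) ltac:(simpl; lra)) as Hs.
      assert (Hr : Cmod (RtoC t) = Rabs t) by apply Cmod_R. rewrite Hr in *.
      assert (Hp : (0 < Rabs t)%R) by now apply Rabs_pos_lt.
      assert (Hn : sinpi (RtoC t) <> 0) by (intros E; rewrite E, Cmod_0 in Hs; lra).
      rewrite Cmod_mult, Cmod_inv, Cmod_mult by now apply Cmult_neq_0.
      apply Rmult_le_reg_r with (Cmod (sinpi t) * Cmod (sinpi t))%R; [nra|].
      rewrite Rmult_assoc, Rinv_l, Rmult_1_r by nra.
      eapply Rle_trans; [exact H3|].
      replace (M * Rabs t ^ 3)%R with (M * Rabs t * (Rabs t * Rabs t))%R by ring.
      apply Rmult_le_compat_l; [nra|]. nra. }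
    eapply Rle_trans; [apply Cmod_triangle|]. rewrite Cmod_opp.
    pose proof (G e ltac:(lra) ltac:(lra)) as G1.
    pose proof (G (- e)%R ltac:(lra) ltac:(lra)) as G2.
    rewrite Rabs_Ropp in G2. rewrite Rabs_pos_eq in G1, G2 by lra. nra.
  - replace (2 * M' * e)%R with (M' * (e - - e))%R by ring.
    assert (Hsn : forall t, (- e <= t <= e)%R ->
      (0 < Cmod (t, x))%R /\ (Cmod (t, x) <= Cmod (sinpi (t, x)))%R).
    { intros t Ht. split.
      - apply Cmod_gt_0. intros E. injection E. auto.
      - apply sinpi_ge. simpl. lra. }
    assert (Hnz : forall t, (- e <= t <= e)%R -> sinpi (t, x) <> 0).
    { intros t Ht E. destruct (Hsn t Ht) as [H1 H2]. rewrite E, Cmod_0 in H2. lra. }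
    apply (Cderiv_bound_le (fun t => rem_over_sin2 (t, x)) (fun t => rem_over_sin2_deriv (t, x))); [lra| |].
    + intros t Ht. eapply Cderiv_eq.
      * apply (rem_over_sin2_Cderiv (fun t => (t, x))); [|now apply Hnz|apply Cderiv_horizontal].
        apply Re_shift_pos. lra.
      * ring.
    + intros t Ht. destruct (Hsn t Ht) as [H1 H2]. pose proof (Hnz t Ht) as Hn.
      assert (Hbox : Box X (t, x)).
      { split; simpl; [lra|]. apply Rabs_le; lra. }
      destruct (HB _ Hbox) as [B2 B3].
      pose proof (Cmod_cospi_le (t, x)) as Hcs. simpl Im in Hcs.
      assert (Hcs' : (Cmod (cospi (t, x)) <= exp (PI * X))%R).
      { eapply Rle_trans; [exact Hcs|]. apply exp_le_compat.
        apply Rmult_le_compat_l; [lra|]. apply Rabs_le; lra. }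
      set (w := (t, x) : C) in *. set (s := Cmod (sinpi w)) in *. set (m := Cmod w) in *.
      unfold rem_over_sin2_deriv. eapply Rle_trans; [apply Cmod_triangle|]. rewrite Cmod_opp.
      rewrite !Cmod_mult, !Cmod_inv, !Cmod_mult
        by (assumption || (apply Cmult_neq_0; [assumption || now apply Cmult_neq_0 | assumption])).
      fold s.
      rewrite (Cmod_RtoC_pos 2), (Cmod_RtoC_pos PI) by lra.
      assert (Hs0 : (0 < s)%R) by lra.
      assert (E1 : (Cmod (taylor_rem2 w) * / (s * s) <= M)%R).
      { apply Rmult_le_reg_r with (s * s)%R; [nra|].
        rewrite Rmult_assoc, Rinv_l, Rmult_1_r by nra.
        eapply Rle_trans; [exact B2|]. apply Rmult_le_compat_l; [exact HM|]. nra. }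
      assert (E2 : (Cmod (taylor_rem3 w) * / (s * s * s) <= M)%R).
      { assert (0 < s * s * s)%R by (repeat apply Rmult_lt_0_compat; assumption).
        apply Rmult_le_reg_r with (s * s * s)%R; [assumption|].
        rewrite Rmult_assoc, Rinv_l, Rmult_1_r by lra.
        eapply Rle_trans; [exact B3|]. apply Rmult_le_compat_l; [exact HM|].
        replace (s * s * s)%R with (s ^ 3)%R by ring. apply pow_incr. lra. }
      replace (2 * PI * Cmod (taylor_rem3 w) * Cmod (cospi w) * / (s * s * s))%R with
        (2 * PI * ((Cmod (taylor_rem3 w) * / (s * s * s)) * Cmod (cospi w)))%R by ring.
      assert (E3 : (Cmod (taylor_rem3 w) * / (s * s * s) * Cmod (cospi w) <= M * exp (PI * X))%R).
      { apply Rmult_le_compat; try apply Cmod_ge_0; try assumption.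
        apply Rmult_le_pos; [apply Cmod_ge_0|]. left. apply Rinv_0_lt_compat.
        repeat apply Rmult_lt_0_compat; assumption. }
      unfold M'. nra.
Qed.

Lemma CInt_minus f g p q : Ccontinuous f -> Ccontinuous g ->
  CInt (fun x => f x - g x) p q = CInt f p q - CInt g p q.
Proof.
  intros Hf Hg. apply CInt_unique.
  apply (@is_RInt_minus C_R_NormedModule); now apply CInt_correct.
Qed.

Lemma CInt_bound f M p q : Ccontinuous f -> (p <= q)%R ->
  (forall x, (p <= x <= q)%R -> (Cmod (f x) <= M)%R) ->
  (Cmod (CInt f p q) <= M * (q - p))%R.
Proof.
  intros Hf Hpq HM.
  replace (CInt f p q) with (CInt f p q - CInt f p p) by (rewrite CInt_point; ring).
  apply (Cderiv_bound_le (fun x => CInt f p x) f); try assumption.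
  intros t _. now apply CInt_deriv.
Qed.

(** Cauchy's theorem for the rectangle with vertical sides Re w = 1/2 and Re w = -1/2: the
vertical sides are moved to Re w = e and Re w = -e, at the cost of the horizontal edges only,
and the remaining gap is O(e). *)
Lemma rectangle_bound X B : (0 <= X)%R ->
  (forall t, (- (1 / 2) <= t <= 1 / 2)%R ->
     (Cmod (rem_over_sin2 (t, X)) <= B)%R /\ (Cmod (rem_over_sin2 (t, - X)%R) <= B)%R) ->
  (Cmod (CInt (fun x => rem_over_sin2 ((1 / 2)%R, x) - rem_over_sin2 ((- (1 / 2))%R, x))%C (- X) X) <= 2 * B)%R.
Proof.
  intros HX HB.
  assert (HB0 : (0 <= B)%R).
  { eapply Rle_trans; [apply Cmod_ge_0 | apply (HB 0%R); lra]. }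
  destruct (gap_pointwise X HX) as [M [HM HG]].
  assert (C1 : Ccontinuous (fun x => rem_over_sin2 ((1 / 2)%R, x)))
    by (apply rem_over_sin2_line_continuous; rewrite Rabs_pos_eq; lra).
  assert (C2 : Ccontinuous (fun x => rem_over_sin2 ((- (1 / 2))%R, x)))
    by (apply rem_over_sin2_line_continuous; rewrite Rabs_left; lra).
  rewrite CInt_minus by assumption.
  apply Rle_add_eps. intros d Hd.
  set (K := (M * (2 * X) + 1)%R).
  assert (HK : (0 < K)%R) by (unfold K; nra).
  (* so small that the gap between Re w = e and Re w = -e contributes at most d *)
  set (e := Rmin (1 / 2) (d / K)).
  assert (He : (0 < e)%R).
  { apply Rmin_glb_lt; [lra|]. now apply Rdiv_lt_0_compat. }
  assert (He1 : (e <= 1 / 2)%R) by apply Rmin_l.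
  assert (He2 : (e <= d / K)%R) by apply Rmin_r.
  assert (HeK : (e * K <= d)%R).
  { apply Rmult_le_compat_r with (r := K) in He2; [|lra].
    replace (d / K * K)%R with d in He2 by (field; lra). exact He2. }
  pose proof (shift_right X e B ltac:(lra) HB) as S1.
  pose proof (shift_left X e B ltac:(lra) HB) as S2.
  assert (D1 : Ccontinuous (fun x => rem_over_sin2 (e, x)))
    by (apply rem_over_sin2_line_continuous; rewrite Rabs_pos_eq; lra).
  assert (D2 : Ccontinuous (fun x => rem_over_sin2 ((- e)%R, x)))
    by (apply rem_over_sin2_line_continuous; rewrite Rabs_left; lra).
  assert (S3 : (Cmod (CInt (fun x => rem_over_sin2 (e, x) - rem_over_sin2 ((- e)%R, x))%C (- X) X)
     <= M * e * (X - - X))%R).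
  { apply CInt_bound; [|lra|].
    - intros x. now apply Ccont_minus.
    - intros x Hx. apply HG; lra. }
  rewrite CInt_minus in S3 by assumption.
  set (I1 := CInt (fun x => rem_over_sin2 ((1 / 2)%R, x)) (- X) X) in *.
  set (I2 := CInt (fun x => rem_over_sin2 ((- (1 / 2))%R, x)) (- X) X) in *.
  set (J1 := CInt (fun x => rem_over_sin2 (e, x)) (- X) X) in *.
  set (J2 := CInt (fun x => rem_over_sin2 ((- e)%R, x)) (- X) X) in *.
  replace (I1 - I2) with ((I1 - J1) + ((J1 - J2) + (J2 - I2))) by ring.
  eapply Rle_trans; [apply Cmod_triangle|].
  pose proof (Cmod_triangle (J1 - J2) (J2 - I2)).
  assert (2 * B * (1 / 2 - e) <= B)%R by nra.
  assert (M * e * (X - - X) <= d)%R by (unfold K in HeK; nra).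
  lra.
Qed.
Lemma sinh_sq_large x : (1 <= Rabs x)%R -> (exp (6 * Rabs x) / 16 <= sinh (PI * x) ^ 2)%R.
Proof.
  intros Hx.
  assert (HPI : (3 <= PI)%R) by (pose proof PI2_3_2; lra).
  assert (E : (sinh (PI * x) ^ 2 = sinh (PI * Rabs x) ^ 2)%R).
  { unfold Rabs. destruct (Rcase_abs x); [|reflexivity].
    rewrite Ropp_mult_distr_r_reverse. unfold sinh. rewrite Ropp_involutive. field. }
  rewrite E. set (y := Rabs x) in *.
  assert (H1 : (exp (3 * y) <= exp (PI * y))%R) by (apply exp_le_compat; nra).
  assert (H2 : (exp (- (PI * y)) <= 1)%R) by (rewrite <- exp_0; apply exp_le_compat; nra).
  assert (H3 : (2 <= exp (3 * y))%R).
  { pose proof (exp_ineq1 (3 * y)%R ltac:(lra)). lra. }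
  replace (exp (6 * y) / 16)%R with ((exp (3 * y) / 4) ^ 2)%R.
  - apply pow_incr. unfold sinh. lra.
  - replace (6 * y)%R with (3 * y + 3 * y)%R by ring. rewrite exp_plus. field.
Qed.

(** F grows at most like exp|x| and the Taylor polynomial like x^2, against
sin^2(pi w) of order exp(2 pi |x|). *)
Lemma edge_decay : exists K, (0 <= K)%R /\ forall t x,
  (- (1 / 2) <= t <= 1 / 2)%R -> (1 <= Rabs x)%R ->
  (Cmod (rem_over_sin2 (t, x)) <= K * exp (- Rabs x))%R.
Proof.
  destruct (Fg 0 (Re b - 1 / 2)%R (Re b + 1 / 2)%R ltac:(lra)) as [C0 HC].
  set (A := (C0 * exp (Rabs (Im b)))%R).
  assert (HA : (0 <= A)%R).
  { eapply Rle_trans; [apply Cmod_ge_0 | apply (HC b); lra]. }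
  set (K := (A + Cmod (F 0 b) + Cmod (F 1 b) + Cmod (F 2 b))%R).
  pose proof (Cmod_ge_0 (F 0 b)) as P0. pose proof (Cmod_ge_0 (F 1 b)) as P1.
  pose proof (Cmod_ge_0 (F 2 b)) as P2.
  exists (16 * K)%R. split; [unfold K; lra|].
  intros t x Ht Hx. set (w := (t, x) : C). set (y := Rabs x) in *.
  set (E := exp y).
  assert (HE : (1 + y <= E)%R) by (left; apply exp_ineq1; lra).
  assert (Hw : (Cmod w <= E)%R).
  { eapply Rle_trans; [apply Cmod_le_parts|]. simpl. fold y.
    assert (Rabs t <= 1)%R by (apply Rabs_le; lra). lra. }
  assert (Hw0 := Cmod_ge_0 w).
  assert (HF : (Cmod (F 0 (b + w)) <= A * E)%R).
  { eapply Rle_trans; [apply HC; destruct b; simpl in *; lra|].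
    unfold A, E. rewrite Rmult_assoc, <- exp_plus.
    assert (HC0 : (0 <= C0)%R).
    { unfold A in HA. pose proof (exp_pos (Rabs (Im b))). nra. }
    apply Rmult_le_compat_l; [exact HC0|]. apply exp_le_compat.
    replace (Im (b + w)) with (Im b + x)%R by (destruct b; reflexivity).
    apply Rabs_triang. }
  assert (H3 : (Cmod (taylor_rem3 w) <= K * (E * E))%R).
  { unfold taylor_rem3. eapply Rle_trans; [apply Cmod_triangle|].
    eapply Rle_trans; [apply Rplus_le_compat_r, Cmod_triangle|].
    eapply Rle_trans; [apply Rplus_le_compat_r, Rplus_le_compat_r, Cmod_triangle|].
    rewrite !Cmod_opp, !Cmod_mult, Cmod_div, Cmod_mult, Cmod_RtoC_pos
      by (lra || exact C2_nz).
    assert (E1 : (1 <= E)%R) by lra.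
    assert (Cmod w * Cmod w <= E * E)%R by (apply Rmult_le_compat; assumption).
    assert (E <= E * E)%R by nra.
    assert (A * E <= A * (E * E))%R by (apply Rmult_le_compat_l; lra).
    assert (Cmod (F 0 b) <= Cmod (F 0 b) * (E * E))%R by nra.
    assert (Cmod w * Cmod (F 1 b) <= Cmod (F 1 b) * (E * E))%R by nra.
    assert (Cmod w * Cmod w / 2 * Cmod (F 2 b) <= Cmod (F 2 b) * (E * E))%R.
    { rewrite (Rmult_comm _ (Cmod (F 2 b))). apply Rmult_le_compat_l; [exact P2|]. nra. }
    unfold K. lra. }
  assert (Hs : (E * E * E * E * E * E / 16 <= Cmod (sinpi w * sinpi w))%R).
  { rewrite Cmod_mult. replace (Cmod (sinpi w) * Cmod (sinpi w))%R with (Cmod (sinpi w) ^ 2)%R by ring.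
    unfold w. rewrite Cmod_sinpi. pose proof (sinh_sq_large x Hx) as Hl. fold y in Hl.
    replace (E * E * E * E * E * E)%R with (exp (6 * y)).
    - pose proof (pow2_ge_0 (sin (PI * t))). lra.
    - unfold E. rewrite <- !exp_plus. f_equal. ring. }
  assert (HE0 : (1 <= E)%R) by lra.
  assert (HE2 : (1 <= E * E)%R) by nra.
  assert (HE3 : (E * E <= E * E * E)%R) by nra.
  assert (HE6 : (0 < E * E * E * E * E * E)%R) by (repeat apply Rmult_lt_0_compat; lra).
  assert (Hn : sinpi w * sinpi w <> 0).
  { apply Cmod_gt_0. lra. }
  unfold rem_over_sin2. rewrite Cmod_mult, Cmod_inv by exact Hn.
  set (s := Cmod (sinpi w * sinpi w)) in *.
  apply Rmult_le_reg_r with s; [lra|].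
  rewrite Rmult_assoc, Rinv_l, Rmult_1_r by lra.
  eapply Rle_trans; [exact H3|].
  rewrite exp_Ropp. fold E.
  assert (HK : (0 <= K)%R) by (unfold K; lra).
  apply Rle_trans with (16 * K * / E * (E * E * E * E * E * E / 16))%R.
  - replace (16 * K * / E * (E * E * E * E * E * E / 16))%R with
      (K * (E * E * (E * E * E)))%R by (field; lra).
    apply Rmult_le_compat_l; [exact HK|]. nra.
  - apply Rmult_le_compat_l; [|exact Hs].
    apply Rmult_le_pos; [lra|]. left. apply Rinv_0_lt_compat. lra.
Qed.

Definition difference (x : R) : C := F 0 (b + ((1 / 2)%R, x)) - F 0 (b + ((- (1 / 2))%R, x)).

(** With w+ and w- = -1/2 + ix on the two lines, w+ - w- = 1 and (w+^2 - w-^2) / 2 = ix; hence the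
subtracted Taylor polynomial leaves a multiple of the kernel and an odd function. *)
Lemma rem_over_sin2_difference x :
  rem_over_sin2 ((1 / 2)%R, x) - rem_over_sin2 ((- (1 / 2))%R, x) =
  difference x * RtoC (sech2 x) + - F 1 b * (1 * RtoC (sech2 x)) +
  (- Ci * F 2 b) * (RtoC x * RtoC (sech2 x)).
Proof.
  unfold rem_over_sin2. rewrite sinpi_half, sinpi_mhalf.
  assert (Hc : (cosh (PI * x) ^ 2 <> 0)%R).
  { apply Rgt_not_eq, pow_lt, cosh_pos. }
  rewrite <- RtoC_inv by exact Hc. change (/ cosh (PI * x) ^ 2)%R with (sech2 x).
  unfold difference.
  unfold taylor_rem3.
  replace (((1 / 2)%R, x) : C) with (((- (1 / 2))%R, x) + 1)
    by (apply C_ext; simpl; field).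
  assert (Ew : Ci * RtoC x = ((- (1 / 2))%R, x) + / 2).
  { rewrite <- RtoC_inv by lra. apply C_ext; simpl; field. }
  replace (- Ci * F 2 b * (RtoC x * RtoC (sech2 x))) with
    (- (Ci * RtoC x) * F 2 b * RtoC (sech2 x)) by ring.
  rewrite Ew. set (w := ((- (1 / 2))%R, x) : C). field.
Qed.

Lemma difference_dominated : Dominated (fun x => difference x * RtoC (sech2 x)).
Proof.
  destruct (Fg 0 (Re b - 1 / 2)%R (Re b + 1 / 2)%R ltac:(lra)) as [C0 HC].
  assert (HC0 : (0 <= C0)%R).
  { specialize (HC b ltac:(lra)). pose proof (Cmod_ge_0 (F 0 b)).
    pose proof (exp_pos (Rabs (Im b))). nra. }
  apply kernel_dominated with (C0 := (2 * (C0 * exp (Rabs (Im b))))%R).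
  - intros x. unfold difference. apply Ccont_minus.
    + apply (Fc 0 R_UniformSpace (fun x => b + ((1 / 2)%R, x))); [apply Re_shift_pos; lra|].
      eapply Cderiv_cont, Cderiv_shift, Cderiv_vertical.
    + apply (Fc 0 R_UniformSpace (fun x => b + ((- (1 / 2))%R, x))); [apply Re_shift_pos; lra|].
      eapply Cderiv_cont, Cderiv_shift, Cderiv_vertical.
  - intros x. unfold difference.
    assert (G : forall t, (- (1 / 2) <= t <= 1 / 2)%R ->
      (Cmod (F 0 (b + (t, x))) <= C0 * exp (Rabs (Im b)) * exp (Rabs x))%R).
    { intros t Ht. eapply Rle_trans; [apply HC; destruct b; simpl in *; lra|].
      rewrite Rmult_assoc, <- exp_plus.
      apply Rmult_le_compat_l; [exact HC0|]. apply exp_le_compat.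
      replace (Im (b + (t, x))) with (Im b + x)%R by (destruct b; reflexivity).
      apply Rabs_triang. }
    eapply Rle_trans; [apply Cmod_triangle|]. rewrite Cmod_opp.
    pose proof (G (1 / 2)%R ltac:(lra)). pose proof (G (- (1 / 2))%R ltac:(lra)). lra.
Qed.

(** By [rectangle_bound] and [edge_decay] the left side of [rem_over_sin2_difference] integrates
to 0. *)
Lemma difference_integral :
  line_int (fun x => difference x * RtoC (sech2 x)) = F 1 b * line_int (fun x => 1 * RtoC (sech2 x)).
Proof.
  set (f1 := fun x => rem_over_sin2 ((1 / 2)%R, x) - rem_over_sin2 ((- (1 / 2))%R, x)).
  assert (D0 := difference_dominated).
  assert (D1 := sech2_dominated). assert (D2 := id_sech2_dominated).
  assert (Ef : f1 = (fun x => difference x * RtoC (sech2 x) + - F 1 b * (1 * RtoC (sech2 x)) +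
    (- Ci * F 2 b) * (RtoC x * RtoC (sech2 x)))).
  { apply functional_extensionality. intros x. apply rem_over_sin2_difference. }
  assert (Df : Dominated f1).
  { rewrite Ef. apply Dominated_plus; [apply Dominated_plus; [exact D0|]|];
    now apply Dominated_scal. }
  assert (Z : line_int f1 = 0).
  { apply line_int_eq_lim; [exact Df|]. intros e He.
    destruct edge_decay as [K [HK HE]].
    destruct (exp_neg_small (2 * K) e He) as [M [HM0 HM]].
    exists (Rmax M 1). intros X HX. pose proof (Rmax_l M 1). pose proof (Rmax_r M 1).
    replace (CInt f1 (- X) X - 0) with (CInt f1 (- X) X) by ring.
    specialize (HM X ltac:(lra)).
    assert (RB := rectangle_bound X (K * exp (- X)) ltac:(lra)). fold f1 in RB.
    eapply Rle_trans; [apply RB|lra].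
    intros t Ht. split.
    - pose proof (HE t X Ht) as H1. rewrite Rabs_pos_eq in H1 by lra. apply H1; lra.
    - pose proof (HE t (- X)%R Ht) as H1. rewrite Rabs_Ropp, Rabs_pos_eq in H1 by lra.
      apply H1; lra. }
  rewrite Ef in Z.
  rewrite (line_int_linear3 _ _ _ _ _ D0 D1 D2), line_int_id_sech2 in Z.
  rewrite <- (Cplus_0_r (F 1 b * _)), <- Z. ring.
Qed.

End Difference.

(** * Powers of z and the difference equation *)

(** al (al - 1) ... (al - k + 1). *)
Fixpoint falling (al : C) (k : nat) : C :=
  match k with O => 1 | S j => falling al j * (al - INR j) end.

Definition power_deriv (al : C) (k : nat) (z : C) : C :=
  falling al k * Cpower z (al - INR k).

Lemma Cpower_pred z al : (0 < Re z)%R -> Cpower z (al - 1) = Cpower z al / z.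
Proof.
  intros H. unfold Cminus. rewrite Cpower_plus. unfold Cdiv. f_equal.
  unfold Cpower. replace (- (1) * Clog z) with (- Clog z) by ring.
  now rewrite Cexp_opp, Cexp_Clog.
Qed.

Lemma power_deriv_deriv al k (gam : R -> C) t l : (0 < Re (gam t))%R -> Cderiv gam t l ->
  Cderiv (fun u => power_deriv al k (gam u)) t (l * power_deriv al (S k) (gam t)).
Proof.
  intros Hp H. unfold power_deriv. eapply Cderiv_eq.
  - apply Cderiv_scal. unfold Cpower.
    apply (Cderiv_exp (fun u => (al - INR k) * Clog (gam u))).
    apply Cderiv_scal, Cderiv_log; [exact Hp | exact H].
  - replace (al - INR (S k)) with (al - INR k - 1) by (rewrite S_INR, RtoC_plus; ring).
    rewrite Cpower_pred by exact Hp. unfold Cpower. simpl falling.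
    field. now apply Re_pos_nz.
Qed.

Lemma power_deriv_cont al k (U : UniformSpace) (f : U -> C) x :
  (0 < Re (f x))%R -> Ccont f x -> Ccont (fun u => power_deriv al k (f u)) x.
Proof.
  intros Hp H. unfold power_deriv, Cpower. apply Ccont_mult; [apply Ccont_const|].
  apply Ccont_exp, Ccont_mult; [apply Ccont_const|]. now apply Ccont_log.
Qed.

Lemma Cpower_growth al c M : (0 < c)%R -> exists C0, (0 <= C0)%R /\
  forall z, (c <= Re z <= M)%R -> (Cmod (Cpower z al) <= C0 * exp (Rabs (Im z)))%R.
Proof.
  intros Hc. destruct (Clog_growth (Cmod al) c M (Cmod_ge_0 al) Hc) as [K HK].
  exists (exp K). split; [left; apply exp_pos|].
  intros z Hz. unfold Cpower. eapply Rle_trans; [apply Cmod_Cexp_le|].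
  rewrite Cmod_mult, <- exp_plus. apply exp_le_compat. now apply HK.
Qed.

Lemma power_deriv_growth al k c M : (0 < c)%R -> exists C0, forall z, (c <= Re z <= M)%R ->
  (Cmod (power_deriv al k z) <= C0 * exp (Rabs (Im z)))%R.
Proof.
  intros Hc. destruct (Cpower_growth (al - INR k) c M Hc) as [C0 [H0 HC]].
  exists (Cmod (falling al k) * C0)%R. intros z Hz. unfold power_deriv.
  rewrite Cmod_mult, Rmult_assoc. apply Rmult_le_compat_l; [apply Cmod_ge_0 | now apply HC].
Qed.

Definition log_line (a : C) (x : R) : C := Clog (a + RtoC x * Ci).

Lemma exp_moment_dominated (L : R -> C) w : Log_growth L ->
  Dominated (fun x => Cexp (w * L x) * RtoC (sech2 x)).
Proof.
  intros HL.
  replace (fun x => Cexp (w * L x) * RtoC (sech2 x)) with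
    (fun x => (Cexp (w * L x) * L x ^ 0) * RtoC (sech2 x)).
  - now apply moment_dominated.
  - apply functional_extensionality. intros x. simpl. ring.
Qed.

Lemma C_PI_nz : RtoC PI <> 0.
Proof. apply RtoC_neq0, PI_neq0. Qed.

(** The identity [difference_integral] for F(z) = z^(1-s). *)
Lemma exp_moment_step (b s : C) : (1 / 2 < Re b)%R ->
  exp_moment (log_line (b - / 2)) (1 - s) - exp_moment (log_line (b + / 2)) (1 - s) =
  2 * (s - 1) / PI * Cpower b (- s).
Proof.
  intros Hb.
  assert (E2 : / RtoC 2 = RtoC (/ 2)) by (rewrite RtoC_inv by lra; reflexivity).
  assert (G1 : Log_growth (log_line (b - / 2))).
  { apply Clog_line_growth. rewrite E2. destruct b; simpl in *; lra. }
  assert (G2 : Log_growth (log_line (b + / 2))).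
  { apply Clog_line_growth. rewrite E2. destruct b; simpl in *; lra. }
  pose proof (difference_integral (power_deriv (1 - s)) (power_deriv_deriv (1 - s))
    (power_deriv_cont (1 - s)) (power_deriv_growth (1 - s)) b Hb) as H.
  rewrite line_int_sech2 in H.
  assert (E : line_int (fun x => difference (power_deriv (1 - s)) b x * RtoC (sech2 x)) =
    exp_moment (log_line (b + / 2)) (1 - s) + - (1) * exp_moment (log_line (b - / 2)) (1 - s)).
  { unfold exp_moment.
    assert (D1 := exp_moment_dominated _ (1 - s) G1). assert (D2 := exp_moment_dominated _ (1 - s) G2).
    rewrite <- (line_int_scal _ _ D1), <- (line_int_plus _ _ D2 (Dominated_scal _ _ D1)).
    apply line_int_ext. intros x. unfold difference, power_deriv, Cpower, log_line.
    replace (b + ((1 / 2)%R, x)) with (b + / 2 + RtoC x * Ci)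
      by (rewrite E2; apply C_ext; simpl; field).
    replace (b + ((- (1 / 2))%R, x)) with (b - / 2 + RtoC x * Ci)
      by (rewrite E2; apply C_ext; simpl; field).
    simpl. replace (1 - s - 0) with (1 - s) by ring. ring. }
  rewrite E in H.
  unfold power_deriv in H. simpl in H.
  replace (1 - s - 1) with (- s) in H by ring.
  rewrite RtoC_div in H by apply PI_neq0.
  replace (exp_moment (log_line (b - / 2)) (1 - s) - exp_moment (log_line (b + / 2)) (1 - s)) with
    (- (exp_moment (log_line (b + / 2)) (1 - s) + - (1) * exp_moment (log_line (b - / 2)) (1 - s))) by ring.
  rewrite H. field. exact C_PI_nz.
Qed.

(** |z^(1-s)| = |z|^(1 - Re s) exp(Im s * arg z), and |z| >= Re a + n on the whole line. *)
Lemma exp_moment_vanishes (a s : C) : (0 < Re a)%R -> (1 < Re s)%R -> forall e, (0 < e)%R ->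
  exists N, forall n, (N <= n)%nat ->
    (Cmod (exp_moment (log_line (a + INR n)) (1 - s)) < e)%R.
Proof.
  intros Ha Hs e He.
  set (K := exp (Rabs (Im s) * PI)).
  destruct (exp_neg_small (2 * (4 * K)) e He) as [M [HM0 HM]].
  destruct (INR_unbounded (exp (M / (Re s - 1)))) as [N HN].
  exists N. intros n Hn.
  assert (Hn' : (exp (M / (Re s - 1)) < Re a + INR n)%R).
  { apply le_INR in Hn. lra. }
  set (r := (Re a + INR n)%R) in *.
  assert (Hr : (0 < r)%R) by (pose proof (exp_pos (M / (Re s - 1))); lra).
  assert (HMr : (M <= (Re s - 1) * ln r)%R).
  { apply ln_increasing in Hn'; [|apply exp_pos]. rewrite ln_exp in Hn'.
    apply Rmult_lt_compat_l with (r := (Re s - 1)%R) in Hn'; [|lra].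
    replace ((Re s - 1) * (M / (Re s - 1)))%R with M in Hn' by (field; lra). lra. }
  specialize (HM _ HMr).
  assert (Er : forall x, Re (a + INR n + RtoC x * Ci) = r)
    by (intros x; unfold r; destruct a; simpl; ring).
  assert (G : Log_growth (log_line (a + INR n))).
  { apply Clog_line_growth. specialize (Er 0%R). 
    replace (Re (a + INR n)) with r by (unfold r; destruct a; simpl; ring). exact Hr. }
  eapply Rle_lt_trans; [|exact HM].
  rewrite Rmult_assoc.
  replace (4 * K * exp (- ((Re s - 1) * ln r)))%R with
    (4 * (K * exp (- ((Re s - 1) * ln r))))%R by ring.
  apply line_int_bound.
  - apply (exp_moment_dominated _ (1 - s) G).
  - apply kernel_bound. intros x. rewrite Cmod_Cexp.
    unfold K. rewrite <- !exp_plus. apply exp_le_compat.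
    set (z := a + INR n + RtoC x * Ci).
    assert (Hz : (0 < Re z)%R) by (unfold z; rewrite Er; exact Hr).
    pose proof (Clog_Im_bound z Hz) as Hi. pose proof PI_RGT_0.
    assert (Hl : (ln r <= Re (Clog z))%R).
    { change (Re (Clog z)) with (ln (Cmod z)).
      assert (r <= Cmod z)%R.
      { rewrite <- (Er x). fold z. eapply Rle_trans; [apply Rle_abs | apply re_le_Cmod]. }
      destruct (Req_dec r (Cmod z)) as [->|]; [lra|]. left; apply ln_increasing; lra. }
    unfold log_line. fold z.
    replace (Re ((1 - s) * Clog z)) with
      (- ((Re s - 1) * Re (Clog z)) + Im s * Im (Clog z))%R
      by (destruct s, (Clog z); simpl; ring).
    assert (H1 : (Im s * Im (Clog z) <= Rabs (Im s) * PI)%R).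
    { eapply Rle_trans; [apply Rle_abs|]. rewrite Rabs_mult.
      apply Rmult_le_compat_l; [apply Rabs_pos|]. apply Rabs_le; lra. }
    assert (H2 : ((Re s - 1) * ln r <= (Re s - 1) * Re (Clog z))%R)
      by (apply Rmult_le_compat_l; lra).
    pose proof (Rabs_pos x). lra.
Qed.

(** * The Hurwitz zeta function *)

Definition zeta_integral (v s : C) : C :=
  (PI / 2 * exp_moment (log_line (v - / 2)) (1 - s)) / (s - 1).

Lemma shift_Re_half (v : C) : Re (v - / 2) = (Re v - 1 / 2)%R.
Proof.
  rewrite <- (RtoC_inv 2) by lra. destruct v; simpl. lra.
Qed.

(** Telescoping of [exp_moment_step]. *)
Lemma zeta_integral_series (v s : C) : (1 / 2 < Re v)%R -> (1 < Re s)%R ->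
  is_Cseries (fun k => Cpower (INR k + v) (- s)) (zeta_integral v s).
Proof.
  intros Hv Hs.
  assert (Hs1 : s - 1 <> 0).
  { apply Cminus_eq_contra. intros E. rewrite E in Hs. simpl in Hs. lra. }
  set (J := fun n => exp_moment (log_line (v - / 2 + INR n)) (1 - s)).
  assert (S1 : forall k, Cpower (INR k + v) (- s) = PI / 2 / (s - 1) * (J k - J (S k))).
  { intros k. unfold J.
    pose proof (exp_moment_step (INR k + v) s) as H.
    replace (INR k + v - / 2) with (v - / 2 + INR k) in H by ring.
    replace (INR k + v + / 2) with (v - / 2 + INR (S k)) in H
      by (rewrite S_INR, RtoC_plus; field).
    rewrite H; [field; repeat split; (exact Hs1 || exact C_PI_nz)|].
    pose proof (pos_INR k). destruct v; simpl in *. lra. }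
  assert (S2 : forall n, @eq C (sum_n (fun k => Cpower (INR k + v) (- s)) n)
    (PI / 2 / (s - 1) * (J 0%nat - J (S n)))).
  { induction n.
    - rewrite sum_O. apply S1.
    - rewrite Csum_Sn, IHn, S1. ring. }
  apply is_Cseries_eps. intros e He.
  set (c := PI / 2 / (s - 1)) in *. pose proof (Cmod_ge_0 c) as Hc.
  assert (Ha : (0 < Re (v - / 2))%R) by (rewrite shift_Re_half; lra).
  destruct (exp_moment_vanishes (v - / 2) s Ha Hs (e / (Cmod c + 1))%R) as [N HN].
  { apply Rdiv_lt_0_compat; lra. }
  exists N. intros n Hn. rewrite S2.
  replace (zeta_integral v s) with (c * J 0%nat).
  - replace (c * (J 0%nat - J (S n)) - c * J 0%nat) with (- (c * J (S n))) by ring.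
    rewrite Cmod_opp, Cmod_mult.
    specialize (HN (S n) ltac:(lia)). fold (J (S n)) in HN.
    apply Rmult_lt_compat_l with (r := (Cmod c + 1)%R) in HN; [|lra].
    replace ((Cmod c + 1) * (e / (Cmod c + 1)))%R with e in HN by (field; lra).
    pose proof (Cmod_ge_0 (J (S n))). lra.
  - unfold zeta_integral, J, c. simpl INR. rewrite Cplus_0_r. field. exact Hs1.
Qed.

Lemma zeta_integral_analytic (v s0 : C) : (1 / 2 < Re v)%R -> s0 <> 1 ->
  analytic_at (zeta_integral v) s0.
Proof.
  intros Hv Hs.
  assert (G : Log_growth (log_line (v - / 2))).
  { apply Clog_line_growth. rewrite shift_Re_half. lra. }
  apply (analytic_quotient (fun s => PI / 2 * exp_moment (log_line (v - / 2)) (1 - s))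
    (fun n => PI / 2 * ((- (1)) ^ n / INR (fact n) * moment (log_line (v - / 2)) (1 - s0) n)));
    [exact Hs|].
  intros s.
  pose proof (exp_moment_expansion _ G (1 - s0) (- (s - s0))) as H.
  replace (1 - s0 + - (s - s0)) with (1 - s) in H by ring.
  eapply is_Cseries_ext; [|apply (is_Cseries_scal (PI / 2) _ _ H)].
  intros n. cbv beta. replace (- (s - s0)) with (- (1) * (s - s0)) by ring.
  rewrite Cpow_mult_l. unfold Cdiv. ring.
Qed.

Lemma hurwitz_zeta_integral (v s : C) : (1 / 2 < Re v)%R -> s <> 1 ->
  hurwitz_zeta s v = zeta_integral v s.
Proof.
  intros Hv Hs.
  assert (Hex : exists f, is_hurwitz_zeta v f).
  { exists (zeta_integral v). split.
    - intros s1 H1. now apply zeta_integral_analytic.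
    - intros s1 H1. now apply zeta_integral_series. }
  pose proof (epsilon_spec (inhabits (fun _ : C => RtoC 0)) (is_hurwitz_zeta v) Hex)
    as [Ha Hser].
  unfold hurwitz_zeta. set (f := epsilon _ _) in *.
  apply Ceq_minus.
  apply (identity_theorem (fun s => f s - zeta_integral v s)); [| |exact Hs].
  - intros s1 H1. apply analytic_at_minus; [now apply Ha | now apply zeta_integral_analytic].
  - intros s1 H1. apply (proj1 (Ceq_minus _ _)).
    eapply is_Cseries_unique; [now apply Hser | now apply zeta_integral_series].
Qed.

(** * The Stieltjes constants *)

Definition stieltjes_integral (v : C) (n : nat) : C :=
  - (PI / (2 * (INR n + 1))) *
    line_int (fun x => log_line (v - / 2) x ^ (n + 1) * RtoC (sech2 x)).

Lemma moment_0 L k : moment L 0 k = line_int (fun x => L x ^ k * RtoC (sech2 x)).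
Proof.
  apply line_int_ext. intros x. rewrite Cmult_0_l, Cexp_0. ring.
Qed.

(** In the expansion of the integral of exp(-(s-1) L) K around s = 1, the term of order 0 is
int K = 2 / pi; after multiplication by pi / (2 (s - 1)) it is the polar part. *)
Lemma stieltjes_integral_spec v : (1 / 2 < Re v)%R -> is_stieltjes v (stieltjes_integral v).
Proof.
  intros Hv s Hs. rewrite hurwitz_zeta_integral by assumption.
  assert (Hs1 : s - 1 <> 0) by now apply Cminus_eq_contra.
  set (L := log_line (v - / 2)).
  assert (G : Log_growth L).
  { apply Clog_line_growth. rewrite shift_Re_half. lra. }
  pose proof (exp_moment_expansion L G 0 (- (s - 1))) as H.
  replace (0 + - (s - 1)) with (1 - s) in H by ring.
  assert (H1 : is_Cseries (fun k => (- (s - 1)) ^ S k / INR (fact (S k)) * moment L 0 (S k))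
    (exp_moment L (1 - s) - 2 / PI)).
  { apply (@is_series_incr_1 C_AbsRing C_NormedModule
      (fun k => (- (s - 1)) ^ k / INR (fact k) * moment L 0 k)).
    replace (plus (exp_moment L (1 - s) - 2 / PI) _) with (exp_moment L (1 - s)); [exact H|].
    change (exp_moment L (1 - s) = exp_moment L (1 - s) - 2 / PI +
      (- (s - 1)) ^ 0 / INR (fact 0) * moment L 0 0).
    rewrite moment_0. simpl. rewrite line_int_sech2, RtoC_div by apply PI_neq0. field. exact C_PI_nz. }
  pose proof (is_Cseries_scal (PI / 2 / (s - 1)) _ _ H1) as H2.
  replace (zeta_integral v s - 1 / (s - 1)) with
    (PI / 2 / (s - 1) * (exp_moment L (1 - s) - 2 / PI)).
  - eapply is_Cseries_ext; [|exact H2]. intros n. cbv beta.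
    unfold stieltjes_integral. rewrite moment_0. fold L.
    replace (n + 1)%nat with (S n) by lia.
    replace (- (s - 1)) with (- (1) * (s - 1)) by ring.
    rewrite Cpow_mult_l, !Cpow_S.
    change (fact (S n)) with (S n * fact n)%nat. rewrite mult_INR, RtoC_mult, S_INR, RtoC_plus.
    field. repeat split.
    + rewrite <- RtoC_plus, <- S_INR. apply RtoC_neq0. now apply not_0_INR.
    + apply RtoC_neq0, INR_fact_neq_0.
    + exact Hs1.
  - unfold zeta_integral. fold L. field. repeat split; (exact Hs1 || exact C_PI_nz).
Qed.

Lemma stieltjes_unique v g g' : is_stieltjes v g -> is_stieltjes v g' -> forall n, g n = g' n.
Proof.
  intros Hg Hg' n.
  assert (Z : forall n, (- (1)) ^ n / INR (fact n) * (g n - g' n) = 0).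
  { apply (power_series_zero_coef _ (fun _ => 0) 1%R); [lra| |].
    - intros z Hz _.
      assert (Hs : 1 + z <> 1).
      { intros E. apply Hz. replace z with (1 + z - 1) by ring. rewrite E. ring. }
      pose proof (is_Cseries_minus _ _ _ _ (Hg _ Hs) (Hg' _ Hs)) as H.
      rewrite (proj1 (Ceq_minus _ _) eq_refl) in H.
      eapply is_Cseries_ext; [|exact H]. intros k. cbv beta.
      replace (1 + z - 1) with z by ring. ring.
    - intros d Hd. exists (RtoC (d / 2)). split; [apply RtoC_neq0; lra|].
      split; [rewrite Cmod_RtoC_pos; lra | reflexivity]. }
  specialize (Z n). apply Ceq_minus.
  assert (N1 : (- (1)) ^ n <> 0).
  { apply Cpow_nz. intros E. injection E. lra. }
  assert (N2 : RtoC (INR (fact n)) <> 0) by apply RtoC_neq0, INR_fact_neq_0.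
  replace (g n - g' n) with
    (INR (fact n) / (- (1)) ^ n * ((- (1)) ^ n / INR (fact n) * (g n - g' n)))
    by (field; split; assumption).
  rewrite Z. ring.
Qed.

Lemma stieltjes_eq v n : (1 / 2 < Re v)%R -> stieltjes n v = stieltjes_integral v n.
Proof.
  intros Hv. apply (stieltjes_unique v); [|now apply stieltjes_integral_spec].
  apply (epsilon_spec (inhabits (fun _ : nat => RtoC 0)) (is_stieltjes v)).
  exists (stieltjes_integral v). now apply stieltjes_integral_spec.
Qed.

(** * The shapes of the integrands *)

Lemma div_cosh_sq z x : z / RtoC (cosh (PI * x)) ^ 2 = z * RtoC (sech2 x).
Proof.
  unfold sech2, Cdiv. rewrite <- RtoC_pow, RtoC_inv; [reflexivity|].
  apply Rgt_not_eq, pow_lt, cosh_pos.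
Qed.

Lemma is_int_line_ext f g I : (forall x, f x = g x) -> is_int_line f I -> is_int_line g I.
Proof.
  intros E H. replace g with f; [exact H|].
  now apply functional_extensionality.
Qed.

Lemma is_int_halfline_ext f g I :
  (forall x, f x = g x) -> is_int_halfline f I -> is_int_halfline g I.
Proof.
  intros E H. replace g with f; [exact H|].
  now apply functional_extensionality.
Qed.

Lemma line_both_signs (H : C -> C) (v : C) (e : R) :
  Dominated (fun x => H (v - / 2 + RtoC x * Ci) * RtoC (sech2 x)) ->
  e = 1%R \/ e = (-1)%R ->
  is_int_line (fun x => H (v - 1 / 2 + e * (Ci * x)) / RtoC (cosh (PI * x)) ^ 2)
    (line_int (fun x => H (v - / 2 + RtoC x * Ci) * RtoC (sech2 x))).
Proof.
  intros D [-> | ->].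
  - eapply is_int_line_ext; [|exact (line_int_correct _ D)]. intros x. cbv beta.
    rewrite div_cosh_sq. do 2 f_equal. field.
  - rewrite <- (line_int_flip _ D).
    eapply is_int_line_ext; [|exact (line_int_correct _ (Dominated_flip _ D))]. intros x. cbv beta.
    rewrite div_cosh_sq, sech2_even. do 2 f_equal. rewrite !RtoC_opp. field.
Qed.

Lemma halfline_sum (H : C -> C) (v : C) :
  Dominated (fun x => H (v - / 2 + RtoC x * Ci) * RtoC (sech2 x)) ->
  is_int_halfline (fun x : R => (H (v - 1 / 2 - Ci * x) + H (v - 1 / 2 + Ci * x))
      / RtoC (cosh (PI * x)) ^ 2)
    (line_int (fun x => H (v - / 2 + RtoC x * Ci) * RtoC (sech2 x))).
Proof.
  intros D. eapply is_int_halfline_ext; [|exact (line_int_halfline _ D)]. intros x. cbv beta.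
  rewrite div_cosh_sq, sech2_even, RtoC_opp.
  replace (v - 1 / 2 - Ci * x) with (v - / 2 + - RtoC x * Ci) by field.
  replace (v - 1 / 2 + Ci * x) with (v - / 2 + RtoC x * Ci) by field.
  ring.
Qed.

Lemma Clog_product (P M : C) : (0 < Re P)%R -> (0 < Re M)%R -> Clog (P * M) = Clog P + Clog M.
Proof.
  intros HP HM. pose proof (Clog_Im_bound P HP). pose proof (Clog_Im_bound M HM).
  rewrite <- (Cexp_Clog P) at 1 by exact HP. rewrite <- (Cexp_Clog M) at 1 by exact HM.
  rewrite <- Cexp_plus. apply Clog_Cexp. simpl Im in *. lra.
Qed.

Lemma Clog_ratio (P M : C) : (0 < Re P)%R -> (0 < Re M)%R -> Clog (P / M) = Clog P - Clog M.
Proof.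
  intros HP HM. pose proof (Clog_Im_bound P HP). pose proof (Clog_Im_bound M HM).
  rewrite <- (Cexp_Clog P) at 1 by exact HP. rewrite <- (Cexp_Clog M) at 1 by exact HM.
  unfold Cdiv. rewrite <- Cexp_opp, <- Cexp_plus. apply Clog_Cexp. simpl Im in *. lra.
Qed.

(** With p = log(a + ix) and m = log(a - ix), the base of the power is exp(p + m) and the
arctangent is (i / 2)(m - p); the logarithm of a itself cancels. *)
Lemma arctan_form (a s : C) (x : R) : (0 < Re (a + Ci * x))%R -> (0 < Re (a - Ci * x))%R ->
  (0 < Re a)%R ->
  Ccos ((s - 1) * Carctan (x / a)) / Cpower (a * a + x * x) (1 / 2 * (s - 1)) =
  / 2 * (Cpower (a - Ci * x) (1 - s) + Cpower (a + Ci * x) (1 - s)).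
Proof.
  intros HP HM Ha. pose proof (Re_pos_nz a Ha) as Hn.
  assert (HC : Ci * Ci = - (1)) by (apply C_ext; simpl; ring).
  set (P := a + Ci * x) in *. set (M := a - Ci * x) in *.
  unfold Carctan.
  replace (1 - Ci * (x / a)) with (M / a) by (unfold M; field; exact Hn).
  replace (1 + Ci * (x / a)) with (P / a) by (unfold P; field; exact Hn).
  rewrite !Clog_ratio by assumption.
  replace (a * a + x * x) with (P * M).
  2: { unfold P, M. replace ((a + Ci * x) * (a - Ci * x)) with (a * a - (Ci * Ci) * (x * x)) by ring.
       rewrite HC. ring. }
  unfold Cpower. rewrite Clog_product by assumption.
  set (p := Clog P). set (m := Clog M). set (l := Clog a).
  unfold Ccos.
  replace (Ci * ((s - 1) * (Ci / 2 * (m - l - (p - l))))) with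
    ((Ci * Ci) * ((s - 1) / 2 * (m - p))) by (unfold Cdiv; ring).
  rewrite HC.
  replace (- (1) * ((s - 1) / 2 * (m - p))) with
    ((1 - s) * m + (s - 1) / 2 * (p + m)) by field.
  replace (- ((1 - s) * m + (s - 1) / 2 * (p + m))) with
    ((1 - s) * p + (s - 1) / 2 * (p + m)) by field.
  replace (1 / 2 * (s - 1) * (p + m)) with ((s - 1) / 2 * (p + m)) by field.
  rewrite !Cexp_plus. field. apply Cexp_nz.
Qed.

Theorem theorem1 (v : C) (hv : (1 / 2 < Re v)%R) :
  (forall s : C, s <> 1 ->
    (forall e : R, e = 1%R \/ e = (-1)%R ->
      exists I : C,
        is_int_line
          (fun x : R => Cpower (v - 1 / 2 + e * (Ci * x)) (1 - s)
                        / (cosh (PI * x)) ^ 2) I /\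
        hurwitz_zeta s v = PI / (2 * (s - 1)) * I) /\
    (exists I : C,
      is_int_halfline
        (fun x : R => (Cpower (v - 1 / 2 - Ci * x) (1 - s)
                       + Cpower (v - 1 / 2 + Ci * x) (1 - s))
                      / (cosh (PI * x)) ^ 2) I /\
      hurwitz_zeta s v = PI / (2 * (s - 1)) * I) /\
    (exists I : C,
      is_int_halfline
        (fun x : R => Ccos ((s - 1) * Carctan (2 * x / (2 * v - 1)))
                      / (Cpower (v ^ 2 - v + 1 / 4 + x ^ 2) (1 / 2 * (s - 1))
                         * (cosh (PI * x)) ^ 2)) I /\
      hurwitz_zeta s v = PI / (s - 1) * I)) /\
  (forall n : nat,
    (forall e : R, e = 1%R \/ e = (-1)%R ->
      exists I : C,
        is_int_line
          (fun x : R => Clog (v - 1 / 2 + e * (Ci * x)) ^ (n + 1)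
                        / (cosh (PI * x)) ^ 2) I /\
        stieltjes n v = - (PI / (2 * (INR n + 1))) * I) /\
    (exists I : C,
      is_int_halfline
        (fun x : R => (Clog (v - 1 / 2 - Ci * x) ^ (n + 1)
                       + Clog (v - 1 / 2 + Ci * x) ^ (n + 1))
                      / (cosh (PI * x)) ^ 2) I /\
      stieltjes n v = - (PI / (2 * (INR n + 1))) * I)).
Proof.
  assert (G : Log_growth (log_line (v - / 2))).
  { apply Clog_line_growth. rewrite shift_Re_half. lra. }
  split.
  - intros s Hs.
    assert (Hs1 : s - 1 <> 0) by now apply Cminus_eq_contra.
    assert (D : Dominated (fun x => Cpower (v - / 2 + RtoC x * Ci) (1 - s) * RtoC (sech2 x)))
      by exact (exp_moment_dominated _ (1 - s) G).
    assert (Z : hurwitz_zeta s v = PI / (2 * (s - 1)) *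
      line_int (fun x => Cpower (v - / 2 + RtoC x * Ci) (1 - s) * RtoC (sech2 x))).
    { rewrite hurwitz_zeta_integral by assumption. unfold zeta_integral.
      change (line_int (fun x => Cpower (v - / 2 + RtoC x * Ci) (1 - s) * RtoC (sech2 x))) with
        (exp_moment (log_line (v - / 2)) (1 - s)). field. exact Hs1. }
    split; [|split].
    + intros e He. eexists. split; [|exact Z].
      exact (line_both_signs (fun z => Cpower z (1 - s)) v e D He).
    + eexists. split; [|exact Z].
      exact (halfline_sum (fun z => Cpower z (1 - s)) v D).
    + exists (/ 2 * line_int (fun x => Cpower (v - / 2 + RtoC x * Ci) (1 - s) * RtoC (sech2 x))).
      split.
      * rewrite <- line_int_scal by exact D.
        eapply is_int_halfline_ext; [|exact (line_int_halfline _ (Dominated_scal (/ 2) _ D))].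
        intros x. cbv beta. rewrite sech2_even, RtoC_opp.
        assert (Ha : (0 < Re (v - / 2))%R) by (rewrite shift_Re_half; lra).
        set (a := v - / 2) in *.
        replace (2 * x / (2 * v - 1)) with (x / a).
        2: { replace v with (a + / 2) by (unfold a; ring).
             replace (2 * (a + / 2) - 1) with (2 * a) by field.
             field. now apply Re_pos_nz. }
        replace (v ^ 2 - v + 1 / 4 + x ^ 2) with (a * a + x * x).
        2: { replace v with (a + / 2) by (unfold a; ring). field. }
        assert (HP : (0 < Re (a + Ci * x))%R) by (destruct a; simpl in *; lra).
        assert (HM : (0 < Re (a - Ci * x))%R) by (destruct a; simpl in *; lra).
        transitivity (Ccos ((s - 1) * Carctan (x / a)) /
          Cpower (a * a + x * x) (1 / 2 * (s - 1)) / RtoC (cosh (PI * x)) ^ 2).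
        -- rewrite div_cosh_sq, arctan_form by assumption.
           replace (a - Ci * x) with (a + - RtoC x * Ci) by ring.
           replace (a + Ci * x) with (a + RtoC x * Ci) by ring. ring.
        -- field. split.
           ++ apply RtoC_neq0, Rgt_not_eq, cosh_pos.
           ++ apply Cexp_nz.
      * rewrite Z. field. exact Hs1.
  - intros n.
    assert (D : Dominated (fun x => Clog (v - / 2 + RtoC x * Ci) ^ (n + 1) * RtoC (sech2 x))).
    { replace (fun x => Clog (v - / 2 + RtoC x * Ci) ^ (n + 1) * RtoC (sech2 x)) with
        (fun x => (Cexp (0 * log_line (v - / 2) x) * log_line (v - / 2) x ^ (n + 1))
           * RtoC (sech2 x)).
      - now apply moment_dominated.
      - apply functional_extensionality. intros x.
        rewrite Cmult_0_l, Cexp_0. unfold log_line. ring. }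
    pose proof (stieltjes_eq v n hv) as Z. unfold stieltjes_integral in Z.
    split.
    + intros e He. eexists. split; [|exact Z].
      exact (line_both_signs (fun z => Clog z ^ (n + 1)) v e D He).
    + eexists. split; [|exact Z].
      exact (halfline_sum (fun z => Clog z ^ (n + 1)) v D).
Qed.
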